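(* Let ${\bf T}\in\mathbb{C}^{p\times m}(z)$ have a minimal realization centered at $z_0\in\partial\mathbb{D}\setminus\Lambda(A-zE)$ $${\bf T}(z)=\begin{bmatrix}{\bf T}_{11}&{\bf T}_{12}\\{\bf T}_{21}&{\bf T}_{22}\end{bmatrix}(z)=\left[\begin{array}{c|cc}A-zE&B_1&B_2\\ \hline C_1&0&D_{12}\\ C_2&D_{21}&0\end{array}\right]_{z_0},$$ of order $n$, where ${\bf T}_{ij}$ is $p_i\times m_j$. Assume that: - $(A-zE,B_2)$ is stabilizable and $(C_2,A-zE)$ is detectable; - $\mathrm{rank}\begin{bmatrix}A-e^{j\theta}E&B_2(\alpha-\beta e^{j\theta})\\ C_1&D_{12}\end{bmatrix}=n+m_2$ for all $\theta\in[0,2\pi)$; - $\mathrm{rank}\begin{bmatrix}A-e^{j\theta}E&B_1(\alpha-\beta e^{j\theta})\\ C_2&D_{21}\end{bmatrix}=n+p_2$ for all $\theta\in[0,2\pi)$. Suppose that DDTARE$(\Sigma_c)$ and DDTARE$(\Sigma_\times)$ have stabilizing solutions $X=X^*\le0$ and $Z=Z^*\le0$, respectively. Then there exists a controller ${\bf K}\in\mathbb{C}^{m_2\times p_2}(z)$ that solves the suboptimal $\mathcal{H}_\infty$ control problem for ${\bf T}$. Moreover, the set of all such ${\bf K}$ is given by $${\bf K}={\bf LFT}({\bf C},{\bf Q}),$$ where ${\bf Q}\in\mathcal{BH}_\infty$ (of size $m_2\times p_2$) is arbitrary and $${\bf C}(z)=\left[\begin{array}{c|cc}A-zE+(BF_c+B_ZC_F)(\alpha-\beta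 z)&B_Z&-B_2(D_{12}^*D_{12})^{-1/2}+(\alpha E-\beta A)ZF_2^*(D_{12}^*D_{12})^{1/2}\\ \hline -F_2&0&(D_{12}^*D_{12})^{-1/2}\\ (D_{21}D_{21}^* )^{-1/2}C_F&(D_{21}D_{21}^* )^{-1/2}&0\end{array}\right]_{z_0},$$ with $B:=[B_1\ \ B_2]$, $C_F:=C_2+D_{21}F_1$, $B_Z:=-\big(B_1D_{21}^*+(\alpha E-\beta A)ZC_F^*\big)(D_{21}D_{21}^* )^{-1}$, and $F_c=\begin{bmatrix}F_1\\ F_2\end{bmatrix}$ the stabilizing feedback of $\Sigma_c$. (The data $\Sigma_c$, $F_c$, $\Sigma_\times$ are defined in the context.)
   Context: $\mathbb{D}$ is the open unit disk, $\partial\mathbb{D}$ the unit circle, $*$ the conjugate transpose, $\mathbb{C}^{p\times m}(z)$ the $p\times m$ rational matrices with complex coefficients (possibly improper or polynomial). Fix $\alpha\in\mathbb{C}$, $|\alpha|=1$, $\beta:=\bar\alpha$, $z_0:=\alpha/\beta=\alpha^2$. $M^{1/2}$ is the Hermitian positive definite square root of a positive definite $M$, and $M^{-1/2}$ its inverse. (The rank conditions at $e^{j\theta}=z_0$ give $D_{12}^*D_{12}$ and $D_{21}D_{21}^*$ invertible.) Centered realization: $\left[\begin{array}{c|c}A-zE&B\\ \hline C&D\end{array}\right]_{z_0}:=D+C(zE-A)^{-1}B(\alpha-\beta z)$, with $A,E\in\mathbb{C}^{n\times n}$ and $A-zE$ regular ($\det(A-zE)\not\equiv0$; $E$ may be singular);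 it is minimal if its order $n$ is smallest possible among realizations of this type. $\Lambda(A-zE)$ is the collection of generalized eigenvalues (finite and infinite). $A-zE+M(\alpha-\beta z)$ denotes the pencil $(A+\alpha M)-z(E+\beta M)$. $(A-zE,B)$ is stabilizable if $\mathrm{rank}[A-zE\ \ B]=n$ for all $z\in\mathbb{C}\setminus\mathbb{D}$ and $\mathrm{rank}[E\ \ B]=n$; $(C,A-zE)$ is detectable if $(A^*-zE^*,C^* )$ is stabilizable. $\mathcal{RH}_\infty$ is the set of rational matrices analytic in $(\mathbb{C}\cup\{\infty\})\setminus\mathbb{D}$; $\|{\bf G}\|_\infty:=\sup_{\theta\in[0,2\pi)}\sigma_{\max}({\bf G}(e^{j\theta}))$; $\mathcal{BH}_\infty:=\{{\bf G}\in\mathcal{RH}_\infty:\|{\bf G}\|_\infty<1\}$. For a $2\times2$ block system ${\bf T}$, ${\bf LFT}({\bf T},{\bf K}):={\bf T}_{11}+{\bf T}_{12}{\bf K}(I-{\bf T}_{22}{\bf K})^{-1}{\bf T}_{21}$; ${\bf C}$ is partitioned as displayed (output blocks of sizes $m_2,p_2$; input blocks of sizes $p_2,m_2$). Suboptimal $\mathcal{H}_\infty$ control problem: find all controllers ${\bf K}\in\mathbb{C}^{m_2\times p_2}(z)$, $u_2={\bf K}y_2$, for which the closed-loop system ${\bf G}={\bf LFT}({\bf T},{\bf K})$ is well-posed, stable and $\|{\bf G}\|_\infty<1$. Here ${\bf K}$ has no pole at $z_0$ and, with ${\bf K}(z)=D_K+C_K(zE_K-A_K)^{-1}B_K(\alpha-\beta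 z)$ minimal, the closed loop is stable when the pole pencil of the interconnection $$\begin{bmatrix}A-zE+B_2D_KC_2(\alpha-\beta z)&B_2C_K(\alpha-\beta z)\\ B_KC_2(\alpha-\beta z)&A_K-zE_K\end{bmatrix}$$ has all generalized eigenvalues (finite and infinite) in $\mathbb{D}$ (well-posedness is automatic since ${\bf T}_{22}(z_0)=0$). For $\Sigma=(A-zE,B;Q,L,R)$ with $Q=Q^*$, $R=R^*$ invertible, DDTARE$(\Sigma)$ is $$E^*XE-A^*XA+Q-\big((\alpha E-\beta A)^*XB+L\big)R^{-1}\big(L^*+B^*X(\alpha E-\beta A)\big)=0,$$ and a Hermitian solution is stabilizing if $\Lambda(A-zE+BF(\alpha-\beta z))\subset\mathbb{D}$, with stabilizing feedback $F:=-R^{-1}(B^*X(\alpha E-\beta A)+L^* )$. Control Riccati data: $$\Sigma_c:=\left(A-zE,[B_1\ B_2];\;C_1^*C_1,\,[0\ \ C_1^*D_{12}],\,\begin{bmatrix}-I_{m_1}&0\\0&D_{12}^*D_{12}\end{bmatrix}\right),$$ $$F_c=\begin{bmatrix}F_1\\ F_2\end{bmatrix}=\begin{bmatrix}B_1^*X(\alpha E-\beta A)\\-(D_{12}^*D_{12})^{-1}\big(D_{12}^*C_1+B_2^*X(\alpha E-\beta A)\big)\end{bmatrix}.$$ Filter-type Riccati data (with $X$ the stabilizing solution of DDTARE$(\Sigma_c)$, and $F_1=B_1^*X(\alpha E-\beta A)$, $F_2=-(D_{12}^*D_{12})^{-1}\big(D_{12}^*C_1+B_2^*X(\alpha E-\beta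 A)\big)$ the two blocks of $F_c$): let $A_O:=A+\alpha B_1F_1$, $E_O:=E+\beta B_1F_1$, $C_O:=\begin{bmatrix}-(D_{12}^*D_{12})^{1/2}F_2\\ C_2+D_{21}F_1\end{bmatrix}$, $L_O:=[0\ \ B_1D_{21}^*]$, $R_O:=\begin{bmatrix}-I_{m_2}&0\\0&D_{21}D_{21}^*\end{bmatrix}$, and $\Sigma_\times:=(A_O^*-zE_O^*,\,C_O^*;\;B_1B_1^*,\,L_O,\,R_O)$. For this dual (conjugate-transposed) structure, $\alpha,\beta$ are replaced by $\bar\alpha,\bar\beta$, so DDTARE$(\Sigma_\times)$ reads $$E_OZE_O^*-A_OZA_O^*+B_1B_1^*-\big((\alpha E-\beta A)ZC_O^*+L_O\big)R_O^{-1}\big((\alpha E-\beta A)ZC_O^*+L_O\big)^*=0$$ (note $\alpha E_O-\beta A_O=\alpha E-\beta A$), and $Z=Z^*$ is stabilizing if $\Lambda\big(A_O-zE_O+H_OC_O(\alpha-\beta z)\big)\subset\mathbb{D}$, where $H_O:=-\big((\alpha E-\beta A)ZC_O^*+L_O\big)R_O^{-1}$. *)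

(* Defs.v *)
From mathcomp Require Export all_boot all_order all_algebra.
From mathcomp Require Export all_classical all_reals all_analysis.
From mathcomp Require Export complex.

Set Implicit Arguments.
Unset Strict Implicit.
Unset Printing Implicit Defensive.

Export Order.TTheory GRing.Theory Num.Theory.

Local Open Scope classical_set_scope.
Local Open Scope ring_scope.
Local Open Scope sesquilinear_scope.

Definition expi (R : realType) (t : R) : R[i] := Complex (cos t) (sin t).

(* The extended complex plane is option R[i], with None the point at infinity. *)
Definition unit_disk (R : realType) : set (option R[i]) :=
  [set z | if z is Some w then `|w| < 1 else False].

(** * Rational functions and rational matrices *)

Notation ratfunc R := {fraction {poly R[i]}}.

Definition poly_ratfunc (R : realType) (p : {poly R[i]}) : ratfunc R :=
  FracField.tofrac p.

Definition const_ratmx (R : realType) p m (M : 'M[R[i]]_(p, m)) :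
  'M[ratfunc R]_(p, m) := map_mx (fun c => poly_ratfunc c%:P) M.

Definition analytic_at (R : realType) (f : ratfunc R) (z : option R[i]) : Prop :=
  exists p q : {poly R[i]},
    [/\ q != 0, f = poly_ratfunc p / poly_ratfunc q
      & if z is Some w then q.[w] != 0 else (size p <= size q)%N].

Definition ratmx_analytic_at (R : realType) p m (G : 'M[ratfunc R]_(p, m))
    (z : option R[i]) : Prop :=
  forall i j, analytic_at (G i j) z.

(* The value is 0, by convention, at a pole. *)
Definition ratfunc_eval (R : realType) (z : R[i]) (f : ratfunc R) : R[i] :=
  xget 0 [set v | exists p q : {poly R[i]},
    [/\ q.[z] != 0, f = poly_ratfunc p / poly_ratfunc q & v = p.[z] / q.[z]]].

Definition ratmx_eval (R : realType) p m (G : 'M[ratfunc R]_(p, m)) (z : R[i]) :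
  'M[R[i]]_(p, m) := map_mx (ratfunc_eval z) G.

(* Largest singular value; 0 for a matrix without columns (sup set0 = 0). *)
Definition sigma_max (R : realType) p m (M : 'M[R[i]]_(p, m)) : R :=
  sup [set s : R | 0 <= s /\ eigenvalue (M^t* *m M) ((s ^+ 2)%:C)%C].

(* Values at the finitely many poles on the circle do not matter: near such a
   pole the supremum is already +oo. *)
Definition Hinf_norm (R : realType) p m (G : 'M[ratfunc R]_(p, m)) : \bar R :=
  ereal_sup [set (sigma_max (ratmx_eval G (expi t)))%:E
            | t in [set t : R | 0 <= t < 2 * pi]].

Definition RHinf (R : realType) p m : set 'M[ratfunc R]_(p, m) :=
  [set G | forall z, ~ unit_disk z -> ratmx_analytic_at G z].

Definition BHinf (R : realType) p m : set 'M[ratfunc R]_(p, m) :=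
  [set G | RHinf G /\ (Hinf_norm G < 1)%E].

Definition LFT (F : fieldType) p1 p2 m1 m2
    (T : 'M[F]_(p1 + p2, m1 + m2)) (K : 'M[F]_(m2, p2)) : 'M[F]_(p1, m1) :=
  ulsubmx T
  + ursubmx T *m K *m invmx (1%:M - drsubmx T *m K) *m dlsubmx T.

(** * Matrix pencils A - zE *)

Definition regular_pencil (R : realType) n (A E : 'M[R[i]]_n) : Prop :=
  \det (map_mx polyC A - 'X *: map_mx polyC E) != 0.

Definition gen_eigenvalues (R : realType) n (A E : 'M[R[i]]_n) :
    set (option R[i]) :=
  [set z | if z is Some w then \det (A - w *: E) = 0 else \det E = 0].

Definition stable_pencil (R : realType) n (A E : 'M[R[i]]_n) : Prop :=
  regular_pencil A E /\ gen_eigenvalues A E `<=` @unit_disk R.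

Definition stabilizable (R : realType) n m (A E : 'M[R[i]]_n)
    (B : 'M[R[i]]_(n, m)) : Prop :=
  (forall z : R[i], ~ `|z| < 1 -> \rank (row_mx (A - z *: E)%R B) = n)
  /\ \rank (row_mx E B) = n.

Definition detectable (R : realType) n p (C : 'M[R[i]]_(p, n))
    (A E : 'M[R[i]]_n) : Prop :=
  stabilizable (A^t*) (E^t*) (C^t*).

(** * Realizations centered at z0 = alpha / beta, with beta = conj alpha *)

Definition center_point (R : realType) (alpha : R[i]) : R[i] := alpha / alpha^*.

Definition centered_system (R : realType) (alpha : R[i]) n p m
    (A E : 'M[R[i]]_n) (B : 'M[R[i]]_(n, m)) (C : 'M[R[i]]_(p, n))
    (D : 'M[R[i]]_(p, m)) : 'M[ratfunc R]_(p, m) :=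
  const_ratmx D
  + poly_ratfunc (alpha%:P - alpha^* *: 'X)
    *: (const_ratmx C
        *m invmx (poly_ratfunc 'X *: const_ratmx E - const_ratmx A)
        *m const_ratmx B).

Definition realizes (R : realType) (alpha : R[i]) n p m
    (G : 'M[ratfunc R]_(p, m))
    (A E : 'M[R[i]]_n) (B : 'M[R[i]]_(n, m)) (C : 'M[R[i]]_(p, n))
    (D : 'M[R[i]]_(p, m)) : Prop :=
  regular_pencil A E /\ G = centered_system alpha A E B C D.

Definition minimal_realization (R : realType) (alpha : R[i]) n p m
    (G : 'M[ratfunc R]_(p, m))
    (A E : 'M[R[i]]_n) (B : 'M[R[i]]_(n, m)) (C : 'M[R[i]]_(p, n))
    (D : 'M[R[i]]_(p, m)) : Prop :=
  realizes alpha G A E B C D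
  /\ forall n' (A' E' : 'M[R[i]]_n') (B' : 'M[R[i]]_(n', m))
       (C' : 'M[R[i]]_(p, n')) (D' : 'M[R[i]]_(p, m)),
       realizes alpha G A' E' B' C' D' -> (n <= n')%N.

(** * The suboptimal H-infinity control problem *)

(* The two matrices are the constant term and minus the z-coefficient of the
   pole pencil of the interconnection; M (alpha - beta z) contributes alpha M
   to the former and beta M to the latter. *)
Definition stable_closed_loop (R : realType) (alpha : R[i]) n m2 p2
    (A E : 'M[R[i]]_n) (B2 : 'M[R[i]]_(n, m2)) (C2 : 'M[R[i]]_(p2, n))
    (K : 'M[ratfunc R]_(m2, p2)) : Prop :=
  exists nK (AK EK : 'M[R[i]]_nK) (BK : 'M[R[i]]_(nK, p2))
    (CK : 'M[R[i]]_(m2, nK)) (DK : 'M[R[i]]_(m2, p2)),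
    minimal_realization alpha K AK EK BK CK DK
    /\ stable_pencil
         (block_mx (A + alpha *: (B2 *m DK *m C2)) (alpha *: (B2 *m CK))
                   (alpha *: (BK *m C2)) AK)
         (block_mx (E + alpha^* *: (B2 *m DK *m C2)) (alpha^* *: (B2 *m CK))
                   (alpha^* *: (BK *m C2)) EK).

(* (A, E, B2, C2) are the data of the realization of T seen by the controller. *)
Definition solves_suboptimal_Hinf (R : realType) (alpha : R[i]) n p1 p2 m1 m2
    (T : 'M[ratfunc R]_(p1 + p2, m1 + m2))
    (A E : 'M[R[i]]_n) (B2 : 'M[R[i]]_(n, m2)) (C2 : 'M[R[i]]_(p2, n))
    (K : 'M[ratfunc R]_(m2, p2)) : Prop :=
  [/\ ratmx_analytic_at K (Some (center_point alpha)),
      1%:M - drsubmx T *m K \in unitmx,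
      stable_closed_loop alpha A E B2 C2 K
    & (Hinf_norm (LFT T K) < 1)%E].

(** * Definite matrices *)

Definition negsemidef (R : realType) n (X : 'M[R[i]]_n) : Prop :=
  X \is hermsymmx /\ forall v : 'cV[R[i]]_n, (v^t* *m X *m v) 0 0 <= 0.

Definition posdef (R : realType) n (X : 'M[R[i]]_n) : Prop :=
  X \is hermsymmx
  /\ forall v : 'cV[R[i]]_n, v != 0 -> 0 < (v^t* *m X *m v) 0 0.

Definition sqrtmx (R : realType) n (M : 'M[R[i]]_n) : 'M[R[i]]_n :=
  xget 0 [set S | posdef S /\ S *m S = M].

(** * Descriptor discrete-time algebraic Riccati equations *)

Definition ddtare (R : realType) (alpha : R[i]) n m
    (A E : 'M[R[i]]_n) (B : 'M[R[i]]_(n, m)) (Q : 'M[R[i]]_n)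
    (L : 'M[R[i]]_(n, m)) (S : 'M[R[i]]_m) (X : 'M[R[i]]_n) : Prop :=
  let W := alpha *: E - alpha^* *: A in
  E^t* *m X *m E - A^t* *m X *m A + Q
  - (W^t* *m X *m B + L) *m invmx S *m (L^t* + B^t* *m X *m W) = 0.

Definition feedback (R : realType) (alpha : R[i]) n m
    (A E : 'M[R[i]]_n) (B : 'M[R[i]]_(n, m))
    (L : 'M[R[i]]_(n, m)) (S : 'M[R[i]]_m) (X : 'M[R[i]]_n) :
    'M[R[i]]_(m, n) :=
  - (invmx S *m (B^t* *m X *m (alpha *: E - alpha^* *: A) + L^t*)).

Definition ddtare_stabilizing (R : realType) (alpha : R[i]) n m
    (A E : 'M[R[i]]_n) (B : 'M[R[i]]_(n, m)) (Q : 'M[R[i]]_n)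
    (L : 'M[R[i]]_(n, m)) (S : 'M[R[i]]_m) (X : 'M[R[i]]_n) : Prop :=
  let F := feedback alpha A E B L S X in
  [/\ X \is hermsymmx, ddtare alpha A E B Q L S X
    & stable_pencil (A + alpha *: (B *m F)) (E + alpha^* *: (B *m F))].

(* Dual notions: the equation is that of (A^* - zE^*, C^*; Q, L, S) with
   conj alpha in place of alpha, and H is the adjoint of its feedback. *)
Definition dual_ddtare (R : realType) (alpha : R[i]) n p
    (A E : 'M[R[i]]_n) (C : 'M[R[i]]_(p, n)) (Q : 'M[R[i]]_n)
    (L : 'M[R[i]]_(n, p)) (S : 'M[R[i]]_p) (Z : 'M[R[i]]_n) : Prop :=
  let V := (alpha *: E - alpha^* *: A) *m Z *m C^t* + L in
  E *m Z *m E^t* - A *m Z *m A^t* + Q - V *m invmx S *m V^t* = 0.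

Definition dual_feedback (R : realType) (alpha : R[i]) n p
    (A E : 'M[R[i]]_n) (C : 'M[R[i]]_(p, n))
    (L : 'M[R[i]]_(n, p)) (S : 'M[R[i]]_p) (Z : 'M[R[i]]_n) :
    'M[R[i]]_(n, p) :=
  - (((alpha *: E - alpha^* *: A) *m Z *m C^t* + L) *m invmx S).

Definition dual_ddtare_stabilizing (R : realType) (alpha : R[i]) n p
    (A E : 'M[R[i]]_n) (C : 'M[R[i]]_(p, n)) (Q : 'M[R[i]]_n)
    (L : 'M[R[i]]_(n, p)) (S : 'M[R[i]]_p) (Z : 'M[R[i]]_n) : Prop :=
  let H := dual_feedback alpha A E C L S Z in
  [/\ Z \is hermsymmx, dual_ddtare alpha A E C Q L S Z
    & stable_pencil (A + alpha *: (H *m C)) (E + alpha^* *: (H *m C))].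

Lemma dual_ddtareE (R : realType) (alpha : R[i]) n p
    (A E : 'M[R[i]]_n) (C : 'M[R[i]]_(p, n)) (Q : 'M[R[i]]_n)
    (L : 'M[R[i]]_(n, p)) (S : 'M[R[i]]_p) (Z : 'M[R[i]]_n) :
  Z \is hermsymmx ->
  dual_ddtare alpha A E C Q L S Z
  <-> ddtare alpha^* (A^t*) (E^t*) (C^t*) Q L S Z.
Proof.
move=> /is_hermitianmxP; rewrite expr0 scale1r => hZ.
have adjM a b c (M : 'M[R[i]]_(a, b)) (N : 'M[R[i]]_(b, c)) :
    (M *m N)^t* = N^t* *m M^t* by rewrite trmx_mul map_mxM.
have adjD a b (M N : 'M[R[i]]_(a, b)) : (M + N)^t* = M^t* + N^t*.
  by rewrite linearD map_mxD.
have adjB a b (M N : 'M[R[i]]_(a, b)) : (M - N)^t* = M^t* - N^t*.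
  by rewrite linearB map_mxB.
have adjZ a b c (M : 'M[R[i]]_(a, b)) : (c *: M)^t* = c^* *: M^t*.
  by rewrite linearZ map_mxZ.
have adjK a b (M : 'M[R[i]]_(a, b)) : (M^t*)^t* = M.
  by apply/matrixP=> i j; rewrite !mxE conjCK.
rewrite /dual_ddtare /ddtare /= adjD !adjM !adjB !adjZ !adjK -hZ !conjCK.
by rewrite !mulmxA [L^t* + _]addrC.
Qed.

(* Main.v *)
Require Import Defs.
From mathcomp Require Import all_boot all_order all_algebra.
From mathcomp Require Import all_classical all_reals all_analysis.
From mathcomp Require Import perm complex.
From mathcomp Require Import ring lra.

Set Implicit Arguments.
Unset Strict Implicit.
Unset Printing Implicit Defensive.

Import Order.TTheory GRing.Theory Num.Theory numFieldNormedType.Exports.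

(** The proof takes place in the left half-plane. The center [alpha / beta] is no
    eigenvalue of the pencil, so [W = alpha E - beta A] is invertible, and the
    substitution [s = - (alpha + beta z) / (2 (alpha - beta z))] turns a centered
    realization into a standard system (A, B, C, D): the outside of the disk
    becomes the right half-plane, the center becomes infinity, stable pencils
    become Hurwitz matrices ([stable_pencil_cayley]). The two descriptor equations
    become Riccati equations with solutions [- W^* X W] and [- Z], both positive
    semidefinite ([control_care], [filter_care]).

    A controller then solves the problem when it has a realization [K] such that
    the loop of the plant [P] and [K] is Hurwitz and strictly contractive on the
    axis, infinity included ([solves_stable_contraction]). A Riccati solution
    completes the square: with [r = w - F1 x] and [v = S (u - F2 x)],
    [|z|^2 - |w|^2] differs from [|v|^2 - |r|^2] by the derivative of a quadratic
    form in the state.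
    So the loop consists of a lossless system with inner transfer function, closed
    by the loop of [K] with a new plant whose disturbance is [r] and whose output
    is [v]. Closing a loop around an inner system preserves stable contractivity
    in both directions: on the axis this is the energy balance, and for stability
    one scales the feedback from 0 to 1 and observes that no eigenvalue meets the
    axis on the way ([inner_loop], [Hurwitz_homotopy]). This gives [riccati_step];
    applied once to [P] and once to the adjoint of the result, it replaces [P] by a
    plant [P2] whose feedthroughs from [u] to the output and from the disturbance
    to [y] are the invertible square roots ([stabilized_loop]).

    Such a plant can be solved for its other inputs. Its inverse is the generator
    [C] of the theorem ([inverse_stabilized]), and closing [P2] on a system built
    on its inverse, or conversely, leaves the innermost system and hidden modes
    governed by the two matrices that the Riccati solutions stabilize
    ([stable_contraction_inverse], [transfer_inverse_left]). Hence the solutions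
    [K] correspond to the stable strict contractions [Q], by [Q] = loop of [P2] and
    [K], and [K] = loop of the inverse of [P2] and [Q].

    It remains to recognize stable contractions of standard systems as the rational
    matrices in BHinf ([BHinfP]): partial fractions produce stable realizations,
    and compactness of the circle makes pointwise strict contractivity uniform.
    Finally, internal stability is defined through a minimal realization of the
    controller. A stabilizing realization of least order is minimal among all
    realizations by pencils: it is observable and controllable, as otherwise it
    could be reduced without losing stability, and then the divided differences of
    the transfer function already determine its order ([minimal_stable]). *)

Local Open Scope ring_scope.
Local Open Scope sesquilinear_scope.

(** * Linear systems and feedback loops *)

Lemma addmxE (V : nmodType) m n (A B : 'M[V]_(m, n)) i j :
  (A + B) i j = A i j + B i j.
Proof. exact: mxE. Qed.

Lemma oppmxE (V : zmodType) m n (A : 'M[V]_(m, n)) i j : (- A) i j = - A i j.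
Proof. exact: mxE. Qed.

Lemma scalemxE (K : pzRingType) m n (c : K) (A : 'M[K]_(m, n)) i j :
  (c *: A) i j = c * A i j.
Proof. exact: mxE. Qed.

Lemma zeromxE (V : nmodType) m n i j : (0 : 'M[V]_(m, n)) i j = 0.
Proof. exact: mxE. Qed.

(* Expands both sides into sums of products of matrices and compares the
   summands entrywise, the products being atoms. *)
Ltac mx_normal :=
  rewrite ?(mulmxDl, mulmxDr, mulmxBl, mulmxBr, mulmxN, mulNmx, opprD, opprK,
            scalerDr, scalerN, mulmxA, mul0mx, mulmx0, mul1mx, mulmx1).
Ltac mx_ring :=
  mx_normal;
  let i := fresh "i" in let j := fresh "j" in
  apply/matrixP=> i j;
  rewrite ?(addmxE, oppmxE, scalemxE, zeromxE); ring.

Record sys (F : fieldType) (n m p : nat) := Sys {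
  sysA : 'M[F]_n; sysB : 'M[F]_(n, m); sysC : 'M[F]_(p, n); sysD : 'M[F]_(p, m) }.

Definition nonpole (F : fieldType) (s : F) n (A : 'M[F]_n) : bool :=
  s%:M - A \in unitmx.

(** [s] need not be a number: with [F] the field of rational functions and [s] a
    rational function, this is the transfer function itself, while for complex
    [s] it is a value of it. Identities are proved once, for all fields. *)
Definition transfer (F : fieldType) (s : F) n m p (G : sys F n m p) :
    'M[F]_(p, m) :=
  sysD G + sysC G *m invmx (s%:M - sysA G) *m sysB G.

Record plant (F : fieldType) (n m1 m2 p1 p2 : nat) := Plant {
  plA : 'M[F]_n; plB1 : 'M[F]_(n, m1); plB2 : 'M[F]_(n, m2);
  plC1 : 'M[F]_(p1, n); plC2 : 'M[F]_(p2, n);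
  plD12 : 'M[F]_(p1, m2); plD21 : 'M[F]_(p2, m1) }.

(** The direct feedthroughs from [w] to [z] and from [u] to [y] vanish, so that a
    feedback [u = K y] never leads to an algebraic loop. *)
Definition open_loop (F : fieldType) n m1 m2 p1 p2
    (P : plant F n m1 m2 p1 p2) : sys F n (m1 + m2) (p1 + p2) :=
  Sys (plA P) (row_mx (plB1 P) (plB2 P)) (col_mx (plC1 P) (plC2 P))
      (block_mx 0 (plD12 P) (plD21 P) 0).

Definition loop (F : fieldType) n k m1 m2 p1 p2
    (P : plant F n m1 m2 p1 p2) (K : sys F k p2 m2) : sys F (n + k) m1 p1 :=
  Sys (block_mx (plA P + plB2 P *m sysD K *m plC2 P) (plB2 P *m sysC K)
                (sysB K *m plC2 P) (sysA K))
      (col_mx (plB1 P + plB2 P *m sysD K *m plD21 P) (sysB K *m plD21 P))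
      (row_mx (plC1 P + plD12 P *m sysD K *m plC2 P) (plD12 P *m sysC K))
      (plD12 P *m sysD K *m plD21 P).

Section TransferFunctions.
Variables (F : fieldType) (s : F).

Lemma nonpoleP n (A : 'M[F]_n) :
  reflect (forall x : 'cV_n, A *m x = s *: x -> x = 0) (nonpole s A).
Proof.
apply: (iffP idP) => [uA x Ax|inj].
  rewrite -[x](mulKmx uA) mulmxBl mul_scalar_mx Ax subrr.
  exact: mulmx0.
rewrite /nonpole -unitmx_tr -row_free_unit -kermx_eq0; apply/eqP/row_matrixP=> i.
rewrite row0; apply: trmx_inj; rewrite trmx0; apply: inj.
have: row i (kermx (s%:M - A)^T) *m (s%:M - A)^T = 0.
  by apply/sub_kermxP; exact: row_sub.
move/(congr1 trmx); rewrite trmx_mul trmxK trmx0 mulmxBl mul_scalar_mx.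
by move/eqP; rewrite subr_eq0 => /eqP.
Qed.

(** Transfer functions are handled through the signals of the system: once
    states [X] are exhibited for the inputs [U], the outputs are forced. *)
Lemma transfer_signal n m p q (G : sys F n m p) (X : 'M[F]_(n, q)) (U : 'M[F]_(m, q)) :
  nonpole s (sysA G) -> s *: X = sysA G *m X + sysB G *m U ->
  sysC G *m X + sysD G *m U = transfer s G *m U.
Proof.
move=> uA eX; rewrite /transfer mulmxDl addrC; congr (_ + _).
rewrite -!mulmxA; congr (_ *m _); rewrite -[X in LHS](mulKmx uA).
by rewrite mulmxBl mul_scalar_mx eX [_ + sysB G *m _]addrC addrK.
Qed.

Lemma resolvent_state n m q (A : 'M[F]_n) (B : 'M[F]_(n, m)) (U : 'M[F]_(m, q)) :
  nonpole s A -> exists X, s *: X = A *m X + B *m U.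
Proof.
move=> uA; exists (invmx (s%:M - A) *m (B *m U)); set X := _ *m (B *m U).
apply/eqP; rewrite [A *m X + _]addrC -subr_eq -mul_scalar_mx -mulmxBl.
by rewrite /X mulKVmx.
Qed.

(** To compare two systems it suffices to exhibit matching states, which avoids
    inverting the resolvent of a composite system. *)
Lemma transfer_eq n n' m p (G : sys F n m p) (G' : sys F n' m p)
    (X : 'M[F]_(n, m)) (X' : 'M[F]_(n', m)) :
  nonpole s (sysA G) -> nonpole s (sysA G') ->
  s *: X = sysA G *m X + sysB G -> s *: X' = sysA G' *m X' + sysB G' ->
  sysC G *m X + sysD G = sysC G' *m X' + sysD G' -> transfer s G = transfer s G'.
Proof.
move=> uG uG' eX eX' eq.
have := @transfer_signal _ _ _ _ G X 1%:M uG; rewrite !mulmx1 => <- //.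
by rewrite eq; have := @transfer_signal _ _ _ _ G' X' 1%:M uG'; rewrite !mulmx1 => ->.
Qed.

Section Loop.
Variables (n k m1 m2 p1 p2 : nat).
Variables (P : plant F n m1 m2 p1 p2) (K : sys F k p2 m2).
Hypothesis uP : nonpole s (plA P).
Hypothesis uK : nonpole s (sysA K).
Hypothesis uL : nonpole s (sysA (loop P K)).

Let T := transfer s (open_loop P).

Let T_signal q (X : 'M[F]_(n, q)) (w : 'M[F]_(m1, q)) (u : 'M[F]_(m2, q)) :
  s *: X = plA P *m X + plB1 P *m w + plB2 P *m u ->
  ulsubmx T *m w + ursubmx T *m u = plC1 P *m X + plD12 P *m u /\
  dlsubmx T *m w + drsubmx T *m u = plC2 P *m X + plD21 P *m w.
Proof.
move=> eX.
have /= := @transfer_signal _ _ _ _ (open_loop P) X (col_mx w u) uP.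
rewrite mul_row_col addrA => /(_ eX).
rewrite mul_block_col mul_col_mx !mul0mx add0r addr0 add_col_mx -/T.
by rewrite -[T]submxK mul_block_col !submxK => /eq_col_mx [<- <-].
Qed.

Lemma loop_state q (x : 'M[F]_(n, q)) (xk : 'M[F]_(k, q)) (w : 'M[F]_(m1, q)) u y :
  u = sysC K *m xk + sysD K *m y -> y = plC2 P *m x + plD21 P *m w ->
  s *: x = plA P *m x + plB1 P *m w + plB2 P *m u ->
  s *: xk = sysA K *m xk + sysB K *m y ->
  s *: col_mx x xk = sysA (loop P K) *m col_mx x xk + sysB (loop P K) *m w /\
  plC1 P *m x + plD12 P *m u
    = sysC (loop P K) *m col_mx x xk + sysD (loop P K) *m w.
Proof.
move=> -> -> ex exk; split => /=.
  rewrite scale_col_mx mul_block_col mul_col_mx add_col_mx ex exk.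
  by congr col_mx; mx_ring.
by rewrite mul_row_col; mx_ring.
Qed.

Lemma loop_split q (x : 'M[F]_(n, q)) (xk : 'M[F]_(k, q)) (w : 'M[F]_(m1, q)) :
  s *: col_mx x xk = sysA (loop P K) *m col_mx x xk + sysB (loop P K) *m w ->
  let y := plC2 P *m x + plD21 P *m w in
  let u := sysC K *m xk + sysD K *m y in
  [/\ s *: x = plA P *m x + plB1 P *m w + plB2 P *m u,
      s *: xk = sysA K *m xk + sysB K *m y &
      sysC (loop P K) *m col_mx x xk + sysD (loop P K) *m w
        = plC1 P *m x + plD12 P *m u].
Proof.
rewrite /= scale_col_mx mul_block_col mul_col_mx add_col_mx.
move=> /eq_col_mx [-> ->]; split; last rewrite mul_row_col; mx_ring.
Qed.

(** A vector [y] in the kernel is the measurement in a trajectory of the loop at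
    frequency [s] without disturbance; as [s] is not a pole of the loop, that
    trajectory is zero. *)
Lemma loop_well_posed : 1%:M - drsubmx T *m transfer s K \in unitmx.
Proof.
rewrite -unitmx_tr -row_free_unit -kermx_eq0.
set N := kermx _; apply/eqP; apply: trmx_inj; rewrite trmx0.
have : N *m (1%:M - drsubmx T *m transfer s K)^T = 0 by exact: mulmx_ker.
move/(congr1 trmx); rewrite trmx_mul trmxK trmx0 mulmxBl mul1mx => /subr0_eq.
set y := N^T => ey.
have [xk exk] := resolvent_state (sysB K) y uK.
have eu := transfer_signal uK exk.
have [x ex] := resolvent_state (plB2 P) (transfer s K *m y) uP.
have ex' : s *: x = plA P *m x + plB1 P *m 0 + plB2 P *m (transfer s K *m y).
  by rewrite mulmx0 addr0.
have [_] := T_signal ex'; rewrite !mulmx0 add0r addr0 mulmxA -ey => ey'.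
have [|e _] := loop_state (esym eu) _ ex' exk; first by rewrite mulmx0 addr0.
move/eqP: e; rewrite mulmx0 addr0 -subr_eq0 -mul_scalar_mx -mulmxBl => /eqP e0.
have := mulKmx uL (col_mx x xk); rewrite e0 mulmx0 => /esym.
by rewrite -[X in _ = X]col_mx0 => /eq_col_mx [x0 _]; rewrite ey' x0 mulmx0.
Qed.

Lemma LFT_loop : LFT T (transfer s K) = transfer s (loop P K).
Proof.
have := loop_well_posed.
have [X] := resolvent_state (sysB (loop P K)) 1%:M uL.
move=> eX; have := transfer_signal uL eX; rewrite !mulmx1 => <-.
move: eX; rewrite -[X]vsubmxK; set x := usubmx X; set xk := dsubmx X.
move=> /loop_split /=; set y := plC2 P *m x + _; set u := sysC K *m xk + _.
move=> -[ex exk].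
rewrite mulmx1 => -> wp.
have eu : u = transfer s K *m y by rewrite -(transfer_signal uK exk).
have [e1 e2] := T_signal ex; rewrite -e1 /LFT.
suff -> : u = transfer s K *m invmx (1%:M - drsubmx T *m transfer s K) *m dlsubmx T.
  by rewrite mulmx1 !mulmxA.
rewrite eu -mulmxA; congr (_ *m _); rewrite -[LHS](mulKmx wp); congr (_ *m _).
rewrite mulmxBl mul1mx -mulmxA -eu {1}/y -e2 mulmx1.
by rewrite addrK.
Qed.

End Loop.
End TransferFunctions.

(** * The modulus of complex numbers *)

Section ComplexModulus.
Variable R : realType.
Implicit Types z w : R[i].

(** [`|z|] has complex type; estimates need a real number. *)
Definition cabs z : R := complex.Re `|z|.

Lemma cabsE z : `|z| = (cabs z)%:C%C.
Proof. by rewrite /cabs RRe_real ?normr_real. Qed.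

Lemma cabs_ge0 z : 0 <= cabs z.
Proof. by rewrite -ler0c -cabsE. Qed.

Lemma cabs0 : cabs 0 = 0.
Proof. by apply: (@complexI R); rewrite -cabsE normr0. Qed.

Lemma cabs1 : cabs 1 = 1.
Proof. by apply: (@complexI R); rewrite -cabsE normr1. Qed.

Lemma cabs_gt0 z : (0 < cabs z) = (z != 0).
Proof. by rewrite -normr_gt0 cabsE -[0 : R[i]]/(0%:C%C) ltcR. Qed.

Lemma cabsM z w : cabs (z * w) = cabs z * cabs w.
Proof. by apply: (@complexI R); rewrite rmorphM -!cabsE normrM. Qed.

Lemma cabsN z : cabs (- z) = cabs z.
Proof. by apply: (@complexI R); rewrite -!cabsE normrN. Qed.

Lemma cabsD z w : cabs (z + w) <= cabs z + cabs w.
Proof. by rewrite -lecR rmorphD -!cabsE ler_normD. Qed.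

Lemma cabs_sum I (r : seq I) (P : pred I) (f : I -> R[i]) :
  cabs (\sum_(i <- r | P i) f i) <= \sum_(i <- r | P i) cabs (f i).
Proof.
elim/big_rec2: _ => [|i x y _ h]; first by rewrite cabs0.
by apply: le_trans (cabsD _ _) _; rewrite lerD2l.
Qed.

Lemma cabs_prod I (r : seq I) (P : pred I) (f : I -> R[i]) :
  cabs (\prod_(i <- r | P i) f i) = \prod_(i <- r | P i) cabs (f i).
Proof. exact: (big_morph _ cabsM cabs1). Qed.

Lemma cabs_real (x : R) : cabs x%:C%C = `|x|.
Proof.
apply: (@complexI R); rewrite -cabsE.
have [x0|x0] := leP 0 x; first by rewrite !ger0_norm // ler0c.
by rewrite !ltr0_norm ?rmorphN // -[0 : R[i]]/(0%:C%C) ltcR.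
Qed.

Lemma cabs_realM (x : R) z : cabs (x%:C%C * z) = `|x| * cabs z.
Proof. by rewrite cabsM cabs_real. Qed.

Lemma Re_le_cabs z : complex.Re z <= cabs z.
Proof.
apply: le_trans (ler_norm _) _.
by rewrite -lecR -cabsE normc_ge_Re.
Qed.

Lemma cReD z w : complex.Re (z + w) = complex.Re z + complex.Re w.
Proof. by case: z w => [? ?] [? ?]. Qed.

Lemma cReN z : complex.Re (- z) = - complex.Re z.
Proof. by case: z. Qed.

Lemma cReB z w : complex.Re (z - w) = complex.Re z - complex.Re w.
Proof. by rewrite cReD cReN. Qed.

Lemma cReM z w : complex.Re (z * w)
  = complex.Re z * complex.Re w - complex.Im z * complex.Im w.
Proof. by case: z w => [? ?] [? ?]. Qed.

Lemma conjcE z : z^* = Complex (complex.Re z) (- complex.Im z).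
Proof. by case: z. Qed.

Lemma cRe_conj z : complex.Re z^* = complex.Re z.
Proof. by rewrite conjcE. Qed.

Lemma cRe_sum I (r : seq I) (P : pred I) (f : I -> R[i]) :
  complex.Re (\sum_(i <- r | P i) f i) = \sum_(i <- r | P i) complex.Re (f i).
Proof. exact: (big_morph _ cReD). Qed.

End ComplexModulus.

(** * Hurwitz matrices and their persistence along a path *)

Definition Hurwitz (R : realType) n (A : 'M[R[i]]_n) : Prop :=
  forall s : R[i], 0 <= complex.Re s -> nonpole s A.

Section Homotopy.
Variable R : realType.
Local Notation C := R[i].

Lemma det_sub_factor n (A : 'M[C]_n) :
  exists2 r : seq C, size r = n & (forall s, \det (s%:M - A) = \prod_(z <- r) (s - z))
    /\ (forall s, (s \in r) = ~~ nonpole s A).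
Proof.
have [r er] := closed_field_poly_normal (char_poly A).
have hor s : \det (s%:M - A) = (char_poly A).[s].
  rewrite /char_poly -horner_evalE -det_map_mx; congr (\det _).
  apply/matrixP=> i j; rewrite !mxE /= horner_evalE hornerD hornerN hornerC.
  by rewrite hornerMn hornerX.
have fac s : \det (s%:M - A) = \prod_(z <- r) (s - z).
  rewrite hor er (monicP (char_poly_monic A)) scale1r horner_prod.
  by apply: eq_bigr => z _; rewrite hornerXsubC.
exists r; last split=> // s.
  have := congr1 (size : {poly C} -> nat) er.
  by rewrite size_char_poly (monicP (char_poly_monic A)) scale1r size_prod_XsubC => -[].
rewrite /nonpole unitmxE unitfE negbK fac prodf_seq_eq0.
apply/idP/hasP => [sr|[z zr]]; first by exists s; rewrite //= subrr.
by rewrite /= subr_eq0 => /eqP ->.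
Qed.

(** Each factor [s - z] of the characteristic polynomial has modulus at least
    [d]. The bound depends on the matrix only through the abscissa of its
    spectrum, which makes it usable along a whole path of matrices. *)
Lemma det_lower_bound n (A : 'M[C]_n) (a d : R) s : 0 <= d ->
  (forall z, ~~ nonpole z A -> complex.Re z <= a) -> a + d <= complex.Re s ->
  d ^+ n <= cabs (\det (s%:M - A)).
Proof.
move=> d0 spec Res; have [r rn [-> rE]] := det_sub_factor A; rewrite -{}rn.
have: all (fun z => complex.Re z <= a) r.
  by apply/allP=> z; rewrite rE; exact: spec.
rewrite cabs_prod; elim: r {rE} => [|z r IH] /=; first by rewrite big_nil expr0.
case/andP=> za ra; rewrite big_cons exprS; apply: ler_pM => //.
- exact: exprn_ge0.
- by apply: le_trans (Re_le_cabs _); rewrite cReB; lra.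
- exact: IH.
Qed.

Lemma Hurwitz_gap n (A : 'M[C]_n) : Hurwitz A ->
  exists2 d : R, 0 < d & forall z, ~~ nonpole z A -> complex.Re z <= - d.
Proof.
move=> hA; have [r _ [_ rE]] := det_sub_factor A.
suff [d d0 dr] : exists2 d : R, 0 < d & all (fun z => complex.Re z <= - d) r.
  by exists d => // z; rewrite -rE => /(allP dr).
have: all (fun z => complex.Re z < 0) r.
  apply/allP=> z; rewrite rE; apply: contraNT; rewrite -leNgt; exact: hA.
elim: r {rE} => [|z r IH] /=; first by exists 1.
case/andP=> z0 /IH [d d0 dr]; exists (Num.min d (- complex.Re z)).
  by rewrite lt_min d0 oppr_gt0.
rewrite -lerN2 opprK ge_min -[X in _ || X]lerN2 ?opprK lexx orbT /=.
apply: sub_all dr => w; rewrite -lerN2 opprK -[in X in _ -> X]lerN2 opprK.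
by move=> h; rewrite ge_min h.
Qed.

Lemma unstable_pole n (A : 'M[C]_n) : ~ Hurwitz A ->
  exists2 s, 0 <= complex.Re s & ~~ nonpole s A.
Proof. by move=> /existsNP [s] /not_implyP [? /negP ?]; exists s. Qed.

Lemma det_at_pole n (A : 'M[C]_n) s : ~~ nonpole s A -> \det (s%:M - A) = 0.
Proof. by rewrite /nonpole unitmxE unitfE negbK => /eqP. Qed.

Definition entry_sum n (A : 'M[C]_n) : R := \sum_i \sum_j cabs (A i j).

Lemma entry_sum_ge0 n (A : 'M[C]_n) : 0 <= entry_sum A.
Proof. by apply: sumr_ge0 => i _; apply: sumr_ge0 => j _; exact: cabs_ge0. Qed.

Lemma entry_le_sum n (A : 'M[C]_n) i j : cabs (A i j) <= entry_sum A.
Proof.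
rewrite /entry_sum (bigD1 i) //= (bigD1 j) //= -addrA lerDl.
by rewrite addr_ge0 // sumr_ge0 // => k _; rewrite ?sumr_ge0 // => *; exact: cabs_ge0.
Qed.

Lemma spectrum_bounded n (A : 'M[C]_n) s : ~~ nonpole s A -> cabs s <= entry_sum A.
Proof.
move=> /nonpoleP/existsNP [x] /not_implyP [Ax] /eqP x0.
have [i xi] : exists i, x i 0 != 0.
  apply/existsP; apply: contraNT x0; rewrite negb_exists => /forallP h.
  by apply/eqP/matrixP=> i j; rewrite ord1 mxE; apply/eqP; move: (h i); rewrite negbK.
pose L := \sum_i cabs (x i 0).
have L0 : 0 < L.
  rewrite /L (bigD1 i) //= ltr_pwDl ?cabs_gt0 // sumr_ge0 // => *; exact: cabs_ge0.
rewrite -(ler_pM2r L0) mulr_sumr /entry_sum mulr_suml; apply: ler_sum => k _.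
rewrite -cabsM; have /matrixP /(_ k 0) := Ax; rewrite !mxE => <-.
apply: le_trans (cabs_sum _ _ _) _; rewrite mulr_suml; apply: ler_sum => j _.
rewrite cabsM; apply: ler_wpM2l; first exact: cabs_ge0.
rewrite /L (bigD1 j) //= lerDl sumr_ge0 // => *; exact: cabs_ge0.
Qed.

(* The bounds are rough; only their dependence on the difference matters. *)
Lemma prod_lipschitz I (r : seq I) (f g : I -> C) (B e : R) : 1 <= B ->
  (forall i, cabs (f i) <= B) -> (forall i, cabs (g i) <= B) ->
  (forall i, cabs (f i - g i) <= e) ->
  cabs (\prod_(i <- r) f i - \prod_(i <- r) g i) <= (size r)%:R * B ^+ size r * e.
Proof.
move=> B1 fB gB fg; have B0 : 0 <= B by lra.
elim: r => [|i r IH]; first by rewrite !big_nil subrr cabs0 !mul0r.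
have e0 : 0 <= e by apply: le_trans (fg i); exact: cabs_ge0.
rewrite !big_cons /=.
have -> : f i * \prod_(j <- r) f j - g i * \prod_(j <- r) g j
    = (f i - g i) * \prod_(j <- r) f j
      + g i * (\prod_(j <- r) f j - \prod_(j <- r) g j) by ring.
apply: le_trans (cabsD _ _) _; rewrite !cabsM.
have h1 : cabs (\prod_(j <- r) f j) <= B ^+ size r.
  rewrite cabs_prod; elim: {IH} r => [|j r IH]; first by rewrite big_nil.
  rewrite big_cons exprS ler_pM ?cabs_ge0 // prodr_ge0 // => *; exact: cabs_ge0.
have h2 : cabs (f i - g i) * cabs (\prod_(j <- r) f j) <= e * (B * B ^+ size r).
  apply: ler_pM; rewrite ?cabs_ge0 //; apply: le_trans h1 _.
  by rewrite ler_peMl // exprn_ge0.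
have h3 := ler_pM (cabs_ge0 _) (cabs_ge0 _) (gB i) IH.
apply: le_trans (lerD h2 h3) _.
rewrite exprS -[(size r).+1%:R]natr1 le_eqVlt; apply/orP; left; apply/eqP; ring.
Qed.

Lemma det_lipschitz n (B : R) : exists2 k : R, 0 <= k &
  forall (M N : 'M[C]_n) e, (forall i j, cabs (M i j) <= B) ->
    (forall i j, cabs (N i j) <= B) -> (forall i j, cabs (M i j - N i j) <= e) ->
  cabs (\det M - \det N) <= k * e.
Proof.
pose B' := Num.max 1 B.
have B1 : 1 <= B' by rewrite le_max lexx.
have BB : B <= B' by rewrite le_max lexx orbT.
exists (#|{perm 'I_n}|%:R * (n%:R * B' ^+ n)).
  rewrite !mulr_ge0 // exprn_ge0 //; lra.
move=> M N e hM hN hMN; rewrite /determinant -sumrB mulr_natl -sumr_const mulr_suml.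
apply: le_trans (cabs_sum _ _ _) _; apply: ler_sum => s _.
rewrite -mulrBr cabsM.
have -> : cabs ((-1) ^+ s : C) = 1.
  by apply: (@complexI R); rewrite -cabsE normr_sign.
rewrite mul1r.
have := @prod_lipschitz _ (index_enum 'I_n) (fun i => M i (s i)) (fun i => N i (s i)) B' e.
rewrite /index_enum -enumT size_enum_ord; apply=> // i; exact: le_trans BB.
Qed.

(** Connectedness of the interval in the form needed to follow a property of
    matrices along a path; the supremum of the set where the property holds is
    attained and cannot be smaller than 1. *)
Lemma unit_interval_connected (P : R -> Prop) :
  (forall t, 0 <= t <= 1 -> exists2 d : R, 0 < d &
     forall t', 0 <= t' <= 1 -> `|t' - t| < d -> P t <-> P t') ->
  P 0 -> P 1.
Proof.
move=> loc P0; pose S := [set t | 0 <= t <= 1 /\ P t]%classic.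
have S0 : S 0 by split; rewrite ?lexx ?ler01.
have hS : has_sup S by split; [exists 0|exists 1 => t [/andP[]]].
have sup1 : sup S <= 1 by apply: ge_sup; [exists 0|move=> t [/andP[]]].
have sup0 : 0 <= sup S by apply: (ub_le_sup (proj2 hS)).
have [d d0 hd] := loc (sup S) (introT andP (conj sup0 sup1)).
have [t [t01 Pt] td] := sup_adherent d0 hS.
have tS : t <= sup S by apply: (ub_le_sup (proj2 hS)); split.
have PS : P (sup S) by apply/(hd t t01) => //; rewrite ler0_norm; lra.
have [s1|s1] := ltP (sup S) 1; last by have -> : 1 = sup S by lra.
pose t' := Num.min 1 (sup S + d / 2).
have t'S : sup S < t' by rewrite lt_min s1 ltrDl divr_gt0.
have t'1 : t' <= 1 by rewrite ge_min lexx.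
have t'd : t' <= sup S + d / 2 by rewrite ge_min lexx orbT.
have : S t'.
  split; first by apply/andP; split=> //; lra.
  apply/(hd t') => //; first by apply/andP; split=> //; lra.
  by rewrite ger0_norm; lra.
by move=> /(ub_le_sup (proj2 hS)); lra.
Qed.

(** Eigenvalues move continuously, so they cannot leave the left half-plane
    without crossing the imaginary axis. Instead of following eigenvalues, one
    compares characteristic polynomials: they are Lipschitz along the path,
    vanish at a pole of one matrix, and are bounded below there if the other
    matrix has its spectrum at a distance. *)
Lemma Hurwitz_homotopy1 n (A0 A1 : 'M[C]_n) :
  (forall t : R, 0 <= t <= 1 -> forall s, complex.Re s = 0 ->
     nonpole s (A0 + t%:C%C *: A1)) ->
  Hurwitz A0 -> Hurwitz (A0 + A1).
Proof.
move=> axis h0; pose A (t : R) := A0 + t%:C%C *: A1.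
suff: Hurwitz (A 1) by rewrite /A scale1r.
have : Hurwitz (A 0) by rewrite /A scale0r addr0.
apply: (unit_interval_connected (P := fun t => Hurwitz (A t))) => t t01.
pose M := entry_sum A0 + entry_sum A1.
have AM t' i j : 0 <= t' <= 1 -> cabs (A t' i j) <= M.
  move=> /andP[t0 t1]; rewrite !mxE; apply: le_trans (cabsD _ _) _.
  apply: lerD; first exact: entry_le_sum.
  rewrite cabsM cabs_real ger0_norm //; apply: le_trans (entry_le_sum _ i j).
  by rewrite ler_piMl // cabs_ge0.
have AL t' i j : cabs (A t' i j - A t i j) <= M * `|t' - t|.
  rewrite !mxE.
  have -> : A0 i j + t'%:C%C * A1 i j - (A0 i j + t%:C%C * A1 i j)
      = (t' - t)%:C%C * A1 i j by rewrite rmorphB; ring.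
  rewrite cabs_realM mulrC; apply: ler_wpM2r; first exact: normr_ge0.
  apply: le_trans (entry_le_sum _ i j) _; rewrite lerDr; exact: entry_sum_ge0.
have {}axis t' : 0 <= t' <= 1 -> forall s, complex.Re s = 0 -> nonpole s (A t').
  exact: axis.
clearbody A.
have specM t' s : 0 <= t' <= 1 -> ~~ nonpole s (A t') -> cabs s <= n%:R * (n%:R * M).
  move=> t'01 /spectrum_bounded h; apply: le_trans h _.
  rewrite /entry_sum mulr_natl -[n in _ *+ n](card_ord n) -sumr_const.
  apply: ler_sum => i _; rewrite mulr_natl -[n in _ *+ n](card_ord n) -sumr_const.
  by apply: ler_sum => j _; exact: AM.
have M0 : 0 <= M by rewrite addr_ge0 // entry_sum_ge0.
(* All poles lie in a fixed disk, so the Lipschitz constant may depend on a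
   bound for s. *)
have cont (Bs : R) : exists2 k : R, 0 <= k & forall t' s, 0 <= t' <= 1 -> cabs s <= Bs ->
    cabs (\det (s%:M - A t) - \det (s%:M - A t')) <= k * `|t' - t|.
  have [k k0 hk] := det_lipschitz n (Bs + M).
  exists (k * M); first exact: mulr_ge0.
  move=> t' s t'01 sB; rewrite -mulrA; apply: hk => [i j|i j|i j].
  - rewrite !mxE; apply: le_trans (cabsD _ _) _; rewrite cabsN; apply: lerD.
      by case: (i == j); rewrite ?mulr1n // mulr0n cabs0 (le_trans (cabs_ge0 s)).
    exact: AM.
  - rewrite !mxE; apply: le_trans (cabsD _ _) _; rewrite cabsN; apply: lerD.
      by case: (i == j); rewrite ?mulr1n // mulr0n cabs0 (le_trans (cabs_ge0 s)).
    exact: AM.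
  - rewrite !mxE; set x := s *+ _.
    have -> : x - A t i j - (x - A t' i j) = A t' i j - A t i j by ring.
    exact: AL.
have [ht|nht] := pselect (Hurwitz (A t)).
  have [d d0 hd] := Hurwitz_gap ht.
  have [k k0 hk] := cont (n%:R * (n%:R * M)).
  have dn : 0 < d ^+ n by rewrite exprn_gt0.
  exists (d ^+ n / (k + 1)); first by rewrite divr_gt0 //; lra.
  move=> t' t'01 close; split=> [_|_]; last exact: ht.
  apply: contrapT => /unstable_pole [s Res ns].
  have := hk t' s t'01 (specM _ _ t'01 ns); rewrite (det_at_pole ns) subr0.
  have := det_lower_bound (ltW d0) hd (s := s); rewrite addNr => /(_ Res).
  move: close; rewrite ltr_pdivlMr; last lra.
  have := normr_ge0 (t' - t); set a := `|_|; nra.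
have [s Res ns] := unstable_pole nht.
have s0 : 0 < complex.Re s.
  rewrite lt_neqAle Res andbT; apply: contraNneq ns => /esym; exact: axis.
have [k k0 hk] := cont (cabs s).
have dn : 0 < complex.Re s ^+ n by rewrite exprn_gt0.
have k1 : 0 < k + 1 by lra.
exists (complex.Re s ^+ n / (k + 1)); first exact: divr_gt0.
move=> t' t'01 close; split=> [/nht[]|ht']; exfalso.
have := hk t' s t'01 (lexx _); rewrite (det_at_pole ns) sub0r cabsN.
have hd z : ~~ nonpole z (A t') -> complex.Re z <= 0.
  by move=> /negP nz; rewrite leNgt; apply/negP=> /ltW /ht'.
have hs : 0 + complex.Re s <= complex.Re s by rewrite add0r.
have := det_lower_bound Res hd hs.
move: close; rewrite ltr_pdivlMr; last lra.
have := normr_ge0 (t' - t); set a := `|_|; nra.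
Qed.

Lemma Hurwitz_homotopy n (A0 A1 : 'M[C]_n) :
  (forall t : R, 0 <= t <= 1 -> forall s, complex.Re s = 0 ->
     nonpole s (A0 + t%:C%C *: A1)) ->
  Hurwitz A0 <-> Hurwitz (A0 + A1).
Proof.
move=> axis; split; first exact: Hurwitz_homotopy1.
have := @Hurwitz_homotopy1 n (A0 + A1) (- A1); rewrite addrK; apply=> t t01 s Res.
have -> : A0 + A1 + t%:C%C *: - A1 = A0 + (1 - t)%:C%C *: A1.
  by rewrite rmorphB rmorph1 scalerBl scale1r scalerN addrA.
by apply: axis => //; lra.
Qed.

End Homotopy.

(** * Conjugate transposes and contractions *)

Section Adjoint.
Variable C : numClosedFieldType.

Lemma adjmxM m n p (A : 'M[C]_(m, n)) (B : 'M[C]_(n, p)) :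
  (A *m B)^t* = B^t* *m A^t*.
Proof. by rewrite trmx_mul map_mxM. Qed.

Lemma adjmxD m n (A B : 'M[C]_(m, n)) : (A + B)^t* = A^t* + B^t*.
Proof. by rewrite linearD map_mxD. Qed.

Lemma adjmxN m n (A : 'M[C]_(m, n)) : (- A)^t* = - A^t*.
Proof. by rewrite linearN map_mxN. Qed.

Lemma adjmxZ m n (c : C) (A : 'M[C]_(m, n)) : (c *: A)^t* = c^* *: A^t*.
Proof. by rewrite linearZ map_mxZ. Qed.

Lemma adjmxK m n (A : 'M[C]_(m, n)) : A^t*^t* = A.
Proof. by apply/matrixP=> i j; rewrite !mxE conjCK. Qed.

Lemma adjmx0 m n : (0 : 'M[C]_(m, n))^t* = 0.
Proof. by rewrite trmx0 map_mx0. Qed.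

Lemma adjmx_scalar n (c : C) : (c%:M : 'M[C]_n)^t* = c^*%:M.
Proof. by rewrite tr_scalar_mx map_scalar_mx. Qed.

Lemma adjmx1 n : (1%:M : 'M[C]_n)^t* = 1%:M.
Proof. by rewrite adjmx_scalar conjC1. Qed.

Lemma adj_row_mx m n1 n2 (A : 'M[C]_(m, n1)) (B : 'M[C]_(m, n2)) :
  (row_mx A B)^t* = col_mx (A^t*) (B^t*).
Proof. by rewrite tr_row_mx map_col_mx. Qed.

Lemma adj_col_mx m1 m2 n (A : 'M[C]_(m1, n)) (B : 'M[C]_(m2, n)) :
  (col_mx A B)^t* = row_mx (A^t*) (B^t*).
Proof. by rewrite tr_col_mx map_row_mx. Qed.

Lemma adj_block_mx m1 m2 n1 n2 (A : 'M[C]_(m1, n1)) (B : 'M[C]_(m1, n2))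
    (D : 'M[C]_(m2, n1)) (E : 'M[C]_(m2, n2)) :
  (block_mx A B D E)^t* = block_mx (A^t*) (D^t*) (B^t*) (E^t*).
Proof. by rewrite tr_block_mx map_block_mx. Qed.

Lemma adjmx_unit n (A : 'M[C]_n) : (A^t* \in unitmx) = (A \in unitmx).
Proof. by rewrite map_unitmx unitmx_tr. Qed.

Lemma adjmx_inv n (A : 'M[C]_n) : (invmx A)^t* = invmx (A^t*).
Proof. by rewrite trmx_inv map_invmx. Qed.

End Adjoint.

Section SquaredNorm.
Variable R : realType.
Local Notation C := R[i].

Definition sqn n (v : 'cV[C]_n) : R := complex.Re ((v^t* *m v) 0 0).

Lemma sqn_sum n (v : 'cV[C]_n) : sqn v = \sum_i cabs (v i 0) ^+ 2.
Proof.
rewrite /sqn mxE cRe_sum; apply: eq_bigr => i _; rewrite !mxE.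
apply: (@complexI R); rewrite [RHS]rmorphXn /= -cabsE normCKC RRe_real //.
by rewrite -normCKC rpredX // normr_real.
Qed.

Lemma sqn_ge0 n (v : 'cV[C]_n) : 0 <= sqn v.
Proof. by rewrite sqn_sum sumr_ge0 // => i _; rewrite sqr_ge0. Qed.

Lemma sqn0 n : sqn (0 : 'cV[C]_n) = 0.
Proof. by rewrite /sqn mulmx0 mxE. Qed.

Lemma sqn_gt0 n (v : 'cV[C]_n) : v != 0 -> 0 < sqn v.
Proof.
move=> v0; have [i vi] : exists i, v i 0 != 0.
  apply/existsP; apply: contraNT v0; rewrite negb_exists => /forallP h.
  by apply/eqP/matrixP=> i j; rewrite ord1 mxE; apply/eqP; move: (h i); rewrite negbK.
rewrite sqn_sum (bigD1 i) //= ltr_pwDl ?exprn_gt0 ?cabs_gt0 //.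
by rewrite sumr_ge0 // => j _; rewrite sqr_ge0.
Qed.

Lemma sqn_eq0 n (v : 'cV[C]_n) : sqn v <= 0 -> v = 0.
Proof. by move=> v0; apply/eqP; apply: contraTT v0 => /sqn_gt0; rewrite ltNge. Qed.

Lemma sqnE n (v : 'cV[C]_n) : v^t* *m v = (sqn v)%:C%C%:M.
Proof.
apply/matrixP=> i j; rewrite !ord1 [in RHS]mxE eqxx mulr1n /sqn RRe_real //.
rewrite mxE rpred_sum // => k _; rewrite !mxE -normCKC rpredX //.
exact: normr_real.
Qed.

Lemma sqn_scale n (c : C) (v : 'cV[C]_n) : sqn (c *: v) = cabs c ^+ 2 * sqn v.
Proof.
by rewrite !sqn_sum mulr_sumr; apply: eq_bigr => i _; rewrite mxE cabsM exprMn.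
Qed.

Lemma Re_adj n (u v : 'cV[C]_n) :
  complex.Re ((u^t* *m v) 0 0) = complex.Re ((v^t* *m u) 0 0).
Proof.
by rewrite -[u in RHS]adjmxK -adjmxM [in RHS]mxE [in RHS]mxE cRe_conj.
Qed.

Lemma sqn_sub n (u v : 'cV[C]_n) :
  sqn (u - v) = sqn u + sqn v - 2 * complex.Re ((v^t* *m u) 0 0).
Proof.
rewrite /sqn adjmxD adjmxN mulmxBl !mulmxBr !(addmxE, oppmxE) !(cReD, cReN).
rewrite (Re_adj u v).
move: (complex.Re ((u^t* *m u) 0 0)) (complex.Re ((v^t* *m v) 0 0)) => a b.
by move: (complex.Re ((v^t* *m u) 0 0)) => c; ring.
Qed.

Definition contractive p m (M : 'M[C]_(p, m)) : Prop :=
  forall u : 'cV[C]_m, u != 0 -> sqn (M *m u) < sqn u.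

(** With [u = M^* y], expanding [|M u - y|^2 >= 0] gives
    [2 |u|^2 <= |M u|^2 + |y|^2], and [|M u| < |u|] unless [u] vanishes. *)
Lemma contractive_adj p m (M : 'M[C]_(p, m)) : contractive M -> contractive (M^t*).
Proof.
move=> hM y y0; set u := M^t* *m y.
have [u0|u0] := eqVneq u 0; first by rewrite u0 sqn0 sqn_gt0.
have := sqn_ge0 (M *m u - y); rewrite sqn_sub.
have -> : y^t* *m (M *m u) = u^t* *m u by rewrite mulmxA adjmxM adjmxK.
by have := hM u u0; rewrite -/(sqn u); lra.
Qed.

End SquaredNorm.

(** * Stable contractive systems *)

Section StableContraction.
Variable R : realType.
Local Notation C := R[i].

(** Internal stability together with an H-infinity norm less than one, in the
    left half-plane picture. The value at infinity, [sysD], belongs to the axis: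
    it is the value of the rational matrix at the center on the unit circle. *)
Definition stable_contraction n m p (G : sys C n m p) : Prop :=
  [/\ Hurwitz (sysA G),
      forall s, complex.Re s = 0 -> contractive (transfer s G)
    & contractive (sysD G)].

(** Contractivity at a point of the axis, on trajectories: it also excludes a
    pole at that point. *)
Definition dissipative_at s n m p (G : sys C n m p) : Prop :=
  forall (x : 'cV_n) (u : 'cV_m), (x != 0) || (u != 0) ->
  s *: x = sysA G *m x + sysB G *m u -> sqn (sysC G *m x + sysD G *m u) < sqn u.

Lemma dissipative_atP s n m p (G : sys C n m p) :
  dissipative_at s G <-> nonpole s (sysA G) /\ contractive (transfer s G).
Proof.
split=> [dG|[uG cG] x u xu ex].
  have uG : nonpole s (sysA G).
    apply/nonpoleP => x ex; apply/eqP; apply/negPn/negP => x0.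
    have := dG x 0; rewrite x0 !mulmx0 !addr0 ex => /(_ isT erefl).
    by rewrite sqn0 ltNge sqn_ge0.
  split=> // u u0; have [x ex] := resolvent_state (sysB G) u uG.
  by rewrite -(transfer_signal uG ex) dG // u0 orbT.
rewrite (transfer_signal uG ex); apply: cG; apply: contraTneq xu => u0.
rewrite u0 eqxx orbF negbK; apply/eqP; apply: (nonpoleP _ _ uG).
by rewrite ex u0 mulmx0 addr0.
Qed.

Lemma stable_contractionP n m p (G : sys C n m p) :
  stable_contraction G <-> [/\ Hurwitz (sysA G),
    forall s, complex.Re s = 0 -> dissipative_at s G & contractive (sysD G)].
Proof.
split=> -[hA hs hD]; split=> // s Res.
  by apply/dissipative_atP; split; [apply: hA; rewrite Res|exact: hs].
by have /dissipative_atP [] := hs s Res.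
Qed.

Definition adj_sys n m p (G : sys C n m p) : sys C n p m :=
  Sys ((sysA G)^t*) ((sysC G)^t*) ((sysB G)^t*) ((sysD G)^t*).

Lemma nonpole_adj n (A : 'M[C]_n) s : nonpole s (A^t*) = nonpole s^* A.
Proof.
rewrite /nonpole -adjmx_unit adjmxD adjmxN adjmxK.
by rewrite adjmx_scalar.
Qed.

Lemma Hurwitz_adj n (A : 'M[C]_n) : Hurwitz A -> Hurwitz (A^t*).
Proof. by move=> hA s Res; rewrite nonpole_adj; apply: hA; rewrite cRe_conj. Qed.

Lemma stable_contraction_adj n m p (G : sys C n m p) :
  stable_contraction G -> stable_contraction (adj_sys G).
Proof.
case=> hA hs hD; split; [exact: Hurwitz_adj| |exact: contractive_adj].
move=> s Res; have := contractive_adj (hs s^* _); rewrite cRe_conj => /(_ Res).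
rewrite /transfer !(adjmxD, adjmxM) /= adjmx_inv adjmxD adjmxN adjmx_scalar conjCK.
by rewrite mulmxA.
Qed.

Lemma adj_sysK n m p (G : sys C n m p) : adj_sys (adj_sys G) = G.
Proof. by case: G => *; rewrite /adj_sys /= !adjmxK. Qed.

Definition adj_plant n m1 m2 p1 p2 (P : plant C n m1 m2 p1 p2) :
    plant C n p1 p2 m1 m2 :=
  Plant ((plA P)^t*) ((plC1 P)^t*) ((plC2 P)^t*) ((plB1 P)^t*) ((plB2 P)^t*)
        ((plD21 P)^t*) ((plD12 P)^t*).

Lemma adj_loop n k m1 m2 p1 p2 (P : plant C n m1 m2 p1 p2) (K : sys C k p2 m2) :
  adj_sys (loop P K) = loop (adj_plant P) (adj_sys K).
Proof.
rewrite /adj_sys /loop /=.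
by rewrite adj_block_mx adj_row_mx adj_col_mx !(adjmxD, adjmxM) !mulmxA.
Qed.

Lemma stable_contraction_adj_loop n k m1 m2 p1 p2 (P : plant C n m1 m2 p1 p2)
    (K : sys C k p2 m2) :
  stable_contraction (loop P K)
  <-> stable_contraction (loop (adj_plant P) (adj_sys K)).
Proof.
rewrite -adj_loop; split; first exact: stable_contraction_adj.
by move/stable_contraction_adj; rewrite adj_sysK.
Qed.

Lemma nonpole_ublock (s : C) n k (A : 'M[C]_n) (B : 'M[C]_(n, k)) (D : 'M[C]_k) :
  nonpole s (block_mx A B 0 D) = nonpole s A && nonpole s D.
Proof.
rewrite /nonpole (scalar_mx_block n k s) opp_block_mx add_block_mx oppr0 addr0.
by rewrite !unitmxE det_ublock unitrM.
Qed.

Lemma Hurwitz_ublock n k (A : 'M[C]_n) (B : 'M[C]_(n, k)) (D : 'M[C]_k) :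
  Hurwitz (block_mx A B 0 D) <-> Hurwitz A /\ Hurwitz D.
Proof.
split=> [h|[hA hD] s Res]; last by rewrite nonpole_ublock hA ?hD.
by split=> s Res; have := h s Res; rewrite nonpole_ublock => /andP[].
Qed.

End StableContraction.

(** * Closing a loop around an inner system *)

(** [X] is a storage function: the derivative of [x^* X x] along a trajectory
    makes up exactly for the difference between the energies of inputs and
    outputs. *)
Lemma lossless_energy (C : numClosedFieldType) n m1 m2 p1 (A X : 'M[C]_n)
    (B1 : 'M[C]_(n, m1)) (B2 : 'M[C]_(n, m2)) (C1 : 'M[C]_(p1, n))
    (C2 : 'M[C]_(m1, n)) (D12 : 'M[C]_(p1, m2))
    (hX : X^t* = X)
    (lyap : A^t* *m X + X *m A + C1^t* *m C1 + C2^t* *m C2 = 0)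
    (XB1 : X *m B1 = - C2^t*) (XB2 : X *m B2 = - (C1^t* *m D12))
    (D12_isometry : D12^t* *m D12 = 1%:M)
    (x : 'cV[C]_n) (w : 'cV[C]_m1) (v : 'cV[C]_m2) :
  let xd := A *m x + B1 *m w + B2 *m v in
  let z := C1 *m x + D12 *m v in
  let r := C2 *m x + w in
  x^t* *m X *m xd + xd^t* *m X *m x + z^t* *m z + r^t* *m r
  = w^t* *m w + v^t* *m v.
Proof.
move=> xd z r; rewrite /xd /z /r !(adjmxD, adjmxM).
have e1 : x^t* *m X *m B1 = - (x^t* *m C2^t*) by rewrite -mulmxA XB1 mulmxN.
have e2 : x^t* *m X *m B2 = - (x^t* *m C1^t* *m D12).
  by rewrite -mulmxA XB2 mulmxN mulmxA.
have e3 : w^t* *m B1^t* *m X = - (w^t* *m C2).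
  by rewrite -mulmxA -[X in B1^t* *m X]hX -adjmxM XB1 adjmxN adjmxK mulmxN.
have e4 : v^t* *m B2^t* *m X = - (v^t* *m D12^t* *m C1).
  rewrite -mulmxA -[X in B2^t* *m X]hX -adjmxM XB2 adjmxN adjmxM adjmxK mulmxN.
  by rewrite mulmxA.
have e5 : v^t* *m D12^t* *m D12 = v^t* by rewrite -mulmxA D12_isometry mulmx1.
have e6 : x^t* *m A^t* *m X *m x = - (x^t* *m X *m A *m x
    + x^t* *m C1^t* *m C1 *m x + x^t* *m C2^t* *m C2 *m x).
  apply/eqP; rewrite -addr_eq0; apply/eqP.
  have := congr1 (fun M => x^t* *m M *m x) lyap; rewrite mulmx0 mul0mx => <-.
  by mx_ring.
mx_normal; rewrite e1 e2 e3 e4 e5 e6; mx_ring.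
Qed.

Section Inner.
Variable R : realType.
Local Notation C := R[i].
Variables (n m1 m2 p1 : nat) (A X : 'M[C]_n).
Variables (B1 : 'M[C]_(n, m1)) (B2 : 'M[C]_(n, m2)).
Variables (C1 : 'M[C]_(p1, n)) (C2 : 'M[C]_(m1, n)) (D12 : 'M[C]_(p1, m2)).
Hypothesis hX : X^t* = X.
Hypothesis lyap : A^t* *m X + X *m A + C1^t* *m C1 + C2^t* *m C2 = 0.
Hypothesis XB1 : X *m B1 = - C2^t*.
Hypothesis XB2 : X *m B2 = - (C1^t* *m D12).
Hypothesis D12_isometry : D12^t* *m D12 = 1%:M.
Hypothesis X_ge0 : forall v : 'cV[C]_n, 0 <= complex.Re ((v^t* *m X *m v) 0 0).
Hypothesis hinv : Hurwitz (A - B1 *m C2).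

Let P : plant C n m1 m2 p1 m1 := Plant A B1 B2 C1 C2 D12 1%:M.

Lemma inner_energy s (x : 'cV[C]_n) w v : complex.Re s = 0 ->
  s *: x = A *m x + B1 *m w + B2 *m v ->
  sqn (C1 *m x + D12 *m v) + sqn (C2 *m x + w) = sqn w + sqn v.
Proof.
move=> Res ex; have := lossless_energy hX lyap XB1 XB2 D12_isometry x w v; rewrite /= -ex.
have -> : x^t* *m X *m (s *: x) + (s *: x)^t* *m X *m x = 0.
  rewrite adjmxZ -!scalemxAr -!scalemxAl -scalerDl.
  suff -> : s + s^* = 0 by rewrite scale0r.
  rewrite conjcE; case: s Res {ex} => a b /= ->; apply/eqP.
  by rewrite eq_complex /= addr0 subrr eqxx.
rewrite add0r => /(congr1 (fun M : 'M[C]_1 => complex.Re (M 0 0))).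
by rewrite !addmxE !cReD.
Qed.

(** Along an unforced mode with [Re s >= 0] the energy balance leaves no room for
    an output, as [X >= 0]; but a mode with [C2 x = 0] is also one of the stable
    matrix [A - B1 C2]. *)
Lemma inner_Hurwitz : Hurwitz A.
Proof.
move=> s Res; apply/nonpoleP => x ex.
have := lossless_energy hX lyap XB1 XB2 D12_isometry x 0 0; rewrite /= !mulmx0 !addr0 ex.
have -> : x^t* *m X *m (s *: x) + (s *: x)^t* *m X *m x
    = (2 * complex.Re s)%:C%C *: (x^t* *m X *m x).
  rewrite adjmxZ -!scalemxAr -!scalemxAl -scalerDl conjcE; congr (_ *: _).
  apply/eqP; case: s {Res ex} => a b; rewrite eq_complex /= subrr.
  by apply/andP; split=> //; apply/eqP; ring.
move/(congr1 (fun M : 'M[C]_1 => complex.Re (M 0 0))).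
rewrite !addmxE !cReD scalemxE cReM /= mul0r subr0 -!/(sqn _) zeromxE /= => e.
have c2 : C2 *m x = 0.
  apply: sqn_eq0; have := sqn_ge0 (C1 *m x); have := X_ge0 x.
  move: e Res; rewrite /=; move: (complex.Re s) (complex.Re _) (sqn _) (sqn _) => a b c d; nra.
apply: (nonpoleP _ _ (hinv Res)).
by rewrite mulmxBl -mulmxA c2 mulmx0 subr0.
Qed.

Lemma sqn_D12 v : sqn (D12 *m v) = sqn v.
Proof. by rewrite /sqn adjmxM mulmxA -[_ *m _ *m D12]mulmxA D12_isometry mulmx1. Qed.

Section Loop.
Variables (k : nat) (Q : sys C k m1 m2).

(** Scaling the feedback signal by [t] leads from the decoupled systems to the
    closed loop. Since the inner system does not amplify and [Q] strictly
    attenuates, no eigenvalue meets the axis on the way. *)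
Lemma inner_loop_Hurwitz :
  (forall s, complex.Re s = 0 -> dissipative_at s Q) ->
  Hurwitz (sysA Q) <-> Hurwitz (sysA (loop P Q)).
Proof.
move=> dQ; have hA := inner_Hurwitz.
pose A0 := block_mx A (B2 *m sysC Q) 0 (sysA Q).
pose A1 : 'M[C]_(n + k) := block_mx (B2 *m sysD Q *m C2) 0 (sysB Q *m C2) 0.
have -> : sysA (loop P Q) = A0 + A1.
  by rewrite /= add_block_mx !addr0 add0r.
suff axis (t : R) : 0 <= t <= 1 -> forall s, complex.Re s = 0 ->
    nonpole s (A0 + t%:C%C *: A1).
  rewrite -(Hurwitz_homotopy axis) Hurwitz_ublock.
  by split=> [|[]].
move=> /andP[t0 t1] s Res; apply/nonpoleP => y.
rewrite -[y]vsubmxK; set x := usubmx y; set q := dsubmx y.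
rewrite scale_block_mx add_block_mx !scaler0 !addr0 add0r mul_block_col scale_col_mx.
move=> /eq_col_mx [ex eq].
pose r := t%:C%C *: (C2 *m x); pose v := sysC Q *m q + sysD Q *m r.
have {}ex : s *: x = A *m x + B1 *m 0 + B2 *m v.
  rewrite -ex /v /r mulmx0 addr0 -!scalemxAr mulmxDl mulmxDr -!scalemxAl -!scalemxAr !mulmxA.
  by rewrite -addrA [X in _ + X = _]addrC.
have {}eq : s *: q = sysA Q *m q + sysB Q *m r.
  by rewrite -eq /r -scalemxAl -scalemxAr mulmxA addrC.
have := inner_energy Res ex; rewrite addr0 sqn0 add0r => en.
have [qr|] := boolP ((q != 0) || (r != 0)).
  have := dQ s Res q r qr eq; rewrite -/v /r sqn_scale cabs_real ger0_norm //.
  have := sqn_ge0 (C1 *m x + D12 *m v); have := sqn_ge0 (C2 *m x); move: en.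
  have : t ^+ 2 * sqn (C2 *m x) <= sqn (C2 *m x).
    by apply: ler_piMl; [exact: sqn_ge0|rewrite expr_le1].
  by move: (sqn v) (sqn (C2 *m x)) (sqn (C1 *m x + _)) => a b c *; exfalso; lra.
rewrite negb_or !negbK => /andP[/eqP q0 /eqP r0].
have v0 : v = 0 by rewrite /v q0 r0 !mulmx0 addr0.
suff -> : x = 0 by rewrite q0 col_mx0.
apply: (nonpoleP _ _ (hA s _)); first by rewrite Res.
by rewrite ex v0 !mulmx0 !addr0.
Qed.

(** The energy balance on the axis turns a strict loss in [Q] into a strict loss
    of the whole loop. Conversely, since [A - B1 C2] has no pole on the axis, the
    inner system can be driven so as to present any trajectory to [Q]. *)
Lemma inner_loop : stable_contraction Q <-> stable_contraction (loop P Q).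
Proof.
rewrite !stable_contractionP; split=> -[hQ dQ cQ].
  have hL : Hurwitz (sysA (loop P Q)) by apply/inner_loop_Hurwitz.
  split=> // [s Res y w yw|w w0]; last first.
    by rewrite /= mulmx1 -mulmxA sqn_D12; exact: cQ.
  move: yw; rewrite -[y]vsubmxK; set x := usubmx y; set q := dsubmx y.
  move=> yw /loop_split /= [ex eq ->].
  move: ex eq; rewrite !mul1mx; set r := C2 *m x + w; set v := sysC Q *m q + _.
  move=> ex eq; have := inner_energy Res ex; rewrite -/r => en.
  have [qr|] := boolP ((q != 0) || (r != 0)).
    by have := dQ s Res q r qr eq; rewrite -/v; lra.
  rewrite negb_or !negbK => /andP[/eqP q0 /eqP r0].
  have v0 : v = 0 by rewrite /v q0 r0 !mulmx0 addr0.
  have wE : w = - (C2 *m x) by apply/eqP; rewrite -addr_eq0 addrC; apply/eqP.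
  have x0 : x = 0.
    apply: (nonpoleP _ _ (hinv (s := s) _)); first by rewrite Res.
    by rewrite ex v0 wE mulmx0 addr0 mulmxBl mulmxN mulmxA.
  have w0 : w = 0 by rewrite wE x0 mulmx0 oppr0.
  by move: yw; rewrite w0 x0 q0 col_mx0 !eqxx.
have dQ' s : complex.Re s = 0 -> dissipative_at s Q.
  move=> Res q r qr eq; set v := sysC Q *m q + _.
  have [|x ex] := resolvent_state (row_mx B1 B2) (col_mx r v) (hinv (s := s) _).
    by rewrite Res.
  pose w := r - C2 *m x.
  have rE : r = C2 *m x + w by rewrite /w addrC subrK.
  have {}ex : s *: x = A *m x + B1 *m w + B2 *m v.
    by rewrite ex mul_row_col /w; mx_ring.
  have := inner_energy Res ex; rewrite -rE => en.
  have [|eL eO] := @loop_state _ s _ _ _ _ _ _ P Q _ x q w v r erefl _ ex eq.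
    by rewrite /= mul1mx.
  have := dQ s Res (col_mx x q) w; rewrite -eO -eL /=.
  suff -> : (col_mx x q != 0) || (w != 0) by move=> /(_ isT erefl); lra.
  apply: contraTT qr; rewrite !negb_or !negbK => /andP[/eqP].
  rewrite -[0 in X in X -> _]col_mx0 => /eq_col_mx [x0 q0] /eqP w0.
  by rewrite rE x0 q0 w0 mulmx0 addr0 !eqxx.
split=> //; first by apply/inner_loop_Hurwitz.
move=> w w0; have := cQ w w0; rewrite /= mulmx1 -mulmxA sqn_D12; exact.
Qed.

End Loop.
End Inner.

(** * Completing the square with a Riccati solution *)

(** The plant seen by the controller after the worst disturbance [F1 x] has
    been split off and the output replaced by the deviation of the control
    from [F2 x]. *)
Definition square_plant (F : fieldType) n m1 m2 p1 p2
    (T : plant F n m1 m2 p1 p2) (F1 : 'M[F]_(m1, n)) (F2 : 'M[F]_(m2, n))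
    (S : 'M[F]_m2) : plant F n m1 m2 m2 p2 :=
  Plant (plA T + plB1 T *m F1) (plB1 T) (plB2 T)
        (- (S *m F2)) (plC2 T + plD21 T *m F1) S (plD21 T).

(** The factor split off: the original loop is this system closed by the loop
    of the new plant. *)
Definition square_factor (F : fieldType) n m1 m2 p1 p2
    (T : plant F n m1 m2 p1 p2) (F1 : 'M[F]_(m1, n)) (F2 : 'M[F]_(m2, n))
    (S : 'M[F]_m2) : plant F n m1 m2 p1 m1 :=
  Plant (plA T + plB2 T *m F2) (plB1 T) (plB2 T *m invmx S)
        (plC1 T + plD12 T *m F2) (- F1) (plD12 T *m invmx S) 1%:M.

Section Factorization.
Variables (F : fieldType) (s : F) (n k m1 m2 p1 p2 : nat).
Variables (T : plant F n m1 m2 p1 p2) (K : sys F k p2 m2).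
Variables (F1 : 'M[F]_(m1, n)) (F2 : 'M[F]_(m2, n)) (S : 'M[F]_m2).
Hypothesis uS : S \in unitmx.

Let cancelS r q (M : 'M[F]_(r, m2)) (x : 'M[F]_(n, q)) (u : 'M[F]_(m2, q)) :
  M *m invmx S *m (- (S *m F2) *m x + S *m u) = M *m (u - F2 *m x).
Proof.
have -> : - (S *m F2) *m x + S *m u = S *m (u - F2 *m x) by mx_ring.
by rewrite mulmxA mulmxKV.
Qed.

Let G := loop T K.
Let G' := loop (square_factor T F1 F2 S) (loop (square_plant T F1 F2 S) K).

(** The state of the plant is present twice in the factored loop; trajectories
    of the original loop are those where the two copies agree. *)
Lemma square_lift q (x : 'M[F]_(n, q)) (xk : 'M[F]_(k, q)) (w : 'M[F]_(m1, q)) :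
  s *: col_mx x xk = sysA G *m col_mx x xk + sysB G *m w ->
  let y := col_mx x (col_mx x xk) in
  s *: y = sysA G' *m y + sysB G' *m w /\
  sysC G' *m y + sysD G' *m w = sysC G *m col_mx x xk + sysD G *m w.
Proof.
move=> /loop_split /=; set y := plC2 T *m x + _; set u := sysC K *m xk + _.
move=> [ex exk ->].
pose r := w - F1 *m x.
have ey : y = (plC2 T + plD21 T *m F1) *m x + plD21 T *m r.
  by rewrite /y /r; mx_ring.
have [|eL eO] := @loop_state F s _ _ _ _ _ _ (square_plant T F1 F2 S) K _ x xk r u y
    erefl ey _ exk.
  by rewrite ex /r /=; mx_ring.
have [|||-> <-] := @loop_state F s _ _ _ _ _ _ (square_factor T F1 F2 S)
  (loop (square_plant T F1 F2 S) K) _ x (col_mx x xk) w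
  (- (S *m F2) *m x + S *m u) r _ _ _ eL.
- exact: eO.
- by rewrite /r /=; mx_ring.
- by rewrite ex /= cancelS; mx_ring.
- by split=> //=; rewrite cancelS; mx_ring.
Qed.

(** The difference of the two copies is a hidden mode, governed by the matrix
    that the Riccati solution stabilizes. *)
Lemma square_project q (xp x : 'M[F]_(n, q)) (xk : 'M[F]_(k, q)) :
  let y := col_mx xp (col_mx x xk) in
  s *: y = sysA G' *m y ->
  s *: (xp - x) = (plA T + plB1 T *m F1 + plB2 T *m F2) *m (xp - x) /\
  (xp = x -> s *: col_mx x xk = sysA G *m col_mx x xk).
Proof.
move=> y ey; have : s *: y = sysA G' *m y + sysB G' *m 0 by rewrite mulmx0 addr0.
move=> /loop_split [].
set r := plC2 _ *m xp + _ => exp exx _.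
have [ex exk eO] := loop_split exx; move: exp; rewrite {}eO.
set yk := plC2 _ *m x + _ in ex exk *; set u := sysC K *m xk + _ in ex *.
rewrite [plB2 (square_factor _ _ _ _)]/= cancelS => exp; split=> [|e].
  by rewrite scalerBr exp ex /r /=; mx_ring.
have [||] := @loop_state F s _ _ _ _ _ _ T K _ x xk 0 u yk erefl _ _ exk.
- by rewrite /yk /r e /=; mx_ring.
- by rewrite ex /r e /=; mx_ring.
- by rewrite mulmx0 addr0.
Qed.

End Factorization.

(** The factor is inner: the Riccati equation is what makes the identity
    |z|^2 - |w|^2 = |v|^2 - |r|^2 - (x^* X x)' hold. *)
Lemma riccati_lossless (C : numClosedFieldType) n m1 m2 p1 (A X : 'M[C]_n)
    (B1 : 'M[C]_(n, m1)) (B2 : 'M[C]_(n, m2)) (C1 : 'M[C]_(p1, n))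
    (D12 : 'M[C]_(p1, m2)) (F1 : 'M[C]_(m1, n)) (F2 : 'M[C]_(m2, n)) (S : 'M[C]_m2) :
  X^t* = X -> S \in unitmx -> S^t* = S -> S *m S = D12^t* *m D12 ->
  F1 = B1^t* *m X -> D12^t* *m D12 *m F2 = - (B2^t* *m X + D12^t* *m C1) ->
  A^t* *m X + X *m A + C1^t* *m C1 + F1^t* *m F1
    - F2^t* *m (D12^t* *m D12) *m F2 = 0 ->
  let A' := A + B2 *m F2 in let C' := C1 + D12 *m F2 in
  [/\ A'^t* *m X + X *m A' + C'^t* *m C' + (- F1)^t* *m (- F1) = 0,
      X *m B1 = - (- F1)^t*,
      X *m (B2 *m invmx S) = - (C'^t* *m (D12 *m invmx S))
    & (D12 *m invmx S)^t* *m (D12 *m invmx S) = 1%:M].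
Proof.
move=> hX uS hS SS eF1 eF2 are A' C'.
have eF2' : F2^t* *m D12^t* *m D12 = - (X *m B2 + C1^t* *m D12).
  have := congr1 (fun M => M^t*) eF2.
  by rewrite !(adjmxM, adjmxN, adjmxD) !adjmxK hX mulmxA.
split.
- rewrite -[RHS]are /A' /C' !(adjmxM, adjmxD, adjmxN) mulmxN mulNmx opprK.
  have e1 : X *m B2 *m F2 = - (F2^t* *m D12^t* *m D12 *m F2 + C1^t* *m D12 *m F2).
    by rewrite eF2'; mx_ring.
  have e2 : F2^t* *m B2^t* *m X
      = - (F2^t* *m D12^t* *m D12 *m F2 + F2^t* *m D12^t* *m C1).
    have := congr1 (mulmx (F2^t*)) eF2; rewrite !mulmxA mulmxN mulmxDr !mulmxA => ->.
    by mx_ring.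
  by mx_normal; rewrite e1 e2; mx_ring.
- by rewrite adjmxN opprK eF1 adjmxM adjmxK hX.
- rewrite !mulmxA -mulNmx; congr (_ *m _).
  by rewrite /C' adjmxD adjmxM mulmxDl eF2'; mx_ring.
- rewrite adjmxM adjmx_inv hS -!mulmxA [D12^t* *m _]mulmxA -SS -mulmxA mulmxV //.
  by rewrite mulmx1 mulVmx.
Qed.

Section RiccatiStep.
Variable R : realType.
Local Notation C := R[i].

Lemma stable_contraction_eq n n' m p (G : sys C n m p) (G' : sys C n' m p) :
  Hurwitz (sysA G') ->
  (forall s, 0 <= complex.Re s -> nonpole s (sysA G) -> nonpole s (sysA G') ->
     transfer s G = transfer s G') ->
  sysD G = sysD G' -> stable_contraction G -> stable_contraction G'.
Proof.
move=> hG' eT eD [hG hs hD]; split; first exact: hG'; last by rewrite -eD.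
by move=> s Res; rewrite -eT ?Res //; [exact: hs|apply: hG; rewrite Res|apply: hG'; rewrite Res].
Qed.

Variables (n k m1 m2 p1 p2 : nat) (T : plant C n m1 m2 p1 p2).
Variables (K : sys C k p2 m2) (X : 'M[C]_n) (S : 'M[C]_m2).
Variables (F1 : 'M[C]_(m1, n)) (F2 : 'M[C]_(m2, n)).
Hypothesis hX : X^t* = X.
Hypothesis X_ge0 : forall v : 'cV[C]_n, 0 <= complex.Re ((v^t* *m X *m v) 0 0).
Hypothesis uS : S \in unitmx.
Hypothesis hS : S^t* = S.
Hypothesis SS : S *m S = (plD12 T)^t* *m plD12 T.
Hypothesis eF1 : F1 = (plB1 T)^t* *m X.
Hypothesis eF2 : (plD12 T)^t* *m plD12 T *m F2
  = - ((plB2 T)^t* *m X + (plD12 T)^t* *m plC1 T).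
Hypothesis riccati : (plA T)^t* *m X + X *m plA T + (plC1 T)^t* *m plC1 T
  + F1^t* *m F1 - F2^t* *m ((plD12 T)^t* *m plD12 T) *m F2 = 0.
Hypothesis stab : Hurwitz (plA T + plB1 T *m F1 + plB2 T *m F2).

(** The loop factors as an inner system closed by the loop of the new plant, up
    to a stable hidden mode, and inner systems do not affect stable
    contractivity ([inner_loop]). *)
Lemma riccati_step :
  stable_contraction (loop T K)
  <-> stable_contraction (loop (square_plant T F1 F2 S) K).
Proof.
have [e1 e2 e3 e4] := riccati_lossless hX uS hS SS eF1 eF2 riccati.
have hinv : Hurwitz (plA T + plB2 T *m F2 - plB1 T *m - F1).
  by rewrite mulmxN opprK addrAC.
rewrite (inner_loop hX e1 e2 e3 e4 X_ge0 hinv).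
rewrite -/(square_factor T F1 F2 S); set G' := loop (square_factor T F1 F2 S) _.
have hG : Hurwitz (sysA (loop T K)) <-> Hurwitz (sysA G').
  split=> h s Res; apply/nonpoleP => y.
    rewrite -[y]vsubmxK -[dsubmx y]vsubmxK => /esym /square_project -[//|ee].
    move: ee; set xp := usubmx y; set x := usubmx (dsubmx y) => /esym ee.
    have /eqP := nonpoleP _ _ (stab Res) _ ee; rewrite subr_eq0 => /eqP -> /(_ erefl).
    move/esym/(nonpoleP _ _ (h s Res)); rewrite -[0]col_mx0 => /eq_col_mx [-> ->].
    by rewrite !col_mx0.
  rewrite -[y]vsubmxK => ey; have := @square_lift C s _ _ _ _ _ _ T K F1 F2 S uS _
    (usubmx y) (dsubmx y) 0.
  rewrite !mulmx0 !addr0 -ey => /(_ erefl) [ey' _].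
  move: ey'; rewrite addr0 => /esym /(nonpoleP _ _ (h s Res)).
  rewrite -[0]col_mx0 => /eq_col_mx [_].
  exact.
have eT s : nonpole s (sysA (loop T K)) -> nonpole s (sysA G') ->
    transfer s (loop T K) = transfer s G'.
  move=> uG uG'; have [y] := resolvent_state (sysB (loop T K)) 1%:M uG.
  rewrite -[y]vsubmxK => ey; have [] := square_lift F1 F2 uS ey; rewrite -/G' !mulmx1.
  move: ey; rewrite mulmx1 => ey ey' eO.
  by symmetry; apply: (transfer_eq uG' uG ey' ey).
have eD : sysD (loop T K) = sysD G'.
  by rewrite /loop /= mulmx1 !mulmxA mulmxKV.
split=> h; have [hH _ _] := h.
  by apply: stable_contraction_eq _ eD h => [|s _]; [apply/hG|exact: eT].
apply: stable_contraction_eq (esym eD) h; first by apply/hG.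
by move=> s _ u u'; rewrite eT.
Qed.

End RiccatiStep.

(** * Values of rational functions on the Riemann sphere *)

Section Values.
Variables (C F : fieldType) (pf : {rmorphism {poly C} -> F}).
Hypothesis pf_inj : injective pf.
Implicit Types (f g : F) (z : option C).

(** [p] as a form of degree [d] in homogeneous coordinates, at [z]: this treats
    the point at infinity like all others, and makes a quotient of two forms of
    the same degree well defined there. *)
Definition form_eval d (p : {poly C}) z : C := if z is Some w then p.[w] else p`_d.

Definition has_value f z v : Prop := exists d (p q : {poly C}),
  [/\ (size p <= d.+1)%N, (size q <= d.+1)%N, form_eval d q z != 0,
      f = pf p / pf q & v = form_eval d p z / form_eval d q z].

Lemma form_evalD d (p q : {poly C}) z :
  form_eval d (p + q) z = form_eval d p z + form_eval d q z.
Proof. by case: z => [w|] /=; rewrite ?hornerD ?coefD. Qed.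

Lemma form_evalM d e (p q : {poly C}) z : (size p <= d.+1)%N -> (size q <= e.+1)%N ->
  form_eval (d + e) (p * q) z = form_eval d p z * form_eval e q z.
Proof.
case: z => [w|] /= sp sq; first by rewrite hornerM.
have dS : (d < (d + e).+1)%N by rewrite ltnS leq_addr.
rewrite coefM (bigD1 (Ordinal dS)) //= addKn big1 ?addr0 // => j.
rewrite -val_eqE /= neq_ltn => /orP[jd|jd].
  rewrite [q`_ _]nth_default ?mulr0 //; apply: leq_trans sq _.
  by rewrite ltn_subRL ltn_add2r.
by rewrite nth_default ?mul0r //; apply: leq_trans sp _.
Qed.

Lemma size_formM d e (p q : {poly C}) : (size p <= d.+1)%N -> (size q <= e.+1)%N ->
  (size (p * q)%R <= (d + e).+1)%N.
Proof.
move=> sp sq; apply: leq_trans (size_polyMleq _ _) _.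
by rewrite -ltnS; case: (size p + size q)%N (leq_add sp sq) => //= m; rewrite addnS addSn.
Qed.

Lemma form_neq0 d (q : {poly C}) z : form_eval d q z != 0 -> pf q != 0.
Proof.
apply: contraNneq => e; have -> : q = 0 by apply: pf_inj; rewrite e rmorph0.
by case: z => [w|] /=; rewrite ?horner0 ?coef0.
Qed.

Lemma has_value_unique f z v v' : has_value f z v -> has_value f z v' -> v = v'.
Proof.
move=> [d [p [q [sp sq q0 -> ->]]]] [d' [p' [q' [sp' sq' q0' e ->]]]].
have /eqP := e; rewrite eqr_div ?(form_neq0 q0) ?(form_neq0 q0') //.
rewrite -!rmorphM => /eqP /pf_inj e'.
apply/eqP; rewrite eqr_div //; apply/eqP.
by rewrite -form_evalM // e' [(d + d')%N]addnC form_evalM.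
Qed.

Lemma has_valueD f g z v w :
  has_value f z v -> has_value g z w -> has_value (f + g) z (v + w).
Proof.
move=> [d [p [q [sp sq q0 -> ->]]]] [d' [p' [q' [sp' sq' q0' -> ->]]]].
exists (d + d')%N, (p * q' + p' * q), (q * q'); split.
- apply: leq_trans (size_polyD _ _) _; rewrite geq_max size_formM //.
  by rewrite addnC size_formM.
- exact: size_formM.
- by rewrite form_evalM // mulf_neq0.
- by rewrite rmorphD !rmorphM addf_div ?(form_neq0 q0) ?(form_neq0 q0').
- have e := form_evalM z sp' sq; rewrite addnC in e.
  by rewrite form_evalD e !form_evalM // addf_div.
Qed.

Lemma has_valueM f g z v w :
  has_value f z v -> has_value g z w -> has_value (f * g) z (v * w).
Proof.
move=> [d [p [q [sp sq q0 -> ->]]]] [d' [p' [q' [sp' sq' q0' -> ->]]]].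
exists (d + d')%N, (p * p'), (q * q'); split; rewrite ?size_formM //.
- by rewrite form_evalM // mulf_neq0.
- by rewrite !rmorphM mulf_div.
- by rewrite !form_evalM // mulf_div.
Qed.

Lemma has_valueV f z v : v != 0 -> has_value f z v -> has_value f^-1 z v^-1.
Proof.
move=> v0 [d [p [q [sp sq q0 ef ev]]]]; exists d, q, p; split=> //.
- by apply: contra_neq v0 => p0; rewrite ev p0 mul0r.
- by rewrite ef invf_div.
- by rewrite ev invf_div.
Qed.

Lemma has_value_const c z : has_value (pf c%:P) z c.
Proof.
have s1 (a : C) : (size a%:P <= 1)%N by rewrite size_polyC leq_b1.
exists 0%N, c%:P, 1; split=> //.
- by rewrite size_poly1.
- by case: z => [w|] /=; rewrite ?hornerC ?coef1 // oner_eq0.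
- by rewrite rmorph1 divr1.
- by case: z => [w|] /=; rewrite ?hornerC ?coef1 ?coefC divr1.
Qed.

Lemma has_value0 z : has_value 0 z 0.
Proof. by have := has_value_const 0 z; rewrite rmorph0. Qed.

Lemma has_value1 z : has_value 1 z 1.
Proof. by have := has_value_const 1 z; rewrite rmorph1. Qed.

Lemma has_valueN f z v : has_value f z v -> has_value (- f) z (- v).
Proof.
move=> h; rewrite -[f]mul1r -[v]mul1r -!mulNr; apply: has_valueM h.
by have := has_value_const (-1) z; rewrite polyCN rmorphN rmorph1.
Qed.

Lemma has_value_neq0 f z v : has_value f z v -> v != 0 -> f != 0.
Proof.
move=> h; apply: contra_neq => f0; apply: (has_value_unique h).
by rewrite f0; exact: has_value0.
Qed.

Lemma has_value_sum (I : Type) (r : seq I) (P : pred I) (f : I -> F) (v : I -> C) z :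
  (forall i, has_value (f i) z (v i)) ->
  has_value (\sum_(i <- r | P i) f i) z (\sum_(i <- r | P i) v i).
Proof.
by move=> h; elim/big_rec2: _ => [|i a b _ hab]; [exact: has_value0|exact: has_valueD].
Qed.

Lemma has_value_prod (I : Type) (r : seq I) (P : pred I) (f : I -> F) (v : I -> C) z :
  (forall i, has_value (f i) z (v i)) ->
  has_value (\prod_(i <- r | P i) f i) z (\prod_(i <- r | P i) v i).
Proof.
by move=> h; elim/big_rec2: _ => [|i a b _ hab]; [exact: has_value1|exact: has_valueM].
Qed.

Lemma has_value_sign (b : bool) z : has_value ((-1) ^+ b) z ((-1) ^+ b).
Proof.
case: b; rewrite ?expr1 ?expr0; last exact: has_value1.
by apply: has_valueN; exact: has_value1.
Qed.

Definition has_valuemx r m (G : 'M[F]_(r, m)) z (M : 'M[C]_(r, m)) : Prop :=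
  forall i j, has_value (G i j) z (M i j).

Lemma has_valuemxD r m (G H : 'M[F]_(r, m)) z M N :
  has_valuemx G z M -> has_valuemx H z N -> has_valuemx (G + H) z (M + N).
Proof. by move=> hG hH i j; rewrite !mxE; exact: has_valueD. Qed.

Lemma has_valuemxN r m (G : 'M[F]_(r, m)) z M :
  has_valuemx G z M -> has_valuemx (- G) z (- M).
Proof. by move=> hG i j; rewrite !mxE; exact: has_valueN. Qed.

Lemma has_valuemxM p m r (G : 'M[F]_(p, m)) (H : 'M[F]_(m, r)) z M N :
  has_valuemx G z M -> has_valuemx H z N -> has_valuemx (G *m H) z (M *m N).
Proof.
by move=> hG hH i j; rewrite !mxE; apply: has_value_sum => k; exact: has_valueM.
Qed.

Lemma has_valuemxZ r m f (G : 'M[F]_(r, m)) z v M :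
  has_value f z v -> has_valuemx G z M -> has_valuemx (f *: G) z (v *: M).
Proof. by move=> hf hG i j; rewrite !mxE; exact: has_valueM. Qed.

Lemma has_valuemx_scalar n f z v :
  has_value f z v -> has_valuemx (f%:M : 'M[F]_n) z v%:M.
Proof. by move=> hf i j; rewrite !mxE; case: eqP => _ //; exact: has_value0. Qed.

Lemma has_valuemx_const r m (M : 'M[C]_(r, m)) z : has_valuemx (map_mx (fun c => pf c%:P) M) z M.
Proof. by move=> i j; rewrite mxE; exact: has_value_const. Qed.

Lemma has_value_det n (G : 'M[F]_n) z M :
  has_valuemx G z M -> has_value (\det G) z (\det M).
Proof.
move=> h; apply: has_value_sum => s; apply: has_valueM; first exact: has_value_sign.
by apply: has_value_prod.
Qed.

(** The determinant takes a nonzero value at one point of the sphere, hence is a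
    nonzero rational function. *)
Lemma has_valuemx_inv n (G : 'M[F]_n) z M :
  has_valuemx G z M -> M \in unitmx ->
  G \in unitmx /\ has_valuemx (invmx G) z (invmx M).
Proof.
move=> h uM; have dM : \det M != 0 by rewrite -unitfE -unitmxE.
have hd := has_value_det h.
have uG : G \in unitmx by rewrite unitmxE unitfE (has_value_neq0 hd).
split=> //; rewrite /invmx uG uM; apply: has_valuemxZ; first exact: has_valueV.
move=> i j; rewrite !mxE; apply: has_valueM.
  by rewrite -signr_odd -[X in has_value _ _ X]signr_odd; exact: has_value_sign.
by apply: has_value_det => k l; rewrite !mxE.
Qed.

Lemma has_valuemx_unique r m (G : 'M[F]_(r, m)) z M N :
  has_valuemx G z M -> has_valuemx G z N -> M = N.
Proof. by move=> h k; apply/matrixP=> i j; exact: has_value_unique (h i j) (k i j). Qed.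

End Values.

Section RationalValues.
Variable R : realType.
Local Notation F := (ratfunc R).
Implicit Types (f g : F) (z : option R[i]).

Lemma tofracI : injective (@FracField.tofrac {poly R[i]}).
Proof. by move=> p q /eqP; rewrite tofrac_eq => /eqP. Qed.

Local Notation has_value := (has_value (@FracField.tofrac {poly R[i]})).
Local Notation has_valuemx := (has_valuemx (@FracField.tofrac {poly R[i]})).

Lemma analytic_atP f z : analytic_at f z <-> exists v, has_value f z v.
Proof.
split=> [[p [q [q0 -> h]]]|[v [d [p [q [sp sq q0 -> _]]]]]]; last first.
  have qn0 : q != 0 by have := form_neq0 tofracI q0; rewrite tofrac_eq0.
  exists p, q; split=> //; case: z q0 => //= q0.
  apply: leq_trans sp _; rewrite ltnNge; apply: contra q0 => h.
  by rewrite nth_default.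
case: z h => [w|] h.
  pose d := maxn (size p) (size q).
  exists (p.[w] / q.[w]), d, p, q.
  by split=> //; rewrite -ltnS ltnW // !ltnS /d ?leq_maxl ?leq_maxr.
have sq : size q = (size q).-1.+1 by rewrite prednK // size_poly_gt0.
exists (p`_(size q).-1 / q`_(size q).-1), (size q).-1, p, q.
by rewrite -sq; split=> //=; rewrite -lead_coefE lead_coef_eq0.
Qed.

Lemma ratfunc_evalE f w v : has_value f (Some w) v -> ratfunc_eval w f = v.
Proof.
move=> hv; rewrite /ratfunc_eval; case: xgetP => [u -> [p [q [q0 ef ->]]]|none].
  apply: (has_value_unique tofracI) hv; pose d := maxn (size p) (size q).
  exists d, p, q.
  by split=> //; rewrite -ltnS ltnW // !ltnS /d ?leq_maxl ?leq_maxr.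
have [d [p [q [sp sq q0 ef ev]]]] := hv.
by case: (none v); exists p, q.
Qed.

Lemma ratmx_analyticP r m (G : 'M[F]_(r, m)) z :
  ratmx_analytic_at G z <-> exists M, has_valuemx G z M.
Proof.
split=> [h|[M h] i j]; last by apply/analytic_atP; exists (M i j).
have /choice [v hv] : forall ij : 'I_r * 'I_m, exists v, has_value (G ij.1 ij.2) z v.
  by move=> [i j]; exact/analytic_atP.
by exists (\matrix_(i, j) v (i, j)) => i j; rewrite mxE; exact: (hv (i, j)).
Qed.

Lemma ratmx_evalE r m (G : 'M[F]_(r, m)) w M :
  has_valuemx G (Some w) M -> ratmx_eval G w = M.
Proof. by move=> h; apply/matrixP=> i j; rewrite mxE (ratfunc_evalE (h i j)). Qed.

End RationalValues.

(** * The Cayley transform *)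

Section Cayley.
Variables (K : fieldType) (a b : K).

(** For [b] the conjugate of a number [a] of modulus one, [cayley] maps the unit
    circle to the imaginary axis, its exterior to the right half-plane and [a / b]
    to infinity. A pencil [A - zE] for which [a / b] is no eigenvalue becomes the
    matrix [cayley_A], up to the invertible factor [a E - b A], and the input
    factor [a - b z] of a centered realization is absorbed. *)
Definition cayley_A n (A E : 'M[K]_n) : 'M[K]_n :=
  - (invmx (a *: E - b *: A) *m (2^-1 *: (a *: E + b *: A))).

Definition cayley_sys n m p (A E : 'M[K]_n) (B : 'M[K]_(n, m)) (C : 'M[K]_(p, n))
    (D : 'M[K]_(p, m)) : sys K n m p :=
  Sys (cayley_A A E) (- (invmx (a *: E - b *: A) *m B)) C D.

Definition cayley z : K := - (a + b * z) / (2 * (a - b * z)).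

Definition cayley_inv s : K := a / b * (2 * s + 1) / (2 * s - 1).

Hypothesis ab1 : a * b = 1.
Hypothesis two : (2 : K) != 0.

Let half : 2^-1 + 2^-1 = 1 :> K.
Proof. by field. Qed.

Lemma cayley_pencil n (A E : 'M[K]_n) z :
  a *: E - b *: A \in unitmx -> a - b * z != 0 ->
  z *: E - A
  = (b * z - a) *: ((a *: E - b *: A) *m ((cayley z)%:M - cayley_A A E)).
Proof.
move=> uW z0; rewrite mulmxDr mul_mx_scalar /cayley_A opprK mulKVmx //.
set W := a *: E - _; set P := a *: E + _.
have hs : (b * z - a) * cayley z = (a + b * z) / 2.
  by rewrite /cayley; field; rewrite two.
rewrite scalerDr !scalerA hs; apply/matrixP=> i j.
rewrite /W /P !(addmxE, oppmxE, scalemxE).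
have -> : z * E i j - A i j = a * b * (z * E i j - A i j) by rewrite ab1 mul1r.
by field.
Qed.

Lemma cayley_pencil_unit n (A E : 'M[K]_n) z :
  a *: E - b *: A \in unitmx -> a - b * z != 0 ->
  (z *: E - A \in unitmx) = nonpole (cayley z) (cayley_A A E).
Proof.
move=> uW z0; rewrite (cayley_pencil uW z0) unitmxZ; last by rewrite unitfE -oppr_eq0 opprB.
by rewrite unitmx_mul uW.
Qed.

Lemma cayley_transfer n m p (A E : 'M[K]_n) (B : 'M[K]_(n, m)) (C : 'M[K]_(p, n))
    (D : 'M[K]_(p, m)) z :
  a *: E - b *: A \in unitmx -> a - b * z != 0 ->
  nonpole (cayley z) (cayley_A A E) ->
  D + (a - b * z) *: (C *m invmx (z *: E - A) *m B)
  = transfer (cayley z) (cayley_sys A E B C D).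
Proof.
move=> uW z0 uA; rewrite /transfer /=; congr (_ + _).
have z0' : b * z - a != 0 by rewrite -oppr_eq0 opprB.
rewrite (cayley_pencil uW z0) invmxZ; last first.
  by rewrite unitmxZ ?unitfE // unitmx_mul uW.
rewrite (_ : invmx (_ *m _) = invmx ((cayley z)%:M - cayley_A A E) *m invmx (a *: E - b *: A)).
  rewrite -scalemxAr -scalemxAl scalerA !mulmxA -opprB mulNr divff // scaleN1r.
  by rewrite mulmxN !mulmxA.
have uM : (a *: E - b *: A) *m ((cayley z)%:M - cayley_A A E) \in unitmx.
  by rewrite unitmx_mul uW.
rewrite -[RHS](mulKmx uM) -[LHS]mulmx1; congr (_ *m _).
by rewrite mulmxA mulmxK // mulmxV.
Qed.

Lemma cayley_center n (A E : 'M[K]_n) :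
  A - (a / b) *: E = - b^-1 *: (a *: E - b *: A).
Proof.
have b0 : b != 0 by apply: contra_eq_neq ab1 => ->; rewrite mulr0 eq_sym oner_eq0.
apply/matrixP=> i j; rewrite !(addmxE, oppmxE, scalemxE); field.
by rewrite b0.
Qed.

(** Nothing is lost with standard systems: each one comes from a pencil, with
    [a E - b A = - 1]. *)
Lemma cayley_sysK n m p (G : sys K n m p) :
  a *: (b *: (sysA G - (2^-1)%:M)) - b *: (a *: (sysA G + (2^-1)%:M)) = - 1%:M /\
  cayley_sys (a *: (sysA G + (2^-1)%:M)) (b *: (sysA G - (2^-1)%:M))
    (sysB G) (sysC G) (sysD G) = G.
Proof.
have eW : a *: (b *: (sysA G - (2^-1)%:M)) - b *: (a *: (sysA G + (2^-1)%:M)) = - 1%:M.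
  rewrite !scalerA ab1 [b * a]mulrC ab1 !scale1r opprD addrACA subrr add0r -opprD.
  by rewrite -raddfD /= half.
split=> //; rewrite /cayley_sys /cayley_A eW.
have iN : invmx (- 1%:M : 'M[K]_n) = - 1%:M.
  by rewrite -raddfN invmx_scalar invrN invr1.
rewrite iN !mulNmx !mul1mx !opprK; case: G {eW} => A B C D /=; congr Sys.
rewrite !scalerA ab1 [b * a]mulrC ab1 !scale1r addrACA addNr addr0 scalerDr.
by rewrite -scalerDl half scale1r.
Qed.

End Cayley.

Definition map_sys (K K' : fieldType) (f : K -> K') n m p (G : sys K n m p) :
    sys K' n m p :=
  Sys (map_mx f (sysA G)) (map_mx f (sysB G)) (map_mx f (sysC G)) (map_mx f (sysD G)).

Lemma map_cayley_sys (K K' : fieldType) (f : {rmorphism K -> K'}) (a b : K) n m p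
    (A E : 'M[K]_n) (B : 'M[K]_(n, m)) (C : 'M[K]_(p, n)) (D : 'M[K]_(p, m)) :
  map_sys f (cayley_sys a b A E B C D)
  = cayley_sys (f a) (f b) (map_mx f A) (map_mx f E) (map_mx f B) (map_mx f C)
      (map_mx f D).
Proof.
rewrite /map_sys /cayley_sys /cayley_A /= !map_mxN !map_mxM !map_invmx.
by rewrite map_mxZ map_mxB map_mxD !map_mxZ fmorphV rmorph_nat.
Qed.

(** * Rational matrices as transfer functions of standard systems *)

Section StateSpace.
Variables (R : realType) (alpha : R[i]).
Hypothesis halpha : `|alpha| = 1.
Local Notation C := R[i].
Local Notation F := (ratfunc R).
Local Notation beta := (alpha^*).
Local Notation has_value := (has_value (@FracField.tofrac {poly R[i]})).
Local Notation has_valuemx := (has_valuemx (@FracField.tofrac {poly R[i]})).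

Definition embed : {rmorphism C -> F} := @FracField.tofrac {poly C} \o polyC.

Lemma alpha_beta : alpha * beta = 1.
Proof. by rewrite -normCK halpha expr1n. Qed.

Lemma alpha_neq0 : alpha != 0.
Proof. by rewrite -normr_gt0 halpha ltr01. Qed.

Lemma beta_neq0 : beta != 0.
Proof. by rewrite conjC_eq0 alpha_neq0. Qed.

Lemma cabs_center : cabs (alpha / beta) = 1.
Proof.
by apply: (@complexI R); rewrite -cabsE normf_div norm_conjC halpha divr1.
Qed.

Lemma center_neq z : z != alpha / beta -> alpha - beta * z != 0.
Proof.
apply: contra_neq => /subr0_eq e; apply: (mulIf beta_neq0).
by rewrite divfK ?beta_neq0 // (mulrC z).
Qed.

Lemma cayley_invK s : 2 * s != 1 ->
  cayley_inv alpha beta s != alpha / beta /\ cayley alpha beta (cayley_inv alpha beta s) = s.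
Proof.
rewrite -subr_eq0 => s1; have a0 := alpha_neq0; have b0 := beta_neq0.
have e : beta * cayley_inv alpha beta s = alpha * (2 * s + 1) / (2 * s - 1).
  by move: beta b0 => b b0; rewrite /cayley_inv; field; rewrite b0 s1.
have e1 : alpha - alpha * (2 * s + 1) / (2 * s - 1) = - (2 * alpha) / (2 * s - 1).
  by field.
split.
  apply/negP=> /eqP h; move: e1; rewrite -e h mulrC divfK // subrr => /eqP.
  rewrite eq_sym mulf_eq0 invr_eq0 oppr_eq0 mulf_eq0 (negbTE a0) (negbTE s1) orbF.
  by rewrite orbF pnatr_eq0.
by rewrite /cayley e e1; field; rewrite a0 s1.
Qed.

Lemma cayleyK z : z != alpha / beta -> 2 * cayley alpha beta z != 1 /\
  cayley_inv alpha beta (cayley alpha beta z) = z.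
Proof.
move=> /center_neq z0; have a0 := alpha_neq0; have b0 := beta_neq0.
have e : 2 * cayley alpha beta z - 1 = - (2 * alpha) / (alpha - beta * z).
  by move: beta b0 z0 => b b0 z0; rewrite /cayley; field.
have e' : 2 * cayley alpha beta z - 1 != 0.
  by rewrite e mulf_neq0 ?invr_eq0 // oppr_eq0 mulf_neq0 // pnatr_eq0.
split; first by rewrite -subr_eq0.
rewrite /cayley_inv e; move: beta b0 z0 {e e'} => b b0 z0; rewrite /cayley.
by field; rewrite a0 b0 z0.
Qed.

Lemma cabs_sqr (z : C) : cabs z ^+ 2 = complex.Re z ^+ 2 + complex.Im z ^+ 2.
Proof. by apply: (@complexI R); rewrite rmorphXn /= -cabsE -add_Re2_Im2. Qed.

Lemma cabs_cayley_inv s : 2 * s != 1 ->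
  (1 <= cabs (cayley_inv alpha beta s)) = (0 <= complex.Re s) /\
  (cabs (cayley_inv alpha beta s) == 1) = (complex.Re s == 0).
Proof.
rewrite -subr_eq0 => s1; set w := cayley_inv _ _ s.
have ew : cabs w * cabs (2 * s - 1) = cabs (2 * s + 1).
  by rewrite -cabsM /w /cayley_inv divfK // cabsM cabs_center mul1r.
have c0 : 0 < cabs (2 * s - 1) by rewrite cabs_gt0.
have e2 : cabs (2 * s + 1) ^+ 2 - cabs (2 * s - 1) ^+ 2 = 8 * complex.Re s.
  by rewrite !cabs_sqr; case: s {s1 w ew c0} => x y /=; simpc => /=; ring.
move: ew c0 e2 (cabs_ge0 w).
move: (cabs w) (cabs (2 * s - 1)) (cabs (2 * s + 1)) (complex.Re s) => u v t r <-.
rewrite exprMn => v0 e2 u0.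
have hu : (u ^+ 2 - 1) * v ^+ 2 = 8 * r by rewrite -e2; ring.
have v2 : 0 < v ^+ 2 by rewrite exprn_gt0.
split.
  rewrite -(pmulr_rge0 r (_ : 0 < 8)) // -hu pmulr_lge0 // subr_ge0.
  by rewrite -[X in X <= u ^+ 2](expr1n _ 2) ler_pXn2r // nnegrE.
rewrite -[r == 0](inj_eq (mulfI (_ : (8 : R) != 0))) ?pnatr_eq0 //.
rewrite mulr0 -hu mulf_eq0 (gt_eqF v2) orbF subr_eq0.
by rewrite -[X in _ = (_ == X)](expr1n _ 2) eqrXn2.
Qed.

(** The transfer function of a standard system, evaluated at this rational
    function of [z], is a rational matrix. *)
Definition svar : F := cayley (embed alpha) (embed beta) (poly_ratfunc 'X).

Definition svalue (z : option C) : C :=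
  if z is Some w then cayley alpha beta w else 2^-1.

Lemma has_value_svar z : z != Some (alpha / beta) -> has_value svar z (svalue z).
Proof.
move=> z0; have b0 := beta_neq0.
exists 1%N, (- (alpha%:P + beta *: 'X)), (2 *: (alpha%:P - beta *: 'X)); split.
- rewrite size_polyN (leq_trans (size_polyD _ _)) // geq_max size_polyC.
  by rewrite size_scale // size_polyX leqnn andbT (leq_trans (leq_b1 _)).
- rewrite size_scale ?pnatr_eq0 // (leq_trans (size_polyD _ _)) // geq_max size_polyC.
  by rewrite size_polyN size_scale // size_polyX leqnn andbT (leq_trans (leq_b1 _)).
- case: z z0 => [w|] z0 /=.
    rewrite hornerZ hornerD hornerN hornerZ hornerC hornerX mulf_neq0 ?pnatr_eq0 //.
    by apply: center_neq; apply: contraNneq z0 => ->.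
  by rewrite !(coefZ, coefB, coefC, coefX) /= sub0r mulr1 mulf_neq0 ?pnatr_eq0 // oppr_eq0.
- rewrite /svar /cayley /embed /poly_ratfunc /=.
  rewrite tofracN tofracD -!mul_polyC !tofracM tofracB tofracM.
  by rewrite (_ : FracField.tofrac 2%:P = 2) //; exact: (rmorph_nat embed 2).
- case: z z0 => [w|] z0 /=.
    by rewrite hornerZ !(hornerD, hornerN, hornerZ, hornerC, hornerX).
  rewrite !(coefZ, coefB, coefC, coefX, coefN, coefD) /= add0r sub0r mulr1.
  by rewrite mulrN invrN mulrNN invfM mulrCA mulfV // mulr1.
Qed.

Definition rtransfer n m p (G : sys C n m p) : 'M[F]_(p, m) :=
  transfer svar (map_sys embed G).

Lemma has_value_resolvent n (A : 'M[C]_n) z : z != Some (alpha / beta) ->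
  has_valuemx (svar%:M - const_ratmx A) z ((svalue z)%:M - A).
Proof.
move=> z0; apply: (has_valuemxD (@tofracI R)); last first.
  by apply: has_valuemxN; exact: has_valuemx_const.
by apply: has_valuemx_scalar; exact: has_value_svar.
Qed.

Lemma rtransfer_value n m p (G : sys C n m p) z : z != Some (alpha / beta) ->
  nonpole (svalue z) (sysA G) -> has_valuemx (rtransfer G) z (transfer (svalue z) G).
Proof.
move=> z0 uA; have tI := @tofracI R.
have [_ hI] := has_valuemx_inv tI (has_value_resolvent (sysA G) z0) uA.
apply: (has_valuemxD tI); first exact: has_valuemx_const.
apply: (has_valuemxM tI) (has_valuemx_const _ _ _).
by apply: (has_valuemxM tI) hI; exact: has_valuemx_const.
Qed.

(** A point beyond the bound on the spectrum; evaluation there shows that the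
    resolvent is invertible as a rational matrix, whatever [A]. *)
Lemma spectrum_avoid n (A : 'M[C]_n) : exists2 z, z != alpha / beta &
  nonpole (cayley alpha beta z) A.
Proof.
pose s : C := (entry_sum A + 1)%:C%C.
have s1 : 2 * s != 1.
  rewrite eq_complex /= negb_and; apply/orP; left.
  by apply/eqP; have := entry_sum_ge0 A; simpc => /=; lra.
have [z0 zs] := cayley_invK s1; exists (cayley_inv alpha beta s) => //.
rewrite zs; apply: contraT => /spectrum_bounded.
by rewrite /s cabs_real ger0_norm; have := entry_sum_ge0 A; lra.
Qed.

Lemma nonpole_svar n (A : 'M[C]_n) : nonpole svar (const_ratmx A).
Proof.
have [z z0 uA] := spectrum_avoid A; have z0' : Some z != Some (alpha / beta) by [].
by have [] := has_valuemx_inv (@tofracI R) (has_value_resolvent A z0') uA.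
Qed.

Lemma embed_center_neq0 : embed alpha - embed beta * poly_ratfunc 'X != 0.
Proof.
rewrite /embed /poly_ratfunc /= -tofracM -tofracB tofrac_eq0 subr_eq0.
apply/eqP=> /(congr1 (fun p : {poly C} => p`_0)).
rewrite coefC coefMX /= => /eqP; exact/negP/alpha_neq0.
Qed.

Lemma const_ratmxE p m (M : 'M[C]_(p, m)) : const_ratmx M = map_mx embed M.
Proof. by []. Qed.

Lemma const_unitmx n (A : 'M[C]_n) : (const_ratmx A \in unitmx) = (A \in unitmx).
Proof. exact: (map_unitmx embed). Qed.

Lemma centered_systemE n m p (A E : 'M[C]_n) (B : 'M[C]_(n, m)) (D : 'M[C]_(p, n))
    (H : 'M[C]_(p, m)) :
  alpha *: E - beta *: A \in unitmx ->
  centered_system alpha A E B D H = rtransfer (cayley_sys alpha beta A E B D H).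
Proof.
move=> uW; have ab : embed alpha * embed beta = 1 by rewrite -rmorphM alpha_beta rmorph1.
have eW : const_ratmx (alpha *: E - beta *: A)
    = embed alpha *: const_ratmx E - embed beta *: const_ratmx A.
  by rewrite !const_ratmxE map_mxB !map_mxZ.
have two : (2 : F) != 0.
  by rewrite -(rmorph_nat embed) fmorph_eq0 pnatr_eq0.
have eG := map_cayley_sys embed alpha beta A E B D H.
have uW' : embed alpha *: const_ratmx E - embed beta *: const_ratmx A \in unitmx.
  by rewrite -eW const_unitmx.
have uA : nonpole svar
    (cayley_A (embed alpha) (embed beta) (const_ratmx A) (const_ratmx E)).
  have := congr1 (fun G => nonpole svar (sysA G)) eG => /= <-.
  exact: nonpole_svar.
rewrite /rtransfer eG.
have := cayley_transfer ab two (const_ratmx B) (const_ratmx D) (const_ratmx H) uW'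
  embed_center_neq0 uA.
move=> <-; rewrite /centered_system /poly_ratfunc; congr (_ + _ *: _).
by rewrite tofracB -mul_polyC tofracM.
Qed.

(** The coefficients of a pencil whose Cayley transform is the given matrix. *)
Definition pencil_A n (A : 'M[C]_n) := alpha *: (A + (2^-1)%:M).
Definition pencil_E n (A : 'M[C]_n) := beta *: (A - (2^-1)%:M).

Lemma two_neq0 : (2 : C) != 0.
Proof. by rewrite pnatr_eq0. Qed.

Lemma pencil_W n (A : 'M[C]_n) :
  alpha *: pencil_E A - beta *: pencil_A A \in unitmx.
Proof.
have [-> _] := cayley_sysK alpha_beta two_neq0 (Sys A (0 : 'M[C]_(n, 0)) (0 : 'M[C]_(0, n)) 0).
by rewrite -scaleN1r unitmxZ ?unitmx1 // unitrN unitr1.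
Qed.

Lemma pencilK n m p (G : sys C n m p) :
  cayley_sys alpha beta (pencil_A (sysA G)) (pencil_E (sysA G)) (sysB G) (sysC G) (sysD G)
  = G.
Proof. by have [_] := cayley_sysK alpha_beta two_neq0 G. Qed.

Lemma rtransfer_centered n m p (G : sys C n m p) : rtransfer G =
  centered_system alpha (pencil_A (sysA G)) (pencil_E (sysA G)) (sysB G) (sysC G) (sysD G).
Proof. by rewrite centered_systemE; [rewrite pencilK|exact: pencil_W]. Qed.

(** The pencil allows evaluation at the center too, where [transfer] would have
    to be taken at infinity. *)
Definition pencil_value n m p (G : sys C n m p) z : 'M[C]_(p, m) :=
  sysD G + (alpha - beta * z)
    *: (sysC G *m invmx (z *: pencil_E (sysA G) - pencil_A (sysA G)) *m sysB G).

Lemma has_value_X z : has_value (poly_ratfunc 'X) (Some z) z.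
Proof.
exists 1%N, 'X, 1; split; rewrite ?size_polyX ?size_poly1 //=.
- by rewrite hornerC oner_eq0.
- by rewrite /poly_ratfunc tofrac1 divr1.
- by rewrite hornerC hornerX divr1.
Qed.

Lemma centered_value n m p (A E : 'M[C]_n) (B : 'M[C]_(n, m)) (D : 'M[C]_(p, n))
    (H : 'M[C]_(p, m)) z : z *: E - A \in unitmx ->
  has_valuemx (centered_system alpha A E B D H) (Some z)
    (H + (alpha - beta * z) *: (D *m invmx (z *: E - A) *m B)).
Proof.
move=> uM; have tI := @tofracI R; have b0 := beta_neq0.
apply: (has_valuemxD tI); first exact: has_valuemx_const.
apply: has_valuemxZ.
  exists 1%N, (alpha%:P - beta *: 'X), 1; split; rewrite ?size_poly1 //=.
  - rewrite (leq_trans (size_polyD _ _)) // geq_max size_polyC.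
    by rewrite size_polyN size_scale // size_polyX leqnn andbT (leq_trans (leq_b1 _)).
  - by rewrite hornerC oner_eq0.
  - by rewrite /poly_ratfunc tofrac1 divr1.
  - by rewrite !(hornerD, hornerN, hornerZ, hornerC, hornerX) divr1.
apply: (has_valuemxM tI) (has_valuemx_const _ _ _).
apply: (has_valuemxM tI); first exact: has_valuemx_const.
have hM : has_valuemx (poly_ratfunc 'X *: const_ratmx E - const_ratmx A)
   (Some z) (z *: E - A).
  apply: (has_valuemxD tI); last by apply: has_valuemxN; exact: has_valuemx_const.
  by apply: has_valuemxZ (has_value_X z) _; exact: has_valuemx_const.
by have [] := has_valuemx_inv tI hM uM.
Qed.

Lemma rtransfer_value_pencil n m p (G : sys C n m p) z :
  z *: pencil_E (sysA G) - pencil_A (sysA G) \in unitmx ->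
  has_valuemx (rtransfer G) (Some z) (pencil_value G z).
Proof. by move=> uM; rewrite rtransfer_centered; exact: centered_value. Qed.

Lemma pencil_unit_center n (A : 'M[C]_n) :
  (alpha / beta) *: pencil_E A - pencil_A A \in unitmx.
Proof.
have := cayley_center alpha_beta (pencil_A A) (pencil_E A).
move/(congr1 (fun M => - M)); rewrite opprB => ->; have b0 := beta_neq0.
by rewrite -scaleNr opprK unitmxZ ?pencil_W // unitfE invr_eq0.
Qed.

Lemma cayley_A_pencil n (A : 'M[C]_n) :
  cayley_A alpha beta (pencil_A A) (pencil_E A) = A.
Proof.
have := pencilK (Sys A (0 : 'M[C]_(n, 0)) (0 : 'M[C]_(0, n)) 0).
by move/(congr1 (fun G => sysA G)).
Qed.

Lemma pencil_unit n (A : 'M[C]_n) z : z != alpha / beta ->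
  (z *: pencil_E A - pencil_A A \in unitmx) = nonpole (cayley alpha beta z) A.
Proof.
move=> /center_neq z0.
have := cayley_pencil_unit alpha_beta two_neq0 (pencil_W A) z0.
by rewrite cayley_A_pencil.
Qed.

Lemma pencil_value_center n m p (G : sys C n m p) :
  pencil_value G (alpha / beta) = sysD G.
Proof.
have b0 := beta_neq0; rewrite /pencil_value [beta * _]mulrC divfK // subrr.
by rewrite scale0r addr0.
Qed.

Lemma pencil_value_transfer n m p (G : sys C n m p) z : z != alpha / beta ->
  nonpole (cayley alpha beta z) (sysA G) ->
  pencil_value G z = transfer (cayley alpha beta z) G.
Proof.
move=> /center_neq z0 uA; have := cayley_A_pencil (sysA G) => e.
have := cayley_transfer alpha_beta two_neq0 (sysB G) (sysC G) (sysD G)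
  (pencil_W (sysA G)) z0.
by rewrite e pencilK => /(_ uA).
Qed.

(** The Cayley transform exchanges the generalized eigenvalues of the pencil with
    the eigenvalues of the matrix, infinity corresponding to [s = 1 / 2]; the
    center, excluded by stability, makes [alpha E - beta A] invertible. *)
Lemma stable_pencil_cayley n (A E : 'M[C]_n) :
  stable_pencil A E <->
  alpha *: E - beta *: A \in unitmx /\ Hurwitz (cayley_A alpha beta A E).
Proof.
have b0 := beta_neq0; have a0 := alpha_neq0.
have detz w : alpha *: E - beta *: A \in unitmx -> w != alpha / beta ->
    (\det (A - w *: E) == 0) = ~~ nonpole (cayley alpha beta w) (cayley_A alpha beta A E).
  move=> uW w0; rewrite -(cayley_pencil_unit alpha_beta two_neq0 uW (center_neq w0)).
  have -> : (w *: E - A \in unitmx) = (A - w *: E \in unitmx).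
    by rewrite -opprB -scaleN1r unitmxZ // unitrN unitr1.
  by rewrite unitmxE unitfE negbK.
have det_inf : alpha *: E - beta *: A \in unitmx ->
    (\det E == 0) = ~~ nonpole 2^-1 (cayley_A alpha beta A E).
  move=> uW.
  have e : alpha *: E = (alpha *: E - beta *: A) *m ((2^-1)%:M - cayley_A alpha beta A E).
    rewrite mulmxDr mul_mx_scalar /cayley_A opprK mulKVmx //.
    rewrite -scalerDr.
    have -> : alpha *: E - beta *: A + (alpha *: E + beta *: A) = 2 *: (alpha *: E).
      by rewrite addrACA addNr addr0 -mulr2n scaler_nat.
    by rewrite [RHS]scalerA mulVf ?two_neq0 // scale1r.
  have := congr1 (fun M : 'M[C]_n => M \in unitmx) e.
  rewrite unitmxZ ?unitfE // unitmx_mul uW /= /nonpole => <-.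
  by rewrite unitmxE unitfE negbK.
split=> [[_ st]|[uW hA]].
  have uW : alpha *: E - beta *: A \in unitmx.
    rewrite -[_ - _]scale1r -(divff (_ : - beta^-1 != 0)) ?oppr_eq0 ?invr_eq0 //.
    rewrite mulrC -scalerA -cayley_center ?alpha_beta // unitmxZ; last first.
      by rewrite unitrV unitrN unitrV unitfE.
    rewrite unitmxE unitfE; apply/negP=> /eqP d0.
    have := st (Some (alpha / beta)) d0 => /=.
    by rewrite cabsE cabs_center -[X in _ < X]/(1%:C%C) ltxx.
  split; first exact: uW.
  move=> s Res; have [s1|s1] := eqVneq (2 * s) 1.
    have -> : s = 2^-1 by rewrite -[s](mulKf two_neq0) s1 mulr1.
    apply: contraT; rewrite -det_inf // => /eqP d0; by have := st None d0.
  have [z0 zs] := cayley_invK s1; rewrite -zs; apply: contraT.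
  rewrite -detz // => /eqP d0; have := st (Some _) d0 => /=.
  have [] := cabs_cayley_inv s1; rewrite Res cabsE => h _.
  by rewrite -[X in _ < X]/(1%:C%C) ltcR ltNge h.
split.
  apply/eqP=> d0; have := congr1 (fun p : {poly C} => p.[alpha / beta]) d0.
  rewrite horner0 -horner_evalE -det_map_mx => /eqP; apply/negP.
  have -> : map_mx (horner_eval (alpha / beta)) (map_mx polyC A - 'X *: map_mx polyC E)
      = A - (alpha / beta) *: E.
    by apply/matrixP=> i j; rewrite !mxE /= horner_evalE !hornerE.
  by rewrite cayley_center ?alpha_beta // -unitfE -unitmxE unitmxZ // unitrN unitrV unitfE.
move=> [w|] /= => [/eqP d0|/eqP]; last first.
  by rewrite det_inf // hA //= invr_ge0.
rewrite cabsE -[X in _ < X]/(1%:C%C) ltcR ltNge; apply/negP=> w1.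
have w0 : w != alpha / beta.
  apply: contraTneq d0 => ->; rewrite cayley_center ?alpha_beta //.
  by rewrite -unitfE -unitmxE unitmxZ // unitrN unitrV unitfE.
have [s1 ws] := cayleyK w0; have [] := cabs_cayley_inv s1; rewrite ws w1 => h _.
by move: d0; rewrite detz // hA // -h.
Qed.

End StateSpace.

(** * Singular values and square roots *)

Section Spectral.
Variable R : realType.
Local Notation C := R[i].

Lemma hermP n (X : 'M[C]_n) : (X \is hermsymmx) <-> X^t* = X.
Proof.
split=> [/is_hermitianmxP|e]; first by rewrite expr0 scale1r.
by apply/is_hermitianmxP; rewrite expr0 scale1r e.
Qed.

Definition diagonalizes n (H U : 'M[C]_n) (r : 'I_n -> R) : Prop :=
  [/\ U^t* *m U = 1%:M, U *m U^t* = 1%:M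
    & H = U^t* *m diag_mx (\row_j (r j)%:C%C) *m U].

Lemma hermitian_diagonalizes n (H : 'M[C]_n) : H^t* = H ->
  exists U r, diagonalizes H U r.
Proof.
move/hermP => hH; set U := spectralmx H.
have uU : U \is unitarymx := spectral_unitarymx H.
have UU : U *m U^t* = 1%:M by apply/unitarymxP.
have U'U : U^t* *m U = 1%:M by exact: mulmx1C.
exists U, (fun j => complex.Re (spectral_diag H 0 j)); split=> //.
have /orthomx_spectralP e := hermitian_normalmx hH.
apply: etrans e _; rewrite (invmx_unitary uU); congr (_ *m diag_mx _ *m _).
apply/rowP=> j; rewrite mxE RRe_real //.
by have /mxOverP := hermitian_spectral_diag_real hH; apply.
Qed.

Section Diagonal.
Variables (n : nat) (H U : 'M[C]_n) (r : 'I_n -> R).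
Hypothesis hU : diagonalizes H U r.

Lemma diag_sqn (u : 'cV[C]_n) : sqn (U *m u) = sqn u.
Proof. by case: hU => h _ _; rewrite /sqn adjmxM mulmxA -[_ *m _ *m U]mulmxA h mulmx1. Qed.

Lemma diag_form (u : 'cV[C]_n) :
  (u^t* *m H *m u) 0 0 = (\sum_j r j * cabs ((U *m u) j 0) ^+ 2)%:C%C.
Proof.
case: hU => _ _ ->; rewrite !mulmxA -adjmxM -mulmxA; set y := U *m u.
rewrite mxE rmorph_sum /=; apply: eq_bigr => j _.
rewrite mul_mx_diag !mxE rmorphM rmorphXn /= -cabsE normCKC; ring.
Qed.

Lemma diag_eigenvector j : exists v : 'cV[C]_n,
  [/\ sqn v = 1, (v^t* *m H *m v) 0 0 = (r j)%:C%C & H *m v = (r j)%:C%C *: v].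
Proof.
have [h1 h2 e] := hU; exists (U^t* *m delta_mx j 0).
have Uv : U *m (U^t* *m delta_mx j 0) = delta_mx j 0 :> 'cV_n.
  by rewrite mulmxA h2 mul1mx.
split.
- rewrite -diag_sqn Uv sqn_sum (bigD1 j) //= big1 ?addr0; last first.
    by move=> i ij; rewrite mxE (negbTE ij) cabs0 expr0n.
  by rewrite mxE !eqxx cabs1 expr1n.
- rewrite diag_form Uv (bigD1 j) //= big1 ?addr0; last first.
    by move=> i ij; rewrite mxE (negbTE ij) cabs0 expr0n mulr0.
  by rewrite mxE !eqxx cabs1 expr1n mulr1.
- rewrite {1}e -!mulmxA Uv mul_diag_mx.
  rewrite scalemxAr; congr (_ *m _); apply/matrixP=> a b; rewrite !mxE.
  by case: eqP => [->|_]; rewrite ?mulr0.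
Qed.

Lemma diag_det_sub1 : \det (1%:M - H) = (\prod_j (1 - r j))%:C%C.
Proof.
have [h1 h2 ->] := hU.
have -> : 1%:M - U^t* *m diag_mx (\row_j (r j)%:C%C) *m U
    = U^t* *m diag_mx (\row_j (1 - r j)%:C%C) *m U.
  have -> : diag_mx (\row_j (1 - r j)%:C%C) = 1%:M - diag_mx (\row_j (r j)%:C%C).
    by apply/matrixP=> i j; rewrite !mxE rmorphB rmorph1 mulrnBl.
  by rewrite mulmxBr mulmxBl mulmx1 h1.
rewrite !det_mulmx mulrAC -det_mulmx h1 det1 mul1r det_diag rmorph_prod.
by apply: eq_bigr => j _; rewrite mxE.
Qed.

End Diagonal.

Lemma sqrtmx_spec n (M : 'M[C]_n) : posdef M ->
  [/\ (sqrtmx M)^t* = sqrtmx M, sqrtmx M \in unitmx & sqrtmx M *m sqrtmx M = M].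
Proof.
move=> [/hermP hM pM]; have [U [r dU]] := hermitian_diagonalizes hM.
have [h1 h2 e] := dU.
have r0 j : 0 < r j.
  have [v [v1 vr _]] := diag_eigenvector dU j.
  have v0 : v != 0 by apply: contra_eq_neq v1 => ->; rewrite sqn0 eq_sym oner_eq0.
  by have := pM v v0; rewrite vr -[0 : C]/(0%:C%C) ltcR.
pose S := U^t* *m diag_mx (\row_j (Num.sqrt (r j))%:C%C) *m U.
have dS : diagonalizes S U (fun j => Num.sqrt (r j)) by split.
have hS : S^t* = S.
  rewrite /S !adjmxM adjmxK mulmxA; congr (_ *m _ *m _).
  apply/matrixP=> i j; rewrite !mxE [j == i]eq_sym; case: eqP => [->|_].
    by rewrite !mulr1n conjcE /= oppr0.
  by rewrite !mulr0n conjC0.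
have : exists S, posdef S /\ S *m S = M.
  exists S; split; last first.
    apply: etrans (esym e); rewrite /S !mulmxA; congr (_ *m _).
    rewrite -[U^t* *m _ *m U *m U^t*]mulmxA h2 mulmx1 -mulmxA mulmx_diag.
    congr (_ *m diag_mx _); apply/rowP=> j; rewrite !mxE -rmorphM -expr2.
    by rewrite sqr_sqrtr // ltW.
  split; first exact/hermP.
  move=> v v0; rewrite (diag_form dS) -[0 : C]/(0%:C%C) ltcR.
  have s0 := sqn_gt0 v0; rewrite -(diag_sqn dS) sqn_sum in s0.
  rewrite lt_neqAle sumr_ge0 ?andbT; last first.
    by move=> j _; rewrite mulr_ge0 ?sqrtr_ge0 ?sqr_ge0.
  apply: contraTneq s0 => /esym /eqP; rewrite psumr_eq0; last first.
    by move=> j _; rewrite mulr_ge0 ?sqrtr_ge0 ?sqr_ge0.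
  move=> /allP h; rewrite big1 ?ltxx // => j _.
  have := h j (mem_index_enum j); rewrite /= mulf_eq0 sqrtr_eq0 leNgt r0 /=.
  by move/eqP.
move=> ex; have := @xgetPex _ 0 _ ex; rewrite -/(sqrtmx M) => -[[/hermP hs ps] ss].
split=> //; rewrite -row_free_unit -kermx_eq0; apply/eqP/row_matrixP=> i; rewrite row0.
have : row i (kermx (sqrtmx M)) *m sqrtmx M = 0 by apply/sub_kermxP; exact: row_sub.
move: (row _ _) => v ev; apply/eqP; apply: contraT => v0.
have vt0 : v^t* != 0 by apply: contra_neq v0 => h; rewrite -[v]adjmxK h adjmx0.
by have := ps _ vt0; rewrite adjmxK ev mul0mx mxE ltxx.
Qed.

Lemma gram_adj p m (M : 'M[C]_(p, m)) : (M^t* *m M)^t* = M^t* *m M.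
Proof. by rewrite adjmxM adjmxK. Qed.

Lemma sqn_gram p m (M : 'M[C]_(p, m)) u :
  (u^t* *m (M^t* *m M) *m u) 0 0 = (sqn (M *m u))%:C%C.
Proof.
by rewrite mulmxA -adjmxM -mulmxA sqnE mxE eqxx mulr1n.
Qed.

(** The smallest eigenvalue of 1 - M^* M is at least the product of all of
    them, which is a polynomial in the entries: a quantitative contractivity
    that depends continuously on the matrix. *)
Lemma contractive_gap p m (M : 'M[C]_(p, m)) : contractive M ->
  let d := complex.Re (\det (1%:M - M^t* *m M)) in
  [/\ 0 < d, d <= 1 & forall u, sqn (M *m u) <= (1 - d) * sqn u].
Proof.
move=> cM; have [U [r dU]] := hermitian_diagonalizes (gram_adj M).
have r01 j : 0 < 1 - r j <= 1.
  have [v [v1 vr _]] := diag_eigenvector dU j; move: vr; rewrite sqn_gram => -[vr].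
  have v0 : v != 0 by apply: contra_eq_neq v1 => ->; rewrite sqn0 eq_sym oner_eq0.
  by have := cM v v0; have := sqn_ge0 (M *m v); rewrite v1 vr; lra.
rewrite (diag_det_sub1 dU) /=.
have bnd (P : pred 'I_m) : 0 < \prod_(j | P j) (1 - r j) <= 1.
  elim/big_rec: _ => [|j x _ /andP[x0 x1]]; first by rewrite ltr01 lexx.
  by have /andP[? ?] := r01 j; rewrite mulr_gt0 //= mulr_ile1 // ltW.
have /andP[d0 d1] := bnd predT; split=> // u.
have := sqn_gram M u; rewrite (diag_form dU) => -[<-].
rewrite -(diag_sqn dU) sqn_sum mulr_sumr; apply: ler_sum => j _.
apply: ler_wpM2r; first exact: sqr_ge0.
rewrite lerBrDl -lerBrDr (bigD1 j) //=; have /andP[q0 q1] := bnd (fun i => i != j).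
by have /andP[? ?] := r01 j; rewrite ler_piMr // ltW.
Qed.

Definition singular_values p m (M : 'M[C]_(p, m)) : set R :=
  [set s : R | 0 <= s /\ eigenvalue (M^t* *m M) ((s ^+ 2)%:C)%C]%classic.

(** Eigenvectors here are row vectors, so an adjoint turns them into vectors to
    which the bound applies. *)
Lemma singular_value_le p m (M : 'M[C]_(p, m)) k s : 0 <= k ->
  (forall u, sqn (M *m u) <= k * sqn u) -> singular_values M s -> s ^+ 2 <= k.
Proof.
move=> k0 hM [s0 /eigenvalueP [v ev v0]].
have vt0 : v^t* != 0 by apply: contra_neq v0 => h; rewrite -[v]adjmxK h adjmx0.
have := sqn_gram M (v^t*); rewrite adjmxK ev -scalemxAl mxE.
have -> : (v *m v^t*) 0 0 = (sqn (v^t*))%:C%C.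
  by have := sqnE (v^t*); rewrite adjmxK => ->; rewrite mxE eqxx mulr1n.
rewrite -rmorphM => -[] e; have := hM (v^t*); rewrite -e ler_pM2r //.
exact: sqn_gt0.
Qed.

Lemma sigma_max_le p m (M : 'M[C]_(p, m)) (k : R) : 0 <= k ->
  (forall u, sqn (M *m u) <= k * sqn u) -> sigma_max M <= Num.sqrt k.
Proof.
move=> k0 hM; rewrite /sigma_max -/(singular_values M).
have [->|/set0P ne] := eqVneq (singular_values M) set0; first by rewrite sup0 sqrtr_ge0.
apply: ge_sup ne _ => s sM; have := singular_value_le k0 hM sM; case: sM => s0 _.
by move/ler_wsqrtr; rewrite sqrtr_sqr ger0_norm.
Qed.

Lemma sigma_max_lt1 p m (M : 'M[C]_(p, m)) : sigma_max M < 1 -> contractive M.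
Proof.
move=> hM; have [U [r dU]] := hermitian_diagonalizes (gram_adj M).
have r1 j : r j < 1.
  have [v [v1 vr Hv]] := diag_eigenvector dU j.
  have rj : 0 <= r j.
    by move: vr; rewrite sqn_gram => -[<-]; exact: sqn_ge0.
  have sj : singular_values M (Num.sqrt (r j)).
    split; first exact: sqrtr_ge0.
    rewrite sqr_sqrtr //; apply/eigenvalueP; exists (v^t*).
      have := congr1 (fun X => X^t*) Hv; rewrite adjmxM gram_adj => ->.
      by rewrite adjmxZ conjcE /= oppr0.
    apply: contra_eq_neq v1 => h; rewrite -[v]adjmxK h adjmx0 sqn0.
    by rewrite eq_sym oner_eq0.
  have ub : has_ubound (singular_values M).
    exists (1 + entry_sum (M^t* *m M)) => s [s0 /eigenvalueP [x ex x0]].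
    have /spectrum_bounded : ~~ nonpole ((s ^+ 2)%:C)%C (M^t* *m M).
      apply/negP=> u; case/negP: x0; apply/eqP; rewrite -[x](mulmxK u).
      by rewrite mulmxBr mul_mx_scalar ex subrr mul0mx.
    rewrite cabs_real ger0_norm ?sqr_ge0 //; have := entry_sum_ge0 (M^t* *m M).
    by move: (entry_sum _) => e; nra.
  have := ub_le_sup ub sj => /le_lt_trans /(_ hM) s1.
  by rewrite -(sqr_sqrtr rj) expr_lt1 ?sqrtr_ge0.
move=> u u0; have := sqn_gram M u; rewrite (diag_form dU) => -[<-].
rewrite -[X in _ < X](diag_sqn dU).
have s0 := sqn_gt0 u0; rewrite -(diag_sqn dU) in s0; move: s0; rewrite sqn_sum => s0.
rewrite -subr_gt0 -sumrB lt_neqAle sumr_ge0 ?andbT; last first.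
  by move=> j _; rewrite -{1}[cabs _ ^+ 2]mul1r -mulrBl mulr_ge0 ?sqr_ge0 // subr_ge0 ltW.
apply: contraTneq s0 => /esym /eqP; rewrite psumr_eq0; last first.
  by move=> j _; rewrite -{1}[cabs _ ^+ 2]mul1r -mulrBl mulr_ge0 ?sqr_ge0 // subr_ge0 ltW.
move=> /allP h; rewrite big1 ?ltxx // => j _.
have := h j (mem_index_enum j); rewrite /= -{1}[cabs _ ^+ 2]mul1r -mulrBl mulf_eq0.
by rewrite subr_eq0 gt_eqF //= => /eqP.
Qed.

End Spectral.

(** * The H-infinity norm *)

Section ComplexContinuity.
Variable R : realType.
Local Notation C := R[i].
Implicit Types f g : R -> C.

(** Continuity of both parts, as the complex numbers over an abstract real field
    are only used as pairs of reals here. *)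
Definition ccontinuous f : Prop :=
  continuous (fun t : R => complex.Re (f t)) /\
  continuous (fun t : R => complex.Im (f t)).

Lemma ccontinuous_cst c : ccontinuous (fun=> c).
Proof. by split=> t; exact: cvg_cst. Qed.

Lemma ccontinuous_ext f g : f =1 g -> ccontinuous f -> ccontinuous g.
Proof. by move=> /funext ->. Qed.

Lemma ccontinuousD f g :
  ccontinuous f -> ccontinuous g -> ccontinuous (fun t => f t + g t).
Proof.
move=> [fr fi] [gr gi]; split=> t.
  rewrite [X in continuous_at _ X](_ : _ = fun t => complex.Re (f t) + complex.Re (g t)).
    by apply: cvgD; [exact: fr|exact: gr].
  by apply: funext => u; rewrite cReD.
rewrite [X in continuous_at _ X](_ : _ = fun t => complex.Im (f t) + complex.Im (g t)).
  by apply: cvgD; [exact: fi|exact: gi].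
by apply: funext => u; case: (f u) (g u) => [? ?] [? ?].
Qed.

Lemma ccontinuousM f g :
  ccontinuous f -> ccontinuous g -> ccontinuous (fun t => f t * g t).
Proof.
move=> [fr fi] [gr gi]; split=> t.
  rewrite [X in continuous_at _ X](_ : _ = fun t =>
    complex.Re (f t) * complex.Re (g t) - complex.Im (f t) * complex.Im (g t)).
    by apply: cvgB; apply: cvgM; [exact: fr|exact: gr|exact: fi|exact: gi].
  by apply: funext => u; rewrite cReM.
rewrite [X in continuous_at _ X](_ : _ = fun t =>
  complex.Re (f t) * complex.Im (g t) + complex.Im (f t) * complex.Re (g t)).
  by apply: cvgD; apply: cvgM; [exact: fr|exact: gi|exact: fi|exact: gr].
by apply: funext => u; case: (f u) (g u) => [? ?] [? ?].
Qed.

Lemma ccontinuous_conj f : ccontinuous f -> ccontinuous (fun t => (f t)^*).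
Proof.
move=> [fr fi]; split=> t.
  rewrite [X in continuous_at _ X](_ : _ = fun t => complex.Re (f t)); first exact: fr.
  by apply: funext => u; rewrite conjcE.
rewrite [X in continuous_at _ X](_ : _ = fun t => - complex.Im (f t)).
  by apply: cvgN; exact: fi.
by apply: funext => u; rewrite conjcE.
Qed.

Lemma ccontinuousV f : (forall t, f t != 0) -> ccontinuous f ->
  ccontinuous (fun t => (f t)^-1).
Proof.
move=> f0 cf; have := ccontinuousM cf (ccontinuous_conj cf) => -[hr _].
have nz t : complex.Re (f t * (f t)^*) != 0.
  rewrite mulrC -normCKC cabsE -rmorphXn /= expf_neq0 //.
  by rewrite gt_eqF // cabs_gt0.
have hV : ccontinuous (fun t => ((complex.Re (f t * (f t)^*))^-1)%:C%C).
  split=> t; last exact: cvg_cst.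
  by apply: cvgV; [exact: nz|exact: hr].
apply: ccontinuous_ext (ccontinuousM (ccontinuous_conj cf) hV) => t.
have e : (complex.Re (f t * (f t)^*))%:C%C = f t * (f t)^*.
  by rewrite RRe_real // mulrC -normCKC rpredX // normr_real.
have c0 : (f t)^* != 0 by rewrite conjC_eq0.
have eV : ((complex.Re (f t * (f t)^*))^-1)%:C%C = (f t * (f t)^*)^-1.
  by rewrite -[in RHS]e fmorphV.
by rewrite eV invfM mulrCA mulfV // mulr1.
Qed.

Lemma ccontinuous_sum I (r : seq I) (P : pred I) (f : I -> R -> C) :
  (forall i, ccontinuous (f i)) -> ccontinuous (fun t => \sum_(i <- r | P i) f i t).
Proof.
move=> cf; elim: r => [|i r IH].
  by apply: ccontinuous_ext (ccontinuous_cst 0) => t; rewrite big_nil.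
have [Pi|Pi] := boolP (P i).
  by apply: ccontinuous_ext (ccontinuousD (cf i) IH) => t; rewrite big_cons Pi.
by apply: ccontinuous_ext IH => t; rewrite big_cons (negbTE Pi).
Qed.

Lemma ccontinuous_prod I (r : seq I) (P : pred I) (f : I -> R -> C) :
  (forall i, ccontinuous (f i)) -> ccontinuous (fun t => \prod_(i <- r | P i) f i t).
Proof.
move=> cf; elim: r => [|i r IH].
  by apply: ccontinuous_ext (ccontinuous_cst 1) => t; rewrite big_nil.
have [Pi|Pi] := boolP (P i).
  by apply: ccontinuous_ext (ccontinuousM (cf i) IH) => t; rewrite big_cons Pi.
by apply: ccontinuous_ext IH => t; rewrite big_cons (negbTE Pi).
Qed.

Definition mx_ccontinuous m n (M : R -> 'M[C]_(m, n)) : Prop :=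
  forall i j, ccontinuous (fun t => M t i j).

Lemma mx_ccontinuous_cst m n (M : 'M[C]_(m, n)) : mx_ccontinuous (fun=> M).
Proof. by move=> i j; exact: ccontinuous_cst. Qed.

Lemma mx_ccontinuousD m n (M N : R -> 'M[C]_(m, n)) :
  mx_ccontinuous M -> mx_ccontinuous N -> mx_ccontinuous (fun t => M t + N t).
Proof.
move=> hM hN i j; apply: ccontinuous_ext (ccontinuousD (hM i j) (hN i j)) => t.
by rewrite mxE.
Qed.

Lemma mx_ccontinuousM m n p (M : R -> 'M[C]_(m, n)) (N : R -> 'M[C]_(n, p)) :
  mx_ccontinuous M -> mx_ccontinuous N -> mx_ccontinuous (fun t => M t *m N t).
Proof.
move=> hM hN i j; have h k := ccontinuousM (hM i k) (hN k j).
by apply: ccontinuous_ext (ccontinuous_sum _ _ h) => t; rewrite mxE.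
Qed.

Lemma mx_ccontinuousZ m n f (M : R -> 'M[C]_(m, n)) :
  ccontinuous f -> mx_ccontinuous M -> mx_ccontinuous (fun t => f t *: M t).
Proof.
move=> hf hM i j; apply: ccontinuous_ext (ccontinuousM hf (hM i j)) => t.
by rewrite mxE.
Qed.

Lemma mx_ccontinuous_adj m n (M : R -> 'M[C]_(m, n)) :
  mx_ccontinuous M -> mx_ccontinuous (fun t => (M t)^t*).
Proof.
move=> hM i j; apply: ccontinuous_ext (ccontinuous_conj (hM j i)) => t.
by rewrite !mxE.
Qed.

Lemma ccontinuous_det n (M : R -> 'M[C]_n) :
  mx_ccontinuous M -> ccontinuous (fun t => \det (M t)).
Proof.
move=> hM; apply: ccontinuous_sum => s.
by apply: ccontinuousM; [exact: ccontinuous_cst|apply: ccontinuous_prod].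
Qed.

Lemma mx_ccontinuous_inv n (M : R -> 'M[C]_n) : (forall t, M t \in unitmx) ->
  mx_ccontinuous M -> mx_ccontinuous (fun t => invmx (M t)).
Proof.
move=> uM hM i j.
have hd : ccontinuous (fun t => (\det (M t))^-1).
  by apply: ccontinuousV; [move=> t; rewrite -unitfE -unitmxE|exact: ccontinuous_det].
have hc : ccontinuous (fun t => cofactor (M t) j i).
  apply: ccontinuousM; first exact: ccontinuous_cst.
  apply: ccontinuous_det => k l; apply: ccontinuous_ext (hM (lift j k) (lift i l)) => t.
  by rewrite !mxE.
apply: ccontinuous_ext (ccontinuousM hd hc) => t.
by rewrite /invmx uM !mxE.
Qed.

Lemma ccontinuous_expi : ccontinuous (@expi R).
Proof. by split=> t; [exact: continuous_cos|exact: continuous_sin]. Qed.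

Lemma cabs_expi (t : R) : cabs (expi t) = 1.
Proof.
apply/eqP; rewrite -(eqrXn2 (_ : 0 < 2)%N) ?cabs_ge0 // cabs_sqr /= expr1n.
by rewrite cos2Dsin2.
Qed.

Lemma circle_expi z : cabs z = 1 -> exists2 t : R, 0 <= t < 2 * pi & z = expi t.
Proof.
move=> z1; have e := cabs_sqr z; rewrite z1 expr1n in e.
case: z {z1} e => x y /= e.
have x1 : -1 <= x <= 1 by apply/andP; split; nra.
have y2 : y ^+ 2 = 1 - x ^+ 2 by rewrite e; ring.
have p0 := pi_gt0 R; have a0 := acos_ge0 x1; have api := acos_lepi x1.
have [y0|y0] := leP 0 y.
  exists (acos x); first by apply/andP; split=> //; lra.
  by rewrite /expi acosK ?in_itv // sin_acos // -y2 sqrtr_sqr ger0_norm.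
have ap : 0 < acos x.
  rewrite lt_neqAle a0 andbT; apply: contraTneq y0 => h.
  have x1' : x = 1 by rewrite -(acosK (_ : x \in `[-1, 1])) ?in_itv // -h cos0.
  have y2' : y ^+ 2 = 0 by rewrite y2 x1'; ring.
  by move/eqP: y2'; rewrite sqrf_eq0 => /eqP ->; rewrite ltxx.
exists (2 * pi - acos x); first by apply/andP; split; lra.
have e2 : 2 * pi - acos x = - acos x + pi *+ 2 by rewrite mulr_natl addrC.
rewrite /expi e2 mulr2n addrA !cosDpi !sinDpi !opprK.
rewrite cosN sinN acosK ?in_itv // sin_acos // -y2 sqrtr_sqr ltr0_norm // opprK.
by [].
Qed.

End ComplexContinuity.

Section HinfNorm.
Variables (R : realType) (alpha : R[i]).
Hypothesis halpha : `|alpha| = 1.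
Local Notation C := R[i].
Local Notation beta := (alpha^*).
Local Notation has_valuemx := (has_valuemx (@FracField.tofrac {poly R[i]})).

Lemma circle_pencil_unit n (A : 'M[C]_n) z : Hurwitz A -> cabs z = 1 ->
  z *: pencil_E alpha A - pencil_A alpha A \in unitmx.
Proof.
move=> hA z1; have [->|z0] := eqVneq z (alpha / beta).
  exact: pencil_unit_center.
have [s1 zs] := cayleyK halpha z0; have [h _] := cabs_cayley_inv halpha s1.
by rewrite (pencil_unit halpha) //; apply: hA; rewrite -h zs z1.
Qed.

Lemma circle_contractive n m p (G : sys C n m p) : Hurwitz (sysA G) ->
  (forall z, cabs z = 1 -> contractive (pencil_value alpha G z)) <->
  (forall s, complex.Re s = 0 -> contractive (transfer s G)) /\ contractive (sysD G).
Proof.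
move=> hA; split=> [h|[hs hD] z z1]; last first.
  have [->|z0] := eqVneq z (alpha / beta); first by rewrite pencil_value_center.
  have [s1 zs] := cayleyK halpha z0; have [e1 e2] := cabs_cayley_inv halpha s1.
  rewrite zs z1 eqxx in e1 e2; rewrite (pencil_value_transfer halpha) //.
    by apply: hs; apply/eqP; rewrite -e2.
  by apply: hA; rewrite -e1.
split=> [s Res|]; last first.
  by rewrite -(pencil_value_center halpha); apply: h; exact: cabs_center.
have s1 : 2 * s != 1.
  apply/eqP=> /(congr1 (@complex.Re R)); case: s Res => x y /= ->; simpc => /=.
  by move=> e; lra.
have [z0 zs] := cayley_invK halpha s1; have [_ e2] := cabs_cayley_inv halpha s1.
rewrite -zs -(pencil_value_transfer halpha) ?zs //; last by apply: hA; rewrite Res.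
by apply: h; apply/eqP; rewrite e2 Res.
Qed.

(** Strict pointwise contractivity is uniform by compactness of the circle: the
    determinant of [1 - G^* G] is continuous, has a positive minimum, and measures
    the contraction rate by [contractive_gap]. *)
Lemma Hinf_norm_lt1 n m p (G : sys C n m p) : Hurwitz (sysA G) ->
  (Hinf_norm (rtransfer alpha G) < 1)%E <->
  (forall z, cabs z = 1 -> contractive (pencil_value alpha G z)).
Proof.
move=> hA.
have ev t : ratmx_eval (rtransfer alpha G) (expi t) = pencil_value alpha G (expi t).
  apply: ratmx_evalE; apply: (rtransfer_value_pencil halpha).
  by apply: circle_pencil_unit => //; exact: cabs_expi.
split=> [h z z1|h].
  have [t t2 ->] := circle_expi z1; apply: sigma_max_lt1; rewrite -lte_fin.
  rewrite -ev; apply: le_lt_trans h; apply: ereal_sup_ubound.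
  by exists t; first exact: t2.
pose gap t := complex.Re (\det (1%:M - (pencil_value alpha G (expi t))^t*
  *m pencil_value alpha G (expi t))).
have cG : mx_ccontinuous (fun t => pencil_value alpha G (expi t)).
  have cE := ccontinuous_expi R.
  apply: mx_ccontinuousD; first exact: mx_ccontinuous_cst.
  apply: mx_ccontinuousZ.
    apply: ccontinuousD; first exact: ccontinuous_cst.
    apply: (@ccontinuous_ext _ (fun t => - beta * expi t)); first by move=> t; rewrite mulNr.
    by apply: ccontinuousM => //; exact: ccontinuous_cst.
  apply: mx_ccontinuousM; last exact: mx_ccontinuous_cst.
  apply: mx_ccontinuousM; first exact: mx_ccontinuous_cst.
  apply: mx_ccontinuous_inv => [t|].
    by apply: circle_pencil_unit => //; exact: cabs_expi.
  apply: mx_ccontinuousD; last exact: mx_ccontinuous_cst.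
  by apply: mx_ccontinuousZ => //; exact: mx_ccontinuous_cst.
have [cgap _] : ccontinuous (fun t => \det (1%:M - (pencil_value alpha G (expi t))^t*
    *m pencil_value alpha G (expi t))).
  apply: ccontinuous_det.
  have cM := mx_ccontinuousM (mx_ccontinuous_adj cG) cG.
  move=> i j; apply: ccontinuous_ext
    (mx_ccontinuousD (mx_ccontinuous_cst 1%:M) (mx_ccontinuousZ (ccontinuous_cst (-1)) cM) i j).
  by move=> t; rewrite scaleN1r.
have pi0 : 0 <= 2 * pi :> R by rewrite mulr_ge0 // pi_ge0.
have [t0 _ tmin] := EVT_min pi0 (continuous_subspaceT cgap).
have [d0 d1 _] := contractive_gap (h _ (cabs_expi t0)).
set d := complex.Re _ in d0 d1.
apply: (@le_lt_trans _ _ (Num.sqrt (1 - d))%:E); last first.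
  rewrite lte_fin -[X in _ < X]sqrtr1 ltr_sqrt ?ltr01 //; lra.
apply/ereal_supP => _ [t t2 <-]; rewrite lee_fin ev.
apply: sigma_max_le => [|u]; first lra.
have [_ _ /(_ u) hu] := contractive_gap (h _ (cabs_expi t)).
apply: le_trans hu _; apply: ler_wpM2r; first exact: sqn_ge0.
rewrite lerD2l lerN2; apply: tmin; rewrite in_itv /=.
by case/andP: t2 => -> /ltW.
Qed.

Lemma stable_contractionE n m p (G : sys C n m p) :
  stable_contraction G <->
  Hurwitz (sysA G) /\ (Hinf_norm (rtransfer alpha G) < 1)%E.
Proof.
split=> [[hA hs hD]|[hA]].
  by split=> //; apply/(Hinf_norm_lt1 hA)/(circle_contractive hA).
by move/(Hinf_norm_lt1 hA)/(circle_contractive hA) => [].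
Qed.

Lemma stable_RHinf n m p (G : sys C n m p) :
  Hurwitz (sysA G) -> RHinf (rtransfer alpha G).
Proof.
move=> hA z nz; apply/ratmx_analyticP.
have [->|z0] := eqVneq z (Some (alpha / beta)).
  exists (pencil_value alpha G (alpha / beta)).
  by apply: (rtransfer_value_pencil halpha); exact: pencil_unit_center.
exists (transfer (svalue alpha z) G); apply: (rtransfer_value halpha) => //.
case: z nz z0 => [w|] /= nz z0; last first.
  apply: hA; have -> : 2^-1 = (2^-1 : R)%:C%C :> C by rewrite fmorphV rmorph_nat.
  by rewrite /= invr_ge0.
have w0 : w != alpha / beta by apply: contraNneq z0 => ->.
have [s1 zs] := cayleyK halpha w0; have [e1 _] := cabs_cayley_inv halpha s1.
apply: hA; rewrite -e1 zs leNgt; apply/negP=> w1; apply: nz.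
by rewrite cabsE -[X in _ < X]/(1%:C%C) ltcR.
Qed.

End HinfNorm.

(** * Stable realizations *)

Section SystemAlgebra.
Variables (F : fieldType) (s : F).

Definition sys_add n n' m p (G : sys F n m p) (G' : sys F n' m p) : sys F (n + n') m p :=
  Sys (block_mx (sysA G) 0 0 (sysA G')) (col_mx (sysB G) (sysB G'))
      (row_mx (sysC G) (sysC G')) (sysD G + sysD G').

Definition sys_mul n n' m p q (G : sys F n p q) (G' : sys F n' m p) : sys F (n + n') m q :=
  Sys (block_mx (sysA G) (sysB G *m sysC G') 0 (sysA G'))
      (col_mx (sysB G *m sysD G') (sysB G'))
      (row_mx (sysC G) (sysD G *m sysC G')) (sysD G *m sysD G').

Definition sys_const m p (D : 'M[F]_(p, m)) : sys F 0 m p := Sys 0 0 0 D.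

Lemma transfer_const m p (D : 'M[F]_(p, m)) : transfer s (sys_const D) = D.
Proof. by rewrite /transfer /= !mul0mx addr0. Qed.

Lemma transfer_add n n' m p (G : sys F n m p) (G' : sys F n' m p) :
  nonpole s (sysA G) -> nonpole s (sysA G') -> nonpole s (sysA (sys_add G G')) ->
  transfer s (sys_add G G') = transfer s G + transfer s G'.
Proof.
move=> uG uG' uS; have [X eX] := resolvent_state (sysB G) 1%:M uG.
have [X' eX'] := resolvent_state (sysB G') 1%:M uG'.
have := transfer_signal uG eX; have := transfer_signal uG' eX'; rewrite !mulmx1 => <- <-.
have := @transfer_signal _ s _ _ _ _ (sys_add G G') (col_mx X X') 1%:M uS.
rewrite !mulmx1 => <- /=; first by rewrite mul_row_col addrACA.
rewrite /= scale_col_mx eX eX' mul_block_col !mulmx1 !mul0mx addr0 add0r.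
by rewrite add_col_mx.
Qed.

Lemma transfer_mul n n' m p q (G : sys F n p q) (G' : sys F n' m p) :
  nonpole s (sysA G) -> nonpole s (sysA G') -> nonpole s (sysA (sys_mul G G')) ->
  transfer s (sys_mul G G') = transfer s G *m transfer s G'.
Proof.
move=> uG uG' uS; have [X' eX'] := resolvent_state (sysB G') 1%:M uG'.
have [X eX] := resolvent_state (sysB G) (transfer s G') uG.
rewrite -(transfer_signal uG eX).
have e := transfer_signal uG' eX'; rewrite !mulmx1 in e.
have := @transfer_signal _ s _ _ _ _ (sys_mul G G') (col_mx X X') 1%:M uS.
rewrite !mulmx1 => <- /=; first by rewrite mul_row_col -e; mx_ring.
rewrite scale_col_mx eX eX' mul_block_col !mulmx1 !mul0mx add0r -e.
by rewrite add_col_mx mulmxDr addrA !mulmxA.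
Qed.

End SystemAlgebra.

Lemma cross_mul (K : fieldType) (a b c d : K) :
  b != 0 -> d != 0 -> a / b = c / d -> a * d = c * b.
Proof. by move=> b0 d0 /eqP; rewrite eqr_div // => /eqP. Qed.

Lemma split_div (K : fieldType) (a c q x : K) : x != 0 ->
  (a * x + c) / (q * x) = a / q + c / q * x^-1.
Proof. by move=> x0; rewrite invfM mulrDl mulrACA divff // mulr1 mulrA. Qed.

Section StableRealization.
Variables (R : realType) (alpha : R[i]).
Hypothesis halpha : `|alpha| = 1.
Local Notation C := R[i].
Local Notation F := (ratfunc R).
Local Notation beta := (alpha^*).
Local Notation pf := (@FracField.tofrac {poly R[i]}).

Definition stably_realized m p (Q : 'M[F]_(p, m)) : Prop :=
  exists n (G : sys C n m p), Hurwitz (sysA G) /\ Q = rtransfer alpha G.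

Lemma realized_const m p (D : 'M[C]_(p, m)) : stably_realized (const_ratmx D).
Proof.
exists 0%N, (sys_const D); split; first by move=> s _; rewrite /nonpole unitmxE det_mx00 unitr1.
have e : map_sys (@embed R) (sys_const D) = sys_const (const_ratmx D).
  by rewrite /map_sys /= !map_mx0.
by rewrite /rtransfer e transfer_const.
Qed.

Lemma realized_add m p (Q Q' : 'M[F]_(p, m)) :
  stably_realized Q -> stably_realized Q' -> stably_realized (Q + Q').
Proof.
move=> [n [G [hG ->]]] [n' [G' [hG' ->]]]; exists (n + n')%N, (sys_add G G').
split; first by apply/Hurwitz_ublock.
have e : map_sys (@embed R) (sys_add G G')
    = sys_add (map_sys (@embed R) G) (map_sys (@embed R) G').
  by rewrite /map_sys /sys_add /= map_block_mx map_col_mx map_row_mx map_mxD !map_mx0.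
rewrite /rtransfer e transfer_add //; [exact: nonpole_svar..|].
have := nonpole_svar halpha (sysA (sys_add G G')).
by rewrite -[sysA (sys_add (map_sys _ G) _)](congr1 (fun G => sysA G) e).
Qed.

Lemma realized_mul m p q (Q : 'M[F]_(q, p)) (Q' : 'M[F]_(p, m)) :
  stably_realized Q -> stably_realized Q' -> stably_realized (Q *m Q').
Proof.
move=> [n [G [hG ->]]] [n' [G' [hG' ->]]]; exists (n + n')%N, (sys_mul G G').
split; first by apply/Hurwitz_ublock.
have e : map_sys (@embed R) (sys_mul G G')
    = sys_mul (map_sys (@embed R) G) (map_sys (@embed R) G').
  by rewrite /map_sys /sys_mul /= map_block_mx map_col_mx map_row_mx !map_mxM !map_mx0.
rewrite /rtransfer e transfer_mul //; [exact: nonpole_svar..|].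
have := nonpole_svar halpha (sysA (sys_mul G G')).
by rewrite -[sysA (sys_mul (map_sys _ G) _)](congr1 (fun G => sysA G) e).
Qed.

(** The pencil [a - z], with the constant term chosen so that the numerator of
    the sum does not depend on [z]. *)
Lemma realized_pole (a : C) : `|a| < 1 ->
  stably_realized ((pf ('X - a%:P))^-1%:M : 'M[F]_1).
Proof.
move=> a1; pose c := (alpha - beta * a)^-1.
have nz : alpha - beta * a != 0.
  apply: center_neq => //; apply: contraTneq a1 => ->.
  by rewrite normf_div norm_conjC halpha divr1 ltxx.
have st : stable_pencil (a%:M : 'M[C]_1) 1%:M.
  split.
    rewrite /regular_pencil det_mx11 !mxE /= mulr1.
    apply/eqP=> /(congr1 (fun q : {poly C} => q`_1)).
    by rewrite coefB coefC coefX coef0 /= sub0r => /eqP; rewrite oppr_eq0 oner_eq0.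
  move=> [w|] /=; rewrite det_mx11 !mxE ?mulr1n ?mulr1; last by move/eqP; rewrite oner_eq0.
  by move/subr0_eq <-.
have [uW hA] := proj1 (stable_pencil_cayley halpha _ _) st.
exists 1%N, (cayley_sys alpha beta a%:M 1%:M (1%:M : 'M[C]_1) (c%:M : 'M[C]_1) (c * beta)%:M).
split; first exact: hA.
rewrite -centered_systemE // /centered_system !const_ratmxE !map_scalar_mx rmorph1.
rewrite scale_scalar_mx mulr1 -raddfB /= invmx_scalar -!scalar_mxM mulr1.
rewrite scale_scalar_mx -raddfD /=; congr (_%:M).
have xa : pf ('X - a%:P) != 0 by rewrite tofrac_eq0 polyXsubC_eq0.
have -> : poly_ratfunc 'X - pf a%:P = pf ('X - a%:P).
  by rewrite /poly_ratfunc -tofracB.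
have e1 : 1 = pf (c * (alpha - beta * a))%:P by rewrite mulVf // polyC1 tofrac1.
apply: (mulIf xa); rewrite mulVf // mulrDl -!mulrA mulVf // mulr1.
rewrite [LHS]e1 /poly_ratfunc -!tofracM -tofracD; congr (pf _).
rewrite -mul_polyC !polyCM polyCB polyCM; ring.
Qed.

(** Splitting off one pole at a time: dividing the numerator by [X - a] writes the
    quotient as a sum of a quotient of lower degree and a product with
    [1 / (X - a)]. *)
Lemma realized_scalar k (p q : {poly C}) : size q = k.+1 -> (size p <= size q)%N ->
  (forall w, root q w -> `|w| < 1) -> stably_realized ((pf p / pf q)%:M : 'M[F]_1).
Proof.
elim: k p q => [|k IH] p q sq spq hq.
  have [c c0 eq] : exists2 c, c != 0 & q = c%:P by apply/size_poly1P; rewrite sq.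
  have ep : p = (p`_0)%:P by apply: size1_polyC; rewrite -sq.
  have -> : (pf p / pf q)%:M = const_ratmx ((p`_0 / c)%:M : 'M[C]_1).
    rewrite const_ratmxE map_scalar_mx; congr (_%:M).
    have -> : embed R (p`_0 / c) = embed R p`_0 / embed R c by rewrite fmorph_div.
    by rewrite {1}ep eq.
  exact: realized_const.
have [a ra] : exists a, root q a.
  by apply: closed_rootP; rewrite sq.
have [q' eq] := factor_theorem _ _ ra.
have q'0 : q' != 0 by apply: contra_eq_neq sq => e; rewrite eq e mul0r size_poly0.
have sq' : size q' = k.+1.
  by have := sq; rewrite eq size_Mmonic ?monicXsubC // size_XsubC addn2 /= => -[].
have hq' w : root q' w -> `|w| < 1.
  by move=> rw; apply: hq; rewrite eq rootM rw.
pose p1 := p %/ ('X - a%:P).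
have ep : p = p1 * ('X - a%:P) + (p.[a])%:P by rewrite -modp_XsubC -divp_eq.
have sp1 : (size p1 <= size q')%N.
  rewrite size_divp ?polyXsubC_eq0 // size_XsubC leq_subLR sq' addSn.
  by move: spq; rewrite sq.
have xa : pf ('X - a%:P) != 0 by rewrite tofrac_eq0 polyXsubC_eq0.
have q'0' : pf q' != 0 by rewrite tofrac_eq0.
have -> : (pf p / pf q)%:M = (pf p1 / pf q')%:M
   + (pf (p.[a])%:P / pf q')%:M *m ((pf ('X - a%:P))^-1)%:M :> 'M[F]_1.
  rewrite -scalar_mxM -raddfD /=; congr (_%:M).
  have e1 : pf p = pf p1 * pf ('X - a%:P) + pf (p.[a])%:P.
    by rewrite -tofracM -tofracD -ep.
  have e2 : pf q = pf q' * pf ('X - a%:P) by rewrite -tofracM -eq.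
  by rewrite e1 e2; exact: (@split_div F (pf p1) (pf (p.[a])%:P) (pf q') _ xa).
apply: realized_add; first exact: IH.
apply: realized_mul; last by apply: realized_pole; exact: hq.
by apply: IH => //; rewrite sq' (leq_trans (size_polyC_leq1 _)).
Qed.

(** In lowest terms the poles are the roots of the denominator, all inside the
    disk, and analyticity at infinity bounds the degree of the numerator. *)
Lemma realized_analytic (f : F) : (forall z, ~ unit_disk z -> analytic_at f z) ->
  stably_realized (f%:M : 'M[F]_1).
Proof.
move=> hf; have [p [q [q0 ef spq]]] := hf None id.
have g0 : gcdp p q != 0 by rewrite gcdp_eq0 negb_and q0 orbT.
pose p' := p %/ gcdp p q; pose q' := q %/ gcdp p q.
have ep : p = p' * gcdp p q by rewrite divpK // dvdp_gcdl.
have eq : q = q' * gcdp p q by rewrite divpK // dvdp_gcdr.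
have q'0 : q' != 0 by apply: contra_neq q0 => e; rewrite eq e mul0r.
have cop : coprimep q' p' by rewrite coprimep_sym coprimep_div_gcd // q0 orbT.
have ef' : f = pf p' / pf q'.
  rewrite ef /poly_ratfunc {1}ep {2}eq !tofracM invfM mulrACA divff ?mulr1 //.
  by rewrite tofrac_eq0.
rewrite ef'; apply: (@realized_scalar (size q').-1).
- by rewrite prednK // size_poly_gt0.
- by rewrite /p' /q' !size_divp // leq_sub2r.
- move=> w rw; apply: contrapT => w1.
  have [p2 [q2 [q20 ef2 q2w]]] := hf (Some w) w1.
  have : q' %| q2.
    rewrite -(Gauss_dvdpr _ cop); apply/dvdpP; exists p2.
    apply: (@tofracI R); rewrite !tofracM.
    have h1 : pf q' != 0 by rewrite tofrac_eq0.
    have h2 : pf q2 != 0 by rewrite tofrac_eq0.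
    exact: cross_mul h1 h2 (etrans (esym ef') ef2).
  rewrite -dvdp_XsubCl in rw; move=> /(dvdp_trans rw); rewrite dvdp_XsubCl.
  by move/rootP=> q2w0; rewrite q2w0 eqxx in q2w.
Qed.

Lemma realized_RHinf m p (Q : 'M[F]_(p, m)) : RHinf Q -> stably_realized Q.
Proof.
move=> hQ.
have -> : Q = \sum_i \sum_j (const_ratmx (delta_mx i 0 : 'M[C]_(p, 1)) *m (Q i j)%:M)
    *m const_ratmx (delta_mx 0 j : 'M[C]_(1, m)).
  rewrite [LHS]matrix_sum_delta; apply: eq_bigr => i _; apply: eq_bigr => j _.
  rewrite mul_mx_scalar -scalemxAl !const_ratmxE -map_mxM mul_delta_mx.
  by congr (_ *: _); apply/matrixP=> a b; rewrite !mxE rmorph_nat.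
have r0 : stably_realized (0 : 'M[F]_(p, m)).
  by have := realized_const (0 : 'M[C]_(p, m)); rewrite const_ratmxE map_mx0.
elim/big_rec: _ => // i x _ hx; apply: realized_add => //.
elim/big_rec: _ => // j y _ hy; apply: realized_add => //.
apply: realized_mul; last exact: realized_const.
apply: realized_mul; first exact: realized_const.
by apply: realized_analytic => z nz; exact: hQ.
Qed.

Lemma BHinfP m p (Q : 'M[F]_(p, m)) : BHinf Q <->
  exists n (G : sys C n m p), stable_contraction G /\ Q = rtransfer alpha G.
Proof.
split=> [[hQ nQ]|[n [G [cG ->]]]].
  have [n [G [hG eQ]]] := realized_RHinf hQ; exists n, G; split=> //.
  by apply/(stable_contractionE halpha); rewrite -eQ.
have [hG nG] := proj1 (stable_contractionE halpha G) cG.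
by split=> //; exact: stable_RHinf.
Qed.

End StableRealization.

(** * Minimal realizations *)

Section Observability.
Variables (K : fieldType) (n p : nat) (A : 'M[K]_n) (D : 'M[K]_(p, n)).
Variable good : K -> Prop.
Hypothesis good_nonpole : forall s, good s -> nonpole s A.
Hypothesis good_infinite : forall l : seq K, exists2 s, good s & s \notin l.

Let res s := invmx (s%:M - A).
Let obs ss := (\sum_(s <- ss) <<D *m res s>>)%MS.

(* The row space of finitely many D (s - A)^-1 of the largest possible rank: it
   contains all others, hence is invariant under A. *)
Let obs_max : exists2 ss, forall s, s \in ss -> good s &
  forall s, good s -> (D *m res s <= obs ss)%MS.
Proof.
pose Q r := `[< exists2 ss, forall s, s \in ss -> good s & \rank (obs ss) = r >].
have exQ : exists r, Q r by exists (\rank (obs [::])); apply/asboolP; exists [::].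
have bQ r : Q r -> (r <= n)%N by move=> /asboolP [ss _ <-]; exact: rank_leq_row.
case: (ex_maxnP exQ bQ) => r /asboolP [ss gss er] max; exists ss => // s gs.
have sub : (obs ss <= obs (s :: ss))%MS by rewrite /obs big_cons addsmxSr.
have := max (\rank (obs (s :: ss))) _; rewrite -er => le_r.
have : (obs (s :: ss) <= obs ss)%MS.
  rewrite -(mxrank_leqif_sup sub) eqn_leq mxrankS //=; apply: le_r.
  apply/asboolP; exists (s :: ss) => // t; rewrite in_cons => /orP[/eqP ->//|]; exact: gss.
by apply: submx_trans; rewrite /obs big_cons (submx_trans _ (addsmxSl _ _)) // genmxE.
Qed.

Let sums_mul (ss : seq K) (X : K -> 'M[K]_(p, n)) (M V : 'M[K]_n) :
  (forall s, s \in ss -> (X s *m M <= V)%MS) ->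
  ((\sum_(s <- ss) <<X s>>)%MS *m M <= V)%MS.
Proof.
elim: ss => [|s ss IH] h; first by rewrite big_nil mul0mx sub0mx.
rewrite big_cons addsmxMr addsmx_sub (eqmxMr _ (genmxE _)) h ?mem_head //=.
by apply: IH => t ts; apply: h; rewrite in_cons ts orbT.
Qed.

Let resolvent_identity s t : nonpole s A -> nonpole t A ->
  (s - t) *: (res t *m res s) = res t - res s.
Proof.
move=> us ut; have e : (s - t)%:M = (s%:M - A) - (t%:M - A).
  by rewrite opprB addrA subrK raddfB.
rewrite scalemxAl -mul_mx_scalar e mulmxBr mulmxBl.
by rewrite -mulmxA mulmxV // mulmx1 mulVmx // mul1mx.
Qed.

Let sums_coef q (X : K -> 'M[K]_(p, n)) (ss : seq K) (M : 'M[K]_(q, n)) :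
  (M <= \sum_(s <- ss) <<X s>>)%MS ->
  exists2 ys : seq (K * 'M[K]_(q, p)), forall y, y \in ys -> y.1 \in ss &
    M = \sum_(y <- ys) y.2 *m X y.1.
Proof.
elim: ss M => [|s ss IH] M.
  by rewrite big_nil submx0 => /eqP ->; exists [::]; rewrite ?big_nil.
rewrite big_cons => /sub_addsmxP [u ->].
have [ys hys ->] := IH _ (submxMl u.2 (\sum_(t <- ss) <<X t>>)%MS).
have /submxP [y ->] : (u.1 *m <<X s>> <= X s)%MS by rewrite (submx_trans (submxMl _ _)) ?genmxE.
exists ((s, y) :: ys); last by rewrite big_cons.
move=> t; rewrite in_cons => /orP[/eqP ->|/hys ts]; rewrite in_cons ?eqxx //.
by rewrite ts orbT.
Qed.

(** Kalman reduction, in frequency terms: either a smaller system with state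
    [L x] has the same output, or the state can be recovered from the outputs at
    finitely many points. The points may be required to avoid a finite set,
    which is needed to keep those for outputs and inputs apart. *)
Lemma observable_alternative :
  (exists r (L : 'M[K]_(r, n)) (N : 'M[K]_(n, r)) (A' : 'M[K]_r) (D' : 'M[K]_(p, r)),
    [/\ (r < n)%N, L *m N = 1%:M, L *m A = A' *m L & D = D' *m L]) \/
  (exists2 ys : seq (K * 'M[K]_(n, p)), forall y, y \in ys -> good y.1 &
     1%:M = \sum_(y <- ys) y.2 *m (D *m invmx (y.1%:M - A))).
Proof.
have [ss gss hss] := obs_max; set O := obs ss in hss.
have [s gs sss] := good_infinite ss; have us := good_nonpole gs.
have OR : (O *m res s <= O)%MS.
  apply: sums_mul => t ts; have ut := good_nonpole (gss t ts).
  have st : s - t != 0 by rewrite subr_eq0; apply: contraNneq sss => ->.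
  rewrite -mulmxA -[_ *m res s](scalerK st) resolvent_identity //.
  rewrite -scalemxAr scalemx_sub // mulmxBr; apply: addmx_sub; first exact/hss/gss.
  by rewrite eqmx_opp hss.
have uR : res s \in unitmx by rewrite unitmx_inv.
have OM : (O *m (s%:M - A) <= O)%MS.
  have RO : (O <= O *m res s)%MS.
    by rewrite -(mxrank_leqif_sup OR) mxrankMfree // row_free_unit.
  apply: submx_trans (submxMr (s%:M - A) RO) _.
  by rewrite -mulmxA mulVmx // mulmx1.
have OA : (O *m A <= O)%MS.
  have -> : A = s%:M - (s%:M - A) by rewrite opprB addrC subrK.
  rewrite mulmxBr addmx_sub // ?eqmx_opp //.
  by rewrite mul_mx_scalar scalemx_sub.
have DO : (D <= O)%MS.
  have e : D = D *m res s *m (s%:M - A) by rewrite mulmxKV.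
  rewrite e; exact: submx_trans (submxMr _ (hss s gs)) OM.
have [full|nfull] := boolP (row_full O).
  right; have [ys hys e] := sums_coef (submx_full 1%:M full).
  by exists ys => // y /hys; exact: gss.
left; exists (\rank O), (row_base O), (pinvmx (row_base O)).
have /submxP [A' eA] : (row_base O *m A <= row_base O)%MS.
  by rewrite eq_row_base (eqmxMr _ (eq_row_base O)).
have /submxP [D' eD] : (D <= row_base O)%MS by rewrite eq_row_base.
exists A', D'; split=> //; last by rewrite mulmxVp // row_base_free.
by rewrite ltn_neqAle rank_leq_row andbT.
Qed.

End Observability.

Section Reduction.
Variable F : fieldType.

Lemma transfer_observable s n r m p (G : sys F n m p) (L : 'M[F]_(r, n))
    (A' : 'M[F]_r) (D' : 'M[F]_(p, r)) :
  nonpole s (sysA G) -> nonpole s A' -> L *m sysA G = A' *m L -> sysC G = D' *m L ->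
  transfer s G = transfer s (Sys A' (L *m sysB G) D' (sysD G)).
Proof.
move=> uG uA LA CL; have [X eX] := resolvent_state (sysB G) 1%:M uG.
rewrite mulmx1 in eX; apply: (transfer_eq (X := X) (X' := L *m X)) => //=.
  by rewrite scalemxAr eX mulmxDr !mulmxA LA.
by rewrite CL mulmxA.
Qed.

Lemma transfer_controllable s n r m p (G : sys F n m p) (N : 'M[F]_(n, r))
    (A' : 'M[F]_r) (B' : 'M[F]_(r, m)) :
  nonpole s (sysA G) -> nonpole s A' -> sysA G *m N = N *m A' -> sysB G = N *m B' ->
  transfer s G = transfer s (Sys A' B' (sysC G *m N) (sysD G)).
Proof.
move=> uG uA AN BN; have [X eX] := resolvent_state B' 1%:M uA.
rewrite mulmx1 in eX; apply: (transfer_eq (X := N *m X) (X' := X)) => //=.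
  by rewrite scalemxAr eX mulmxDr !mulmxA AN BN.
by rewrite mulmxA.
Qed.

Lemma nonpole_quotient s n r (A : 'M[F]_n) (A' : 'M[F]_r) (L : 'M[F]_(r, n))
    (N : 'M[F]_(n, r)) :
  L *m N = 1%:M -> L *m A = A' *m L -> nonpole s A -> nonpole s A'.
Proof.
move=> LN LA uA; have e : (s%:M - A') *m L = L *m (s%:M - A).
  by rewrite mulmxBl mulmxBr LA mul_scalar_mx mul_mx_scalar.
have : (s%:M - A') *m (L *m invmx (s%:M - A) *m N) = 1%:M.
  by rewrite !mulmxA e mulmxK.
by case/mulmx1_unit.
Qed.

Lemma nonpole_sub s n r (A : 'M[F]_n) (A' : 'M[F]_r) (L : 'M[F]_(r, n))
    (N : 'M[F]_(n, r)) :
  L *m N = 1%:M -> A *m N = N *m A' -> nonpole s A -> nonpole s A'.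
Proof.
move=> LN AN uA; have e : N *m (s%:M - A') = (s%:M - A) *m N.
  by rewrite mulmxBl mulmxBr AN mul_scalar_mx mul_mx_scalar.
have : (L *m invmx (s%:M - A) *m N) *m (s%:M - A') = 1%:M.
  by rewrite -mulmxA e mulmxA mulmxKV.
by case/mulmx1_unit.
Qed.

Section ReducedLoop.
Variables (s : F) (n m1 m2 p1 p2 k r : nat) (T : plant F n m1 m2 p1 p2).
Variables (G : sys F k p2 m2) (L : 'M[F]_(r, k)) (N : 'M[F]_(k, r)) (A' : 'M[F]_r).
Hypothesis LN : L *m N = 1%:M.

Let LN1 : block_mx 1%:M 0 0 L *m block_mx 1%:M 0 0 N = 1%:M :> 'M[F]_(n + r).
Proof.
by rewrite mulmx_block !mulmx0 !mul0mx !addr0 add0r mulmx1 LN -scalar_mx_block.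
Qed.

Lemma nonpole_loop_observable (D' : 'M[F]_(m2, r)) :
  L *m sysA G = A' *m L -> sysC G = D' *m L -> nonpole s (sysA (loop T G)) ->
  nonpole s (sysA (loop T (Sys A' (L *m sysB G) D' (sysD G)))).
Proof.
move=> LA CL; apply: (nonpole_quotient LN1).
rewrite /loop /= !mulmx_block !mulmx0 !mul0mx !mul1mx !mulmx1 !addr0 !add0r.
by rewrite LA CL !mulmxA.
Qed.

Lemma nonpole_loop_controllable (B' : 'M[F]_(r, p2)) :
  sysA G *m N = N *m A' -> sysB G = N *m B' -> nonpole s (sysA (loop T G)) ->
  nonpole s (sysA (loop T (Sys A' B' (sysC G *m N) (sysD G)))).
Proof.
move=> AN BN; apply: (nonpole_sub LN1).
rewrite /loop /= !mulmx_block !mulmx0 !mul0mx !mul1mx !mulmx1 !addr0 !add0r.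
by rewrite AN BN !mulmxA.
Qed.

End ReducedLoop.

Lemma resolvent_diff n (A : 'M[F]_n) s t : nonpole s A -> nonpole t A ->
  invmx (s%:M - A) - invmx (t%:M - A)
  = (t - s) *: (invmx (s%:M - A) *m invmx (t%:M - A)).
Proof.
move=> us ut; have e : (t - s)%:M = (t%:M - A) - (s%:M - A).
  by rewrite opprB addrA subrK raddfB.
rewrite scalemxAl -mul_mx_scalar e mulmxBr mulmxBl.
by rewrite -mulmxA mulmxV // mulmx1 mulVmx // mul1mx.
Qed.

Lemma pencil_diff n (A E : 'M[F]_n) a b z w :
  z *: E - A \in unitmx -> w *: E - A \in unitmx ->
  (a - b * z) *: invmx (z *: E - A) - (a - b * w) *: invmx (w *: E - A)
  = (w - z) *: (invmx (z *: E - A) *m (a *: E - b *: A) *m invmx (w *: E - A)).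
Proof.
move=> uz uw.
have e : (w - z) *: (a *: E - b *: A)
    = (a - b * z) *: (w *: E - A) - (a - b * w) *: (z *: E - A).
  by apply/matrixP=> i j; rewrite !(addmxE, oppmxE, scalemxE); ring.
rewrite scalemxAl scalemxAr e mulmxBr mulmxBl -!scalemxAr -!scalemxAl.
by rewrite -mulmxA mulmxV // mulmx1 mulVmx // mul1mx.
Qed.

Lemma cayley_diff (a b z w : F) : a * b = 1 -> (2 : F) != 0 ->
  a - b * z != 0 -> a - b * w != 0 ->
  cayley a b w - cayley a b z = (z - w) / ((a - b * z) * (a - b * w)).
Proof.
move=> ab two hz hw.
have -> : z - w = a * b * (z - w) by rewrite ab mul1r.
by rewrite /cayley; field; rewrite hz hw two.
Qed.

(** Divided differences of the transfer function (entries of the Loewner matrix)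
    factor through the state space of every realization, standard or not. They
    do not depend on the realization. *)
Lemma loewner_eq (a b : F) n n' m p (G : sys F n m p) (A E : 'M[F]_n')
    (B : 'M[F]_(n', m)) (D : 'M[F]_(p, n')) (H : 'M[F]_(p, m)) z w :
  let d x := a - b * x in
  let M x := invmx (x *: E - A) in
  let r x := invmx ((cayley a b x)%:M - sysA G) in
  a * b = 1 -> (2 : F) != 0 -> z != w -> d z != 0 -> d w != 0 ->
  z *: E - A \in unitmx -> w *: E - A \in unitmx ->
  nonpole (cayley a b z) (sysA G) -> nonpole (cayley a b w) (sysA G) ->
  H + d z *: (D *m M z *m B) = transfer (cayley a b z) G ->
  H + d w *: (D *m M w *m B) = transfer (cayley a b w) G ->
  sysC G *m r z *m (r w *m sysB G)
  = - ((d z *: (D *m M z)) *m (a *: E - b *: A) *m (d w *: (M w *m B))).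
Proof.
move=> d M r ab two zw dz dw uz uw gz gw ez ew.
have zw' : z - w != 0 by rewrite subr_eq0.
have e1 : sysC G *m (r z - r w) *m sysB G = D *m (d z *: M z - d w *: M w) *m B.
  have := congr2 (fun X Y => X - Y) ez ew; rewrite /transfer -/(r z) -/(r w).
  rewrite opprD addrACA subrr add0r opprD addrACA subrr add0r => e.
  by rewrite !mulmxBr !mulmxBl -e -!scalemxAr -!scalemxAl.
move: e1; rewrite /r resolvent_diff // -/(r z) -/(r w) /d pencil_diff // -/(d z) -/(d w).
rewrite cayley_diff // -/(d z) -/(d w) -/(M z) -/(M w).
rewrite -!scalemxAr -!scalemxAl !mulmxA => e2.
have c0 : (z - w) / (d z * d w) != 0 by rewrite mulf_neq0 // invr_eq0 mulf_neq0.
apply: (scalerI c0); rewrite e2 scalerN !scalerA -scaleNr; congr (_ *: _).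
by field; rewrite dz dw.
Qed.

End Reduction.

Section Minimality.
Variables (R : realType) (alpha : R[i]).
Hypothesis halpha : `|alpha| = 1.
Local Notation C := R[i].
Local Notation F := (ratfunc R).
Local Notation beta := (alpha^*).

Lemma rtransfer_observable n r m p (G : sys C n m p) (L : 'M[C]_(r, n))
    (A' : 'M[C]_r) (D' : 'M[C]_(p, r)) :
  L *m sysA G = A' *m L -> sysC G = D' *m L ->
  rtransfer alpha G = rtransfer alpha (Sys A' (L *m sysB G) D' (sysD G)).
Proof.
move=> LA CL; have e := @transfer_observable _ (svar alpha) _ _ _ _
  (map_sys (@embed R) G) (const_ratmx L) (const_ratmx A') (const_ratmx D').
rewrite /rtransfer e.
- by rewrite /map_sys /= !const_ratmxE map_mxM.
- exact: nonpole_svar.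
- exact: nonpole_svar.
- by rewrite /= !const_ratmxE -!map_mxM LA.
- by rewrite /= !const_ratmxE -!map_mxM CL.
Qed.

Lemma rtransfer_controllable n r m p (G : sys C n m p) (N : 'M[C]_(n, r))
    (A' : 'M[C]_r) (B' : 'M[C]_(r, m)) :
  sysA G *m N = N *m A' -> sysB G = N *m B' ->
  rtransfer alpha G = rtransfer alpha (Sys A' B' (sysC G *m N) (sysD G)).
Proof.
move=> AN BN; have e := @transfer_controllable _ (svar alpha) _ _ _ _
  (map_sys (@embed R) G) (const_ratmx N) (const_ratmx A') (const_ratmx B').
rewrite /rtransfer e.
- by rewrite /map_sys /= !const_ratmxE map_mxM.
- exact: nonpole_svar.
- exact: nonpole_svar.
- by rewrite /= !const_ratmxE -!map_mxM AN.
- by rewrite /= !const_ratmxE -!map_mxM BN.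
Qed.

Lemma regular_pencil_unit n (A E : 'M[C]_n) z : z *: E - A \in unitmx -> regular_pencil A E.
Proof.
move=> uM; apply/eqP=> d0; have := congr1 (fun p : {poly C} => p.[z]) d0.
rewrite horner0 -horner_evalE -det_map_mx.
have -> : map_mx (horner_eval z) (map_mx polyC A - 'X *: map_mx polyC E) = A - z *: E.
  by apply/matrixP=> i j; rewrite !mxE /= horner_evalE !hornerE.
apply/eqP; rewrite -unitfE -unitmxE -opprB -scaleN1r unitmxZ //.
by rewrite unitrN unitr1.
Qed.

Lemma regular_pencil_generic n (A E : 'M[C]_n) : regular_pencil A E ->
  exists l : seq C, forall z, z \notin l -> z *: E - A \in unitmx.
Proof.
rewrite /regular_pencil; set q := \det _ => reg; have [l el] := closed_field_poly_normal q.
exists l => z zl; rewrite -opprB -scaleN1r unitmxZ ?unitrN ?unitr1 //.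
rewrite unitmxE unitfE.
have -> : \det (A - z *: E) = q.[z].
  rewrite -horner_evalE -det_map_mx; congr (\det _).
  by apply/matrixP=> i j; rewrite !mxE /= horner_evalE !hornerE.
rewrite el hornerZ mulf_neq0 ?lead_coef_eq0 // horner_prod.
rewrite prodf_seq_neq0; apply/allP => w wl /=.
by rewrite !hornerE subr_eq0; apply: contraNneq zl => ->.
Qed.

Lemma exists_notin (l : seq C) : exists z, z \notin l.
Proof.
pose x : R := 1 + \sum_(w <- l) cabs w; exists x%:C%C; apply/negP=> xl.
have : cabs x%:C%C <= \sum_(w <- l) cabs w.
  rewrite (big_rem _ xl) /= lerDl sumr_ge0 // => w _; exact: cabs_ge0.
rewrite cabs_real; have : 0 <= \sum_(w <- l) cabs w by rewrite sumr_ge0 // => *; exact: cabs_ge0.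
by rewrite /x => h; rewrite ger0_norm; lra.
Qed.

(** The points at which both the standard system and the competing pencil can be
    evaluated: all but finitely many. *)
Definition matching_point n n' (A0 : 'M[C]_n) (A E : 'M[C]_n') s : Prop :=
  let z := cayley_inv alpha beta s in
  [/\ z != alpha / beta, cayley alpha beta z = s, nonpole s A0
    & z *: E - A \in unitmx].

Lemma matching_point_infinite n n' (A0 : 'M[C]_n) (A E : 'M[C]_n') (l : seq C) :
  regular_pencil A E -> exists2 s, matching_point A0 A E s & s \notin l.
Proof.
move=> /regular_pencil_generic [l1 h1].
have [l2 _ [_ h2]] := det_sub_factor A0.
have [z] := exists_notin (alpha / beta :: l1 ++ map (cayley_inv alpha beta) (l2 ++ l)).
rewrite in_cons mem_cat !negb_or => /and3P[z0 /h1 uz zl].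
have [s1 zs] := cayleyK halpha z0; exists (cayley alpha beta z).
  rewrite /matching_point zs; split=> //; apply: contraT; rewrite -h2 => sl.
  case/negP: zl; apply/mapP; exists (cayley alpha beta z) => //.
  by rewrite mem_cat sl.
apply: contra zl => sl; apply/mapP; exists (cayley alpha beta z) => //.
by rewrite mem_cat sl orbT.
Qed.

Section MinimalOrder.
Variables (n n' m p : nat) (G : sys C n m p) (A E : 'M[C]_n') (B : 'M[C]_(n', m)).
Variables (D : 'M[C]_(p, n')) (H : 'M[C]_(p, m)).
Hypothesis eG : rtransfer alpha G = centered_system alpha A E B D H.

Let good s := matching_point (sysA G) A E s.

Let good_value s : good s ->
  H + (alpha - beta * cayley_inv alpha beta s)
    *: (D *m invmx (cayley_inv alpha beta s *: E - A) *m B) = transfer s G.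
Proof.
case; set z := cayley_inv _ _ _ => z0 zs us uz.
have h1 := centered_value halpha B D H uz; rewrite -eG in h1.
have z0' : Some z != Some (alpha / beta) by [].
have h2 := rtransfer_value halpha z0' (G := G); rewrite /= zs in h2.
exact: (has_valuemx_unique (@tofracI R)) h1 (h2 us).
Qed.

(** Observability and controllability write the identity of the state space as a
    combination of divided differences; by [loewner_eq] the identity then factors
    through the state space, of dimension [n'], of the competing pencil. *)
Lemma minimal_order
  (ys : seq (C * 'M[C]_(n, p))) (xs : seq (C * 'M[C]_(m, n))) :
  (forall y, y \in ys -> good y.1) ->
  (forall x, x \in xs -> good x.1 /\ x.1 \notin map fst ys) ->
  1%:M = \sum_(y <- ys) y.2 *m (sysC G *m invmx (y.1%:M - sysA G)) ->
  1%:M = \sum_(x <- xs) (invmx (x.1%:M - sysA G) *m sysB G) *m x.2 ->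
  (n <= n')%N.
Proof.
move=> gys gxs ey ex; pose zz := cayley_inv alpha beta.
pose O := \sum_(y <- ys) y.2 *m ((alpha - beta * zz y.1) *: (D *m invmx (zz y.1 *: E - A))).
pose Q := \sum_(x <- xs) ((alpha - beta * zz x.1) *: (invmx (zz x.1 *: E - A) *m B)) *m x.2.
suff e : O *m - ((alpha *: E - beta *: A) *m Q) = 1%:M by apply: mulmx1_min e.
rewrite -[RHS]mulmx1 {1}ey ex mulmxN mulmxA /O /Q !mulmx_suml -sumrN.
apply: eq_big_seq => y yy; have gy := gys y yy; rewrite !mulmx_sumr -sumrN.
apply: eq_big_seq => x xx; have [gx xy] := gxs x xx.
have [yz yzs yn yu] := gy; have [xz xzs xn xu] := gx.
have zw : zz y.1 != zz x.1.
  apply: contraNneq xy => e; apply/mapP; exists y; first exact: yy.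
  by rewrite -xzs -yzs -/(zz x.1) -/(zz y.1) e.
have := @loewner_eq C alpha beta n n' m p G A E B D H (zz y.1) (zz x.1)
  (alpha_beta halpha) (two_neq0 R) zw (center_neq halpha yz) (center_neq halpha xz) yu xu.
rewrite /zz yzs xzs => /(_ yn xn (good_value gy) (good_value gx)) e.
have e2 := congr1 (fun M => y.2 *m M *m x.2) e.
by move: e2; rewrite mulmxN mulNmx !mulmxA => ->.
Qed.

End MinimalOrder.

Lemma rtransfer_realizes n m p (G : sys C n m p) :
  realizes alpha (rtransfer alpha G) (pencil_A alpha (sysA G)) (pencil_E alpha (sysA G))
    (sysB G) (sysC G) (sysD G).
Proof.
split; last exact: rtransfer_centered.
exact: regular_pencil_unit (pencil_unit_center halpha (sysA G)).
Qed.

(** Removing unobservable or uncontrollable states of a controller removes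
    modes of the loop, so the least order among all stabilizing realizations
    of a controller is the least order among all its realizations. *)
Lemma minimal_stable n k m1 m2 p1 p2 (T : plant C n m1 m2 p1 p2) (K : sys C k p2 m2) :
  Hurwitz (sysA (loop T K)) ->
  exists k' (K' : sys C k' p2 m2), [/\ Hurwitz (sysA (loop T K')),
    rtransfer alpha K' = rtransfer alpha K &
    minimal_realization alpha (rtransfer alpha K) (pencil_A alpha (sysA K'))
      (pencil_E alpha (sysA K')) (sysB K') (sysC K') (sysD K')].
Proof.
move=> hK; pose P k' := `[< exists K' : sys C k' p2 m2,
  Hurwitz (sysA (loop T K')) /\ rtransfer alpha K' = rtransfer alpha K >].
have exP : exists k', P k' by exists k; apply/asboolP; exists K.
case: (ex_minnP exP) => k' /asboolP [K' [hK' eK']] min; exists k', K'; split=> //.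
split; first by rewrite -eK'; exact: rtransfer_realizes.
move=> n' A' E' B' C' D' [reg eQ]; rewrite -eK' in eQ.
pose good s := matching_point (sysA K') A' E' s.
have gn s : good s -> nonpole s (sysA K') by case.
have ginf (l : seq C) : exists2 s, good s & s \notin l.
  exact: (matching_point_infinite (sysA K') l reg).
have [[r [L [N [A1 [D1 [rk LN LA CL]]]]]]|[ys gys ey]] :=
    observable_alternative (sysC K') gn ginf.
  suff /min : P r by rewrite leqNgt rk.
  apply/asboolP; exists (Sys A1 (L *m sysB K') D1 (sysD K')); split.
    by move=> s Res; apply: (nonpole_loop_observable LN LA CL); exact: hK'.
  by rewrite -eK' (rtransfer_observable LA CL).
pose good2 s := good s /\ s \notin map fst ys.
have gn2 s : good2 s -> nonpole s (sysA K')^T.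
  move=> [/gn us _]; have e : s%:M - (sysA K')^T = (s%:M - sysA K')^T.
    by rewrite linearB /= tr_scalar_mx.
  by rewrite /nonpole e unitmx_tr.
have ginf2 (l : seq C) : exists2 s, good2 s & s \notin l.
  have [s gs] := ginf (map fst ys ++ l); rewrite mem_cat negb_or => /andP[sy sl].
  by exists s.
have [[r [L [N [A1 [D1 [rk LN LA CL]]]]]]|[xs gxs ex]] :=
    observable_alternative (sysB K')^T gn2 ginf2.
  have NL : N^T *m L^T = 1%:M by rewrite -trmx_mul LN trmx1.
  have AL : sysA K' *m L^T = L^T *m A1^T by rewrite -trmx_mul -LA trmx_mul trmxK.
  have BL : sysB K' = L^T *m D1^T by rewrite -trmx_mul -CL trmxK.
  suff /min : P r by rewrite leqNgt rk.
  apply/asboolP; exists (Sys A1^T D1^T (sysC K' *m L^T) (sysD K')); split.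
    by move=> s Res; apply: (nonpole_loop_controllable NL AL BL); exact: hK'.
  by rewrite -eK' (rtransfer_controllable AL BL).
apply: (@minimal_order _ _ _ _ K' A' E' B' C' D' eQ ys
  [seq (x.1, x.2^T) | x <- xs] gys _ ey).
  by move=> _ /mapP [x /gxs gx ->].
have := congr1 trmx ex; rewrite trmx1 big_map linear_sum /= => {1}->.
apply: eq_big_seq => x /gxs [/gn us _]; rewrite !trmx_mul trmxK trmx_inv.
by rewrite linearB /= tr_scalar_mx trmxK.
Qed.

End Minimality.

(** * Inverting a plant with square feedthroughs *)

(** Solving the equations of the plant for its other inputs: from the
    measurement [y] and the output [z] one recovers the control [u] and the
    disturbance [w]. The state is the opposite of that of the plant, which
    makes closing the two systems on each other cancel. *)
Definition inverse_plant (F : fieldType) n m2 p2 (P : plant F n p2 m2 m2 p2) :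
    plant F n p2 m2 m2 p2 :=
  let iS := invmx (plD12 P) in let iT := invmx (plD21 P) in
  Plant (plA P - plB2 P *m iS *m plC1 P - plB1 P *m iT *m plC2 P)
        (- (plB1 P *m iT)) (- (plB2 P *m iS)) (iS *m plC1 P) (iT *m plC2 P) iS iT.

Section InversePlant.
Variables (F : fieldType) (s : F) (n k m2 p2 : nat).
Variables (P : plant F n p2 m2 m2 p2) (Q : sys F k p2 m2).
Hypothesis uS : plD12 P \in unitmx.
Hypothesis uT : plD21 P \in unitmx.

Let G := loop P (loop (inverse_plant P) Q).
Let G' := loop (inverse_plant P) (loop P Q).
Let iS := invmx (plD12 P).
Let iT := invmx (plD21 P).

(** Because the inverse carries the opposite state, [x + xi] measures how far the
    two plants are from running in step; it is a hidden mode. *)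
Lemma inverse_right_signals q (x xi : 'M[F]_(n, q)) (xq : 'M[F]_(k, q)) w :
  let y := col_mx x (col_mx xi xq) in
  s *: y = sysA G *m y + sysB G *m w ->
  s *: (x + xi) = (plA P - plB1 P *m iT *m plC2 P) *m (x + xi) /\
  (x + xi = 0 ->
   let v := sysC Q *m xq + sysD Q *m w in
   [/\ s *: xq = sysA Q *m xq + sysB Q *m w,
       s *: xi = (plA P - plB2 P *m iS *m plC1 P) *m xi
                 - plB1 P *m w - plB2 P *m iS *m v
     & sysC G *m y + sysD G *m w = v]).
Proof.
move=> y0 /loop_split []; rewrite -/G -/y0.
set y := plC2 P *m x + _ => ex /loop_split []; rewrite -/iS -/iT.
set e := plC2 (inverse_plant P) *m xi + _; set v := sysC Q *m xq + _.
have ee : e = iT *m plC2 P *m (x + xi) + w.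
  rewrite /e /y /= -/iT mulmxDr [iT *m (plD21 P *m w)]mulKmx //; mx_ring.
move=> exi eq eu; rewrite eu => eout; rewrite eu in ex.
have exi' : s *: xi = (plA P - plB2 P *m iS *m plC1 P) *m xi
    - plB1 P *m w - plB1 P *m iT *m plC2 P *m (x + xi) - plB2 P *m iS *m v.
  rewrite exi /y /= -/iS -/iT !mulmxDr !mulNmx.
  have -> : plB1 P *m iT *m (plD21 P *m w) = plB1 P *m w by rewrite mulmxA mulmxKV.
  by mx_ring.
have ev : plC1 P *m x + plD12 P *m (plC1 (inverse_plant P) *m xi + plD12 (inverse_plant P) *m v)
    = plC1 P *m (x + xi) + v.
  by rewrite /= -/iS mulmxDr !mulmxA mulmxV // !mul1mx mulmxDr addrA.
split.
  by rewrite scalerDr ex exi' /= -/iS; mx_ring.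
move=> d0; rewrite d0 in ee ev exi'; split.
- by rewrite eq ee mulmx0 add0r.
- by rewrite exi' /v ee !mulmx0 add0r subr0.
- by rewrite eout ev /v ee !mulmx0 !add0r.
Qed.

Lemma transfer_inverse_right :
  nonpole s (plA P - plB1 P *m iT *m plC2 P) -> nonpole s (sysA Q) ->
  nonpole s (sysA G) -> transfer s G = transfer s Q.
Proof.
move=> ud uQ uG; have [y] := resolvent_state (sysB G) 1%:M uG.
rewrite -[y]vsubmxK -[dsubmx y]vsubmxK => ey; have [ed] := inverse_right_signals ey.
move: ey; rewrite mulmx1 => ey.
have -> : usubmx y + usubmx (dsubmx y) = 0 :> 'M[F]_(n, p2).
  rewrite -[LHS](mulKmx ud) mulmxBl mul_scalar_mx ed subrr; exact: mulmx0.
move=> /(_ erefl) /=; rewrite !mulmx1 => -[eq _ eo].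
exact: transfer_eq uG uQ ey eq eo.
Qed.

Lemma inverse_left_signals q (x xi : 'M[F]_(n, q)) (xq : 'M[F]_(k, q)) y :
  let X := col_mx xi (col_mx x xq) in
  s *: X = sysA G' *m X + sysB G' *m y ->
  s *: (x + xi) = (plA P - plB2 P *m iS *m plC1 P) *m (x + xi) /\
  (x + xi = 0 ->
     s *: xq = sysA Q *m xq + sysB Q *m y /\
     sysC G' *m X + sysD G' *m y = sysC Q *m xq + sysD Q *m y).
Proof.
move=> X0 /loop_split []; rewrite -/G' -/X0.
set w := plC2 (inverse_plant P) *m xi + _ => exi /loop_split [].
set y' := plC2 P *m x + _; set u := sysC Q *m xq + _.
have ey : y' = plC2 P *m (x + xi) + y.
  rewrite /y' /w /= -/iT mulmxDr !mulmxA mulmxV // !mul1mx mulmxDr addrA //.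
move=> ex eq ez; rewrite ez in exi *.
have eu : plC1 (inverse_plant P) *m xi + plD12 (inverse_plant P) *m
    (plC1 P *m x + plD12 P *m u) = iS *m plC1 P *m (x + xi) + u.
  by rewrite /= -/iS mulmxDr mulKmx //; mx_ring.
move=> eo; split.
  rewrite scalerDr ex exi /w /= -/iS -/iT !mulmxDr !mulNmx !mulmxA.
  have -> : plB2 P *m iS *m plD12 P = plB2 P by rewrite mulmxKV.
  by mx_ring.
move=> d0; rewrite d0 mulmx0 add0r in ey; rewrite d0 mulmx0 add0r in eu.
by rewrite eq eo eu /u ey.
Qed.

Lemma transfer_inverse_left :
  nonpole s (plA P - plB2 P *m iS *m plC1 P) -> nonpole s (sysA Q) ->
  nonpole s (sysA G') -> transfer s G' = transfer s Q.
Proof.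
move=> ud uQ uG; have [y] := resolvent_state (sysB G') 1%:M uG.
rewrite -[y]vsubmxK -[dsubmx y]vsubmxK => ey; have [ed] := inverse_left_signals ey.
move: ey; rewrite mulmx1 => ey.
have -> : usubmx (dsubmx y) + usubmx y = 0 :> 'M[F]_(n, p2).
  rewrite -[LHS](mulKmx ud) mulmxBl mul_scalar_mx ed subrr; exact: mulmx0.
move=> /(_ erefl) /=; rewrite !mulmx1 => -[eq eo].
exact: transfer_eq uG uQ ey eq eo.
Qed.

End InversePlant.

(** Besides the modes of [Q] the loop has two groups of hidden modes: the mismatch
    of the two plants, and the state of the inverse once they run in step. *)
Lemma stable_contraction_inverse (R : realType) n k m2 p2
    (P : plant R[i] n p2 m2 m2 p2) (Q : sys R[i] k p2 m2) :
  plD12 P \in unitmx -> plD21 P \in unitmx ->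
  Hurwitz (plA P - plB1 P *m invmx (plD21 P) *m plC2 P) ->
  Hurwitz (plA P - plB2 P *m invmx (plD12 P) *m plC1 P) ->
  stable_contraction Q -> stable_contraction (loop P (loop (inverse_plant P) Q)).
Proof.
move=> uS uT hd hi cQ; have [hQ _ _] := cQ.
have hG : Hurwitz (sysA (loop P (loop (inverse_plant P) Q))).
  move=> s Res; apply/nonpoleP => y /esym; rewrite -[y]vsubmxK -[dsubmx y]vsubmxK.
  set x := usubmx y; set xi := usubmx (dsubmx y); set xq := dsubmx (dsubmx y) => ey.
  have ey0 := etrans ey (esym (addr0 _)).
  rewrite -[X in _ + X](mulmx0 _ (sysB (loop P (loop (inverse_plant P) Q)))) in ey0.
  have [ed] := inverse_right_signals uS uT ey0.
  have d0 := nonpoleP _ _ (hd s Res) _ (esym ed).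
  move=> /(_ d0) [eq ei _]; move: eq ei; rewrite !mulmx0 !addr0 subr0 => eq.
  have q0 := nonpoleP _ _ (hQ s Res) _ (esym eq).
  rewrite q0 !mulmx0 subr0 => ei; have xi0 := nonpoleP _ _ (hi s Res) _ (esym ei).
  by move: d0; rewrite xi0 addr0 => ->; rewrite !col_mx0.
apply: (stable_contraction_eq hG _ _ cQ) => [s Res uQ uG|].
  symmetry; apply: transfer_inverse_right => //; exact: hd.
rewrite /loop /= !mulmxA mulmxV // mul1mx.
by rewrite mulmxKV.
Qed.

(** * The dual Riccati equation *)

Section DualStep.
Variable R : realType.
Local Notation C := R[i].
Variables (n k m1 m2 p1 p2 : nat).

(** The adjoint of the plant obtained by completing the square for the adjoint
    of [T]. *)
Definition dual_square_plant (T : plant C n m1 m2 p1 p2) (H1 : 'M[C]_(n, p1))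
    (H2 : 'M[C]_(n, p2)) (S : 'M[C]_p2) : plant C n p2 m2 p1 p2 :=
  Plant (plA T + H1 *m plC1 T) (- (H2 *m S)) (plB2 T + H1 *m plD12 T)
        (plC1 T) (plC2 T) (plD12 T) S.

Variables (T : plant C n m1 m2 p1 p2) (K : sys C k p2 m2) (Z : 'M[C]_n).
Variables (S : 'M[C]_p2) (H1 : 'M[C]_(n, p1)) (H2 : 'M[C]_(n, p2)).
Hypothesis hZ : Z^t* = Z.
Hypothesis Z_ge0 : forall v : 'cV[C]_n, 0 <= complex.Re ((v^t* *m Z *m v) 0 0).
Hypothesis uS : S \in unitmx.
Hypothesis hS : S^t* = S.
Hypothesis SS : S *m S = plD21 T *m (plD21 T)^t*.
Hypothesis eH1 : H1 = Z *m (plC1 T)^t*.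
Hypothesis eH2 : H2 *m (plD21 T *m (plD21 T)^t*)
  = - (Z *m (plC2 T)^t* + plB1 T *m (plD21 T)^t*).
Hypothesis riccati : plA T *m Z + Z *m (plA T)^t* + plB1 T *m (plB1 T)^t*
  + H1 *m H1^t* - H2 *m (plD21 T *m (plD21 T)^t*) *m H2^t* = 0.
Hypothesis stab : Hurwitz (plA T + H1 *m plC1 T + H2 *m plC2 T).

(** [riccati_step] for the adjoint loop. *)
Lemma riccati_step_dual :
  stable_contraction (loop T K)
  <-> stable_contraction (loop (dual_square_plant T H1 H2 S) K).
Proof.
rewrite stable_contraction_adj_loop.
have eF1 : H1^t* = (plB1 (adj_plant T))^t* *m Z.
  by rewrite eH1 adjmxM hZ.
have SS' : S *m S = (plD12 (adj_plant T))^t* *m plD12 (adj_plant T).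
  by rewrite SS /= adjmxK.
have eF2 : (plD12 (adj_plant T))^t* *m plD12 (adj_plant T) *m H2^t*
    = - ((plB2 (adj_plant T))^t* *m Z + (plD12 (adj_plant T))^t* *m plC1 (adj_plant T)).
  have := congr1 (fun M => M^t*) eH2.
  by rewrite adjmxM [in LHS]adjmxM adjmxN adjmxD !adjmxM hZ /= !adjmxK.
have ric : (plA (adj_plant T))^t* *m Z + Z *m plA (adj_plant T)
    + (plC1 (adj_plant T))^t* *m plC1 (adj_plant T) + H1^t*^t* *m H1^t*
    - H2^t*^t* *m ((plD12 (adj_plant T))^t* *m plD12 (adj_plant T)) *m H2^t* = 0.
  by rewrite /= !adjmxK.
have st : Hurwitz (plA (adj_plant T) + plB1 (adj_plant T) *m H1^t*
    + plB2 (adj_plant T) *m H2^t*).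
  by have := Hurwitz_adj stab; rewrite !adjmxD !adjmxM.
rewrite (riccati_step (adj_sys K) hZ Z_ge0 uS hS SS' eF1 eF2 ric st).
rewrite [in X in _ <-> X]stable_contraction_adj_loop.
suff -> : adj_plant (dual_square_plant T H1 H2 S)
    = square_plant (adj_plant T) (H1^t*) (H2^t*) S by [].
rewrite /adj_plant /square_plant /dual_square_plant /=.
by rewrite !(adjmxD, adjmxN, adjmxM) hS.
Qed.

End DualStep.

(** * Riccati equations of pencils in the left half-plane *)

Lemma cayley_A_feedback (K : fieldType) (a b : K) n (A E M : 'M[K]_n) :
  a * b = 1 -> (2 : K) != 0 ->
  (a *: (E + b *: M) - b *: (A + a *: M) = a *: E - b *: A) /\
  cayley_A a b (A + a *: M) (E + b *: M)
  = cayley_A a b A E - invmx (a *: E - b *: A) *m M.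
Proof.
move=> ab two.
have eW : a *: (E + b *: M) - b *: (A + a *: M) = a *: E - b *: A.
  by apply/matrixP=> i j; rewrite !(addmxE, oppmxE, scalemxE); ring.
split=> //; rewrite /cayley_A eW.
have -> : 2^-1 *: (a *: (E + b *: M) + b *: (A + a *: M))
    = 2^-1 *: (a *: E + b *: A) + M.
  apply/matrixP=> i j; rewrite !(addmxE, oppmxE, scalemxE).
  have -> : 2^-1 * (a * (E i j + b * M i j) + b * (A i j + a * M i j))
      = 2^-1 * (a * E i j + b * A i j) + a * b * M i j by field.
  by rewrite ab mul1r.
by rewrite mulmxDr opprD.
Qed.

Section RiccatiCayley.
Variable C : numClosedFieldType.
Variables (alpha : C) (n : nat).
Hypothesis ab : alpha * alpha^* = 1.
Implicit Types A E X Z : 'M[C]_n.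
Local Notation beta := (alpha^*).

Let two : (2 : C) != 0. Proof. by rewrite pnatr_eq0. Qed.

Lemma half_polarization m (p q : 'M[C]_(m, n)) (p' q' : 'M[C]_(n, m)) (X : 'M[C]_m) :
  2^-1 *: (p' + q') *m X *m (p - q) + (p' - q') *m X *m (2^-1 *: (p + q))
  = p' *m X *m p - q' *m X *m q.
Proof.
rewrite -!(scalemxAl, scalemxAr) !(mulmxDl, mulmxDr, mulmxN, mulNmx).
by apply/matrixP=> i j; rewrite !(addmxE, oppmxE, scalemxE); field.
Qed.

(** Since [alpha] has modulus one, the Stein operator of the pencil is the
    Lyapunov operator of its Cayley transform, up to congruence by [W]. *)
Lemma stein_difference A E X :
  let W := alpha *: E - beta *: A in let P := 2^-1 *: (alpha *: E + beta *: A) in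
  P^t* *m X *m W + W^t* *m X *m P = E^t* *m X *m E - A^t* *m X *m A /\
  P *m X *m W^t* + W *m X *m P^t* = E *m X *m E^t* - A *m X *m A^t*.
Proof.
have c2 : (2^-1 : C)^* = 2^-1 by rewrite fmorphV rmorph_nat.
move=> W P; rewrite /W /P !(adjmxD, adjmxN, adjmxZ) conjCK c2 !half_polarization.
by rewrite -!(scalemxAl, scalemxAr) !scalerA ![beta * alpha]mulrC ab !scale1r.
Qed.

Lemma riccati_quadratic m (V : 'M[C]_(n, m)) (M : 'M[C]_m) :
  M^t* = M -> M \in unitmx ->
  let F := - (invmx M *m V^t*) in
  V *m invmx M *m V^t* = F^t* *m M *m F /\ M *m F = - V^t*.
Proof.
move=> hM uM F; rewrite /F; split.
  rewrite adjmxN adjmxM adjmxK adjmx_inv hM mulNmx mulmxN mulNmx opprK.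
  by rewrite mulmxKV // mulmxA.
by rewrite mulmxN mulKVmx.
Qed.

(** The form [X] is transported to the state [x] of the standard system through
    [W x]; the sign changes because [cayley_A] is minus [W^-1] times
    the mean of [alpha E] and [beta A]. *)
Lemma care_of_ddtare A E m (B : 'M[C]_(n, m)) (Q : 'M[C]_n) (L : 'M[C]_(n, m))
    (M : 'M[C]_m) X :
  let W := alpha *: E - beta *: A in
  let Xh := - (W^t* *m X *m W) in
  let At := cayley_A alpha beta A E in
  let Bt := - (invmx W *m B) in
  let F := - (invmx M *m (B^t* *m X *m W + L^t*)) in
  W \in unitmx -> X^t* = X -> M^t* = M -> M \in unitmx ->
  E^t* *m X *m E - A^t* *m X *m A + Q
    - (W^t* *m X *m B + L) *m invmx M *m (L^t* + B^t* *m X *m W) = 0 ->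
  [/\ Xh^t* = Xh, M *m F = - (Bt^t* *m Xh + L^t*)
    & At^t* *m Xh + Xh *m At + Q - F^t* *m M *m F = 0].
Proof.
move=> W Xh At Bt F uW hX hM uM are; set V := W^t* *m X *m B + L.
have eV : V^t* = B^t* *m X *m W + L^t*.
  by rewrite /V adjmxD !adjmxM hX [W^t*^t*]adjmxK mulmxA.
have eXB : Xh *m Bt = W^t* *m X *m B.
  by rewrite /Xh /Bt mulNmx mulmxN opprK mulmxA mulmxK.
have [q1 q2] := riccati_quadratic V hM uM.
have hXh : Xh^t* = Xh by rewrite /Xh adjmxN !adjmxM adjmxK hX mulmxA.
split=> //.
  rewrite /F -eV q2; congr (- _); rewrite eV; congr (_ + _).
  have := congr1 (fun N => N^t*) eXB; rewrite adjmxM hXh => ->.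
  by rewrite !adjmxM adjmxK hX mulmxA.
rewrite -are /F -eV -q1 [L^t* + _]addrC -eV; congr (_ + _ - _).
have [<- _] := stein_difference A E X; rewrite -/W; set P := 2^-1 *: _.
have eXA : Xh *m At = W^t* *m X *m P.
  by rewrite /Xh /At /cayley_A -/W -/P mulNmx mulmxN opprK mulmxA mulmxK.
rewrite eXA; congr (_ + _).
have := congr1 (fun N => N^t*) eXA; rewrite adjmxM hXh => ->.
by rewrite !adjmxM adjmxK hX mulmxA.
Qed.

(** In the dual equation [W] acts on the outside, so multiplying by [W^-1] and its
    adjoint leaves [Z] itself, with the opposite sign. *)
Lemma care_of_dual_ddtare A E p q (D : 'M[C]_(p, n)) (B1 : 'M[C]_(n, q))
    (L : 'M[C]_(n, p)) (M : 'M[C]_p) Z :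
  let W := alpha *: E - beta *: A in
  let V := W *m Z *m D^t* + L in
  let Zh := - Z in
  let At := cayley_A alpha beta A E in
  let Bt := - (invmx W *m B1) in
  let H := invmx W *m V *m invmx M in
  W \in unitmx -> Z^t* = Z -> M^t* = M -> M \in unitmx ->
  E *m Z *m E^t* - A *m Z *m A^t* + B1 *m B1^t* - V *m invmx M *m V^t* = 0 ->
  H *m M = - (Zh *m D^t* - invmx W *m L) /\
  At *m Zh + Zh *m At^t* + Bt *m Bt^t* - H *m M *m H^t* = 0.
Proof.
move=> W V Zh At Bt H uW hZ hM uM are.
have eH : H *m M = - (Zh *m D^t* - invmx W *m L).
  by rewrite /H mulmxKV // /V mulmxDr !mulmxA mulVmx // mul1mx /Zh mulNmx opprD opprK opprK.
split=> //; have := congr1 (fun N => invmx W *m N *m (invmx W)^t*) are.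
rewrite mulmx0 mul0mx => are'; rewrite -[RHS]are'.
have eA : At *m Zh + Zh *m At^t* = invmx W *m (E *m Z *m E^t* - A *m Z *m A^t*) *m (invmx W)^t*.
  pose P := 2^-1 *: (alpha *: E + beta *: A).
  have eP : P *m Z *m W^t* + W *m Z *m P^t* = E *m Z *m E^t* - A *m Z *m A^t*.
    by have [_] := stein_difference A E Z.
  have iW : W^t* *m (invmx W)^t* = 1%:M by rewrite -adjmxM mulVmx // adjmx1.
  rewrite -eP addrC mulmxDr mulmxDl !mulmxA mulVmx // mul1mx.
  rewrite -[_ *m W^t* *m _]mulmxA iW mulmx1.
  rewrite /At /cayley_A -/W -/P /Zh adjmxN adjmxM mulmxN mulNmx opprK mulNmx mulmxN opprK.
  by rewrite mulmxA addrC.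
rewrite mulmxDr mulmxDl [invmx W *m (_ + B1 *m _)]mulmxDr mulmxDl -eA.
congr (_ + _ + _).
  by rewrite /Bt adjmxN adjmxM mulNmx mulmxN opprK !mulmxA.
rewrite mulmxN mulNmx; congr (- _); rewrite {1}/H mulmxKV // /H adjmxM [(invmx M)^t*]adjmx_inv hM.
by rewrite [(invmx W *m V)^t*]adjmxM !mulmxA.
Qed.

End RiccatiCayley.

(** * Loops of rational matrices *)

Definition map_plant (K K' : fieldType) (f : K -> K') n m1 m2 p1 p2
    (P : plant K n m1 m2 p1 p2) : plant K' n m1 m2 p1 p2 :=
  Plant (map_mx f (plA P)) (map_mx f (plB1 P)) (map_mx f (plB2 P))
    (map_mx f (plC1 P)) (map_mx f (plC2 P)) (map_mx f (plD12 P)) (map_mx f (plD21 P)).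

Section MapLoop.
Variables (K K' : fieldType) (f : {rmorphism K -> K'}).

Lemma map_loop n k m1 m2 p1 p2 (P : plant K n m1 m2 p1 p2) (G : sys K k p2 m2) :
  map_sys f (loop P G) = loop (map_plant f P) (map_sys f G).
Proof.
rewrite /map_sys /loop /=.
by rewrite map_block_mx map_col_mx map_row_mx !(map_mxD, map_mxM).
Qed.

Lemma map_open_loop n m1 m2 p1 p2 (P : plant K n m1 m2 p1 p2) :
  map_sys f (open_loop P) = open_loop (map_plant f P).
Proof.
by rewrite /map_sys /open_loop /= map_block_mx map_col_mx map_row_mx !map_mx0.
Qed.

Lemma map_inverse_plant n m2 p2 (P : plant K n p2 m2 m2 p2) :
  map_plant f (inverse_plant P) = inverse_plant (map_plant f P).
Proof.
rewrite /map_plant /inverse_plant /=.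
by rewrite !(map_mxB, map_mxN, map_mxM, map_invmx).
Qed.

End MapLoop.

Section RationalLoop.
Variables (R : realType) (alpha : R[i]).
Hypothesis halpha : `|alpha| = 1.
Local Notation C := R[i].
Local Notation F := (ratfunc R).

Section Plant.
Variables (n k m1 m2 p1 p2 : nat) (P : plant C n m1 m2 p1 p2) (G : sys C k p2 m2).

Let nonpole_loop : nonpole (svar alpha) (sysA (loop (map_plant (embed R) P) (map_sys (embed R) G))).
Proof.
have e := congr1 (fun L => sysA L) (map_loop (embed R) P G).
rewrite -e; exact: nonpole_svar.
Qed.

(** Over the field of rational functions there are no exceptional frequencies:
    [nonpole_svar] supplies all hypotheses. *)
Lemma rtransfer_well_posed :
  1%:M - drsubmx (rtransfer alpha (open_loop P)) *m rtransfer alpha G \in unitmx.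
Proof.
rewrite /rtransfer map_open_loop; apply: loop_well_posed; [exact: nonpole_svar..|].
exact: nonpole_loop.
Qed.

Lemma LFT_rtransfer :
  LFT (rtransfer alpha (open_loop P)) (rtransfer alpha G) = rtransfer alpha (loop P G).
Proof.
rewrite /rtransfer map_open_loop map_loop; apply: LFT_loop; [exact: nonpole_svar..|].
exact: nonpole_loop.
Qed.

End Plant.

Lemma rtransfer_inverse_left n k m2 p2 (P : plant C n p2 m2 m2 p2) (G : sys C k p2 m2) :
  plD12 P \in unitmx -> plD21 P \in unitmx ->
  rtransfer alpha (loop (inverse_plant P) (loop P G)) = rtransfer alpha G.
Proof.
move=> uS uT; rewrite /rtransfer map_loop map_inverse_plant map_loop.
have uS' : plD12 (map_plant (embed R) P) \in unitmx by rewrite map_unitmx.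
have uT' : plD21 (map_plant (embed R) P) \in unitmx by rewrite map_unitmx.
apply: transfer_inverse_left uS' uT' _ _ _.
- have := nonpole_svar halpha (plA P - plB2 P *m invmx (plD12 P) *m plC1 P).
  by rewrite const_ratmxE map_mxB !map_mxM map_invmx.
- exact: nonpole_svar.
have := nonpole_svar halpha (sysA (loop (inverse_plant P) (loop P G))).
have e := congr1 (fun L => sysA L) (map_loop (embed R) (inverse_plant P) (loop P G)).
by rewrite const_ratmxE [map_mx _ _]e map_inverse_plant map_loop.
Qed.

End RationalLoop.

(** * The stabilized plant *)

Section Stabilized.
Variable R : realType.
Local Notation C := R[i].
Variables (n m1 m2 p1 p2 : nat) (T : plant C n m1 m2 p1 p2) (X Z : 'M[C]_n).
Variables (F1 : 'M[C]_(m1, n)) (F2 : 'M[C]_(m2, n)).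
Variables (H1 : 'M[C]_(n, m2)) (H2 : 'M[C]_(n, p2)) (S : 'M[C]_m2) (U : 'M[C]_p2).
Hypothesis uS : S \in unitmx.
Hypothesis uU : U \in unitmx.
Hypothesis hS : S^t* = S.
Hypothesis hU : U^t* = U.
Hypothesis SS : S *m S = (plD12 T)^t* *m plD12 T.
Hypothesis UU : U *m U = plD21 T *m (plD21 T)^t*.

Let T1 := square_plant T F1 F2 S.
Let T2 := dual_square_plant T1 H1 H2 U.

Hypothesis hX : X^t* = X.
Hypothesis X_ge0 : forall v : 'cV[C]_n, 0 <= complex.Re ((v^t* *m X *m v) 0 0).
Hypothesis eF1 : F1 = (plB1 T)^t* *m X.
Hypothesis eF2 : (plD12 T)^t* *m plD12 T *m F2
  = - ((plB2 T)^t* *m X + (plD12 T)^t* *m plC1 T).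
Hypothesis riccatiX : (plA T)^t* *m X + X *m plA T + (plC1 T)^t* *m plC1 T
  + F1^t* *m F1 - F2^t* *m ((plD12 T)^t* *m plD12 T) *m F2 = 0.
Hypothesis stabX : Hurwitz (plA T + plB1 T *m F1 + plB2 T *m F2).

Hypothesis hZ : Z^t* = Z.
Hypothesis Z_ge0 : forall v : 'cV[C]_n, 0 <= complex.Re ((v^t* *m Z *m v) 0 0).
Hypothesis eH1 : H1 = Z *m (plC1 T1)^t*.
Hypothesis eH2 : H2 *m (plD21 T *m (plD21 T)^t*)
  = - (Z *m (plC2 T1)^t* + plB1 T *m (plD21 T)^t*).
Hypothesis riccatiZ : plA T1 *m Z + Z *m (plA T1)^t* + plB1 T *m (plB1 T)^t*
  + H1 *m H1^t* - H2 *m (plD21 T *m (plD21 T)^t*) *m H2^t* = 0.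
Hypothesis stabZ : Hurwitz (plA T1 + H1 *m plC1 T1 + H2 *m plC2 T1).

(** Both reductions together: the new plant has invertible feedthroughs from [u]
    to [z] and from [w] to [y], the square roots. *)
Lemma stabilized_loop k (K : sys C k p2 m2) :
  stable_contraction (loop T K) <-> stable_contraction (loop T2 K).
Proof.
rewrite (riccati_step K hX X_ge0 uS hS SS eF1 eF2 riccatiX stabX).
exact: (@riccati_step_dual R n k m1 m2 m2 p2 T1 K Z U H1 H2 hZ Z_ge0 uU hU UU
  eH1 eH2 riccatiZ stabZ).
Qed.

(** The two hidden modes are governed by exactly the two matrices stabilized by
    the Riccati solutions. *)
Lemma stabilized_inverse k (Q : sys C k p2 m2) :
  stable_contraction Q -> stable_contraction (loop T (loop (inverse_plant T2) Q)).
Proof.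
move=> cQ; apply/stabilized_loop.
apply: (@stable_contraction_inverse R n k m2 p2 T2 Q uS uU _ _ cQ).
  have -> : plA T2 - plB1 T2 *m invmx (plD21 T2) *m plC2 T2
      = plA T1 + H1 *m plC1 T1 + H2 *m plC2 T1.
    by rewrite [plB1 T2 *m _]mulNmx [H2 *m U *m _]mulmxK // mulNmx opprK.
  exact: stabZ.
have -> : plA T2 - plB2 T2 *m invmx (plD12 T2) *m plC1 T2
    = plA T + plB1 T *m F1 + plB2 T *m F2.
  rewrite [plC1 T2]/= -mulmxA mulmxN mulKmx // mulmxN opprK.
  rewrite /= mulmxDl mulmxN -[H1 *m S *m F2]mulmxA.
  rewrite [_ *m F2 + _]addrC addrA addrNK //.
exact: stabX.
Qed.

End Stabilized.

(** * The control problem for standard systems *)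

(** The pole pencil of the interconnection is a block diagonal pencil with a
    feedback [M (a - b z)], which the Cayley transform turns into a perturbation by
    [- W^-1 M]. *)
Lemma sysA_closed_loop (F : fieldType) (a b : F) n k m2 p2 (A E : 'M[F]_n) (B2 : 'M[F]_(n, m2))
    (C2 : 'M[F]_(p2, n)) (AK EK : 'M[F]_k) (BK : 'M[F]_(k, p2)) (CK : 'M[F]_(m2, k))
    (DK : 'M[F]_(m2, p2)) :
  a * b = 1 -> (2 : F) != 0 ->
  let W := a *: E - b *: A in let WK := a *: EK - b *: AK in
  let Ab := block_mx (A + a *: (B2 *m DK *m C2)) (a *: (B2 *m CK))
                     (a *: (BK *m C2)) AK in
  let Eb := block_mx (E + b *: (B2 *m DK *m C2)) (b *: (B2 *m CK))
                     (b *: (BK *m C2)) EK in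
  (a *: Eb - b *: Ab \in unitmx) = (W \in unitmx) && (WK \in unitmx) /\
  (W \in unitmx -> WK \in unitmx -> cayley_A a b Ab Eb =
    block_mx (cayley_A a b A E - invmx W *m B2 *m DK *m C2)
      (- (invmx W *m B2) *m CK) (- (invmx WK *m BK) *m C2) (cayley_A a b AK EK)).
Proof.
move=> ab two W WK Ab Eb.
pose M := block_mx (B2 *m DK *m C2) (B2 *m CK) (BK *m C2) 0.
have eA : Ab = block_mx A 0 0 AK + a *: M.
  by rewrite /Ab scale_block_mx add_block_mx !add0r scaler0 addr0.
have eE : Eb = block_mx E 0 0 EK + b *: M.
  by rewrite /Eb scale_block_mx add_block_mx !add0r scaler0 addr0.
have [eW eC] := cayley_A_feedback (block_mx A 0 0 AK) (block_mx E 0 0 EK) M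
  ab two.
have eWb : a *: block_mx E 0 0 EK - b *: block_mx A 0 0 AK = block_mx W 0 0 WK.
  by rewrite !scale_block_mx opp_block_mx add_block_mx !scaler0 !oppr0 !addr0.
have iWb : W \in unitmx -> WK \in unitmx ->
    invmx (block_mx W 0 0 WK) = block_mx (invmx W) 0 0 (invmx WK).
  move=> uW uWK; have e : block_mx W 0 0 WK *m block_mx (invmx W) 0 0 (invmx WK) = 1%:M.
    by rewrite mulmx_block !mulmx0 !mul0mx !addr0 !add0r !mulmxV // -scalar_mx_block.
  have [u _] := mulmx1_unit e; rewrite -[LHS]mulmx1 -e mulmxA mulVmx // mul1mx //.
rewrite eA eE eW eWb; split.
  by rewrite unitmxE det_ublock unitrM -!unitmxE.
move=> uW uWK; rewrite eC eWb iWb // /cayley_A eWb iWb //.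
rewrite !scale_block_mx add_block_mx !scaler0 !addr0 scale_block_mx !scaler0.
rewrite /M !mulmx_block opp_block_mx !mulmx0 !mul0mx !addr0 !add0r.
by rewrite opp_block_mx add_block_mx !oppr0 !add0r !addr0 !mulNmx !mulmxA.
Qed.

Section Problem.
Variables (R : realType) (alpha : R[i]).
Hypothesis halpha : `|alpha| = 1.
Local Notation C := R[i].
Local Notation beta := (alpha^*).

Section Solve.
Variables (n m1 m2 p1 p2 : nat) (A E : 'M[C]_n).
Variables (B1 : 'M[C]_(n, m1)) (B2 : 'M[C]_(n, m2)).
Variables (C1 : 'M[C]_(p1, n)) (C2 : 'M[C]_(p2, n)).
Variables (D12 : 'M[C]_(p1, m2)) (D21 : 'M[C]_(p2, m1)).
Let W := alpha *: E - beta *: A.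
Hypothesis uW : W \in unitmx.

Definition cayley_plant : plant C n m1 m2 p1 p2 :=
  Plant (cayley_A alpha beta A E) (- (invmx W *m B1)) (- (invmx W *m B2)) C1 C2 D12 D21.

Lemma centered_open_loop :
  centered_system alpha A E (row_mx B1 B2) (col_mx C1 C2) (block_mx 0 D12 D21 0)
  = rtransfer alpha (open_loop cayley_plant).
Proof.
rewrite (centered_systemE halpha _ _ _ uW); congr rtransfer.
by rewrite /cayley_sys /open_loop /= mul_mx_row opp_row_mx.
Qed.

Lemma sysA_loop_cayley k (AK EK : 'M[C]_k) (BK : 'M[C]_(k, p2)) (CK : 'M[C]_(m2, k))
    (DK : 'M[C]_(m2, p2)) :
  alpha *: EK - beta *: AK \in unitmx ->
  cayley_A alpha beta
    (block_mx (A + alpha *: (B2 *m DK *m C2)) (alpha *: (B2 *m CK))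
              (alpha *: (BK *m C2)) AK)
    (block_mx (E + beta *: (B2 *m DK *m C2)) (beta *: (B2 *m CK))
              (beta *: (BK *m C2)) EK)
  = sysA (loop cayley_plant (cayley_sys alpha beta AK EK BK CK DK)).
Proof.
move=> uWK; have [_ ->] := sysA_closed_loop A E B2 C2 AK EK BK CK DK (alpha_beta halpha)
  (two_neq0 R); [|exact: uW|exact: uWK].
by rewrite /= !mulNmx.
Qed.

(** Minimality disappears from the condition: any realization of the controller
    that stabilizes the loop contains a minimal one ([minimal_stable]). *)
Lemma stable_closed_loopP (K : 'M[ratfunc R]_(m2, p2)) :
  stable_closed_loop alpha A E B2 C2 K <->
  exists k (G : sys C k p2 m2),
    K = rtransfer alpha G /\ Hurwitz (sysA (loop cayley_plant G)).
Proof.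
split=> [[k [AK [EK [BK [CK [DK [[[_ eK] _] st]]]]]]]|[k [G [-> hG]]]].
  have [uWb hb] := proj1 (stable_pencil_cayley halpha _ _) st.
  have [eu _] := sysA_closed_loop A E B2 C2 AK EK BK CK DK
    (alpha_beta halpha) (two_neq0 R).
  have uWK : alpha *: EK - beta *: AK \in unitmx.
    by move: uWb; rewrite eu => /andP[].
  exists k, (cayley_sys alpha beta AK EK BK CK DK); split.
    by rewrite eK; exact: centered_systemE.
  by rewrite -sysA_loop_cayley.
have [k' [G' [hG' _ min]]] := minimal_stable halpha hG.
exists k', (pencil_A alpha (sysA G')), (pencil_E alpha (sysA G')), (sysB G'), (sysC G'), (sysD G').
split; first exact: min.
apply/(stable_pencil_cayley halpha); split.
  have [-> _] := sysA_closed_loop A E B2 C2 (pencil_A alpha (sysA G'))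
    (pencil_E alpha (sysA G')) (sysB G') (sysC G') (sysD G')
    (alpha_beta halpha) (two_neq0 R).
  by rewrite -/W uW; exact: pencil_W.
rewrite sysA_loop_cayley; last exact: pencil_W.
by rewrite pencilK.
Qed.

(** From here on no pencil is left in the problem; analyticity at the center and
    well-posedness hold for every loop of standard systems. *)
Lemma solves_stable_contraction (K : 'M[ratfunc R]_(m2, p2)) :
  solves_suboptimal_Hinf alpha (rtransfer alpha (open_loop cayley_plant)) A E B2 C2 K <->
  exists k (G : sys C k p2 m2),
    K = rtransfer alpha G /\ stable_contraction (loop cayley_plant G).
Proof.
split=> [[_ _ /stable_closed_loopP [k [G [-> hG]]]]|[k [G [eK cG]]]].
  rewrite (LFT_rtransfer halpha) => nG; exists k, G; split; first by [].
  by apply/(stable_contractionE halpha).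
have [hG nG] := proj1 (stable_contractionE halpha _) cG; rewrite eK; split.
- apply/ratmx_analyticP; exists (pencil_value alpha G (alpha / beta)).
  by apply: (rtransfer_value_pencil halpha); exact: pencil_unit_center.
- exact: rtransfer_well_posed.
- by apply/stable_closed_loopP; exists k, G.
- by rewrite (LFT_rtransfer halpha).
Qed.

End Solve.
End Problem.

(** * Assembling the parametrization *)

(** At the center the input column of the pencil vanishes, so the rank
    conditions there concern the feedthrough alone. *)
Lemma feedthrough_injective (F : fieldType) n p m (M : 'M[F]_n) (D : 'M[F]_(p, n))
    (H : 'M[F]_(p, m)) (v : 'cV[F]_m) :
  \rank (block_mx M 0 D H) = (n + m)%N -> H *m v = 0 -> v = 0.
Proof.
move=> rk Hv; have /row_fullP [N NB] : row_full (block_mx M 0 D H) by apply/eqP.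
have : block_mx M 0 D H *m col_mx 0 v = 0.
  by rewrite mul_block_col !mulmx0 mul0mx Hv !addr0 col_mx0.
move/(congr1 (mulmx N)); rewrite mulmxA NB mul1mx mulmx0 -col_mx0.
by case/eq_col_mx.
Qed.

Lemma feedthrough_surjective (F : fieldType) n p m (M : 'M[F]_n) (D : 'M[F]_(p, n))
    (H : 'M[F]_(p, m)) (u : 'rV[F]_p) : M \in unitmx ->
  \rank (block_mx M 0 D H) = (n + p)%N -> u *m H = 0 -> u = 0.
Proof.
move=> uM rk uH; have /row_freeP [N BN] : row_free (block_mx M 0 D H) by apply/eqP.
have : row_mx (- (u *m D *m invmx M)) u *m block_mx M 0 D H = 0.
  by rewrite mul_row_block mulmx0 mulNmx mulmxKV // addNr uH addr0 row_mx0.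
move/(congr1 (mulmx^~ N)); rewrite /= -[_ *m N]mulmxA BN mulmx1 mul0mx -row_mx0.
by case/eq_row_mx.
Qed.

Section SplitFeedback.
Variable C : numClosedFieldType.

Lemma split_feedback n m1 m2 (B1 : 'M[C]_(n, m1)) (B2 : 'M[C]_(n, m2)) (X : 'M[C]_n)
    (L : 'M[C]_(n, m2)) (M : 'M[C]_m2) (F : 'M[C]_(m1 + m2, n)) :
  block_mx (- 1%:M) 0 0 M *m F = - ((row_mx B1 B2)^t* *m X + (row_mx 0 L)^t*) ->
  [/\ usubmx F = B1^t* *m X, M *m dsubmx F = - (B2^t* *m X + L^t*)
    & F^t* *m block_mx (- 1%:M) 0 0 M *m F
      = - ((usubmx F)^t* *m usubmx F) + (dsubmx F)^t* *m M *m dsubmx F].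
Proof.
rewrite -[F]vsubmxK col_mxKu col_mxKd; set F1 := usubmx F; set F2 := dsubmx F.
rewrite !adj_row_mx mul_block_col !mul0mx addr0 add0r mulNmx mul1mx.
rewrite mul_col_mx add_col_mx adjmx0 addr0 opp_col_mx => e; split.
- by case/eq_col_mx: e => /oppr_inj.
- by case/eq_col_mx: e.
rewrite adj_col_mx mul_row_block !mulmx0 addr0 add0r mulmxN mulmx1 mul_row_col.
by rewrite mulNmx.
Qed.

Lemma split_injection n p1 p2 (D1 : 'M[C]_(p1, n)) (D2 : 'M[C]_(p2, n)) (Z : 'M[C]_n)
    (L : 'M[C]_(n, p2)) (M : 'M[C]_p2) (H : 'M[C]_(n, p1 + p2)) :
  H *m block_mx (- 1%:M) 0 0 M = - (Z *m (col_mx D1 D2)^t* - row_mx 0 L) ->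
  [/\ lsubmx H = Z *m D1^t*, rsubmx H *m M = - (Z *m D2^t* - L)
    & H *m block_mx (- 1%:M) 0 0 M *m H^t*
      = - (lsubmx H *m (lsubmx H)^t*) + rsubmx H *m M *m (rsubmx H)^t*].
Proof.
rewrite -[H]hsubmxK row_mxKl row_mxKr; set H1 := lsubmx H; set H2 := rsubmx H.
rewrite adj_col_mx mul_row_block !mulmx0 addr0 add0r mulmxN mulmx1.
rewrite mul_mx_row opp_row_mx add_row_mx oppr0 addr0 opp_row_mx => e; split.
- by case/eq_row_mx: e => /oppr_inj.
- by case/eq_row_mx: e.
rewrite adj_row_mx mul_row_col.
by rewrite mulNmx.
Qed.

Lemma signed_block n m (M : 'M[C]_m) : M^t* = M -> M \in unitmx ->
  let N := block_mx (- 1%:M : 'M[C]_n) 0 0 M in N^t* = N /\ N \in unitmx.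
Proof.
move=> hM uM N; split.
  by rewrite /N adj_block_mx adjmxN adjmx1 !adjmx0 hM.
rewrite unitmxE det_ublock unitrM -!unitmxE uM andbT.
by rewrite -scaleN1r unitmxZ ?unitmx1 // unitrN unitr1.
Qed.

End SplitFeedback.

Section Definiteness.
Variable R : realType.
Local Notation C := R[i].

Lemma posdef_gram p m (D : 'M[C]_(p, m)) :
  (forall v : 'cV[C]_m, D *m v = 0 -> v = 0) -> posdef (D^t* *m D).
Proof.
move=> inj; split; first by apply/hermP; exact: gram_adj.
move=> v v0; rewrite sqn_gram -[X in X < _]/(0%:C%C) ltcR; apply: sqn_gt0.
by apply: contra_neq v0 => /inj.
Qed.

Lemma negsemidef_Re n (X : 'M[C]_n) (v : 'cV[C]_n) : negsemidef X ->
  0 <= complex.Re ((v^t* *m - X *m v) 0 0).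
Proof.
move=> [_ /(_ v)]; rewrite lecE => /andP[_].
by rewrite mulmxN mulNmx oppmxE cReN oppr_ge0.
Qed.

End Definiteness.

(** The inverse of the stabilized plant is the generator of the controllers. *)
Lemma inverse_stabilized (R : realType) n m1 m2 p1 p2 (T : plant R[i] n m1 m2 p1 p2)
    (F1 : 'M[R[i]]_(m1, n)) (F2 : 'M[R[i]]_(m2, n)) (H1 : 'M[R[i]]_(n, m2))
    (H2 : 'M[R[i]]_(n, p2)) (S : 'M[R[i]]_m2) (U : 'M[R[i]]_p2) :
  S \in unitmx -> U \in unitmx ->
  let CF := plC2 T + plD21 T *m F1 in
  inverse_plant (dual_square_plant (square_plant T F1 F2 S) H1 H2 U)
  = Plant (plA T + (plB1 T *m F1 + plB2 T *m F2) + H2 *m CF)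
      H2 (- (plB2 T *m invmx S) - H1) (- F2) (invmx U *m CF) (invmx S) (invmx U).
Proof.
move=> uS uU CF; rewrite /inverse_plant /=; congr Plant.
- rewrite !mulNmx mulmxK // opprK; congr (_ + _).
  rewrite !mulmxN opprK -[_ *m invmx S *m _]mulmxA mulKmx // mulmxDl -[H1 *m S *m F2]mulmxA.
  by rewrite [_ *m F2 + _]addrC addrA addrNK addrA.
- by rewrite mulNmx mulmxK // opprK.
- by rewrite mulmxDl mulmxK // opprD.
- by rewrite mulmxN mulKmx.
Qed.

(** * The Riccati data in the left half-plane *)

Section PencilRiccati.
Variables (R : realType) (alpha : R[i]) (n : nat) (A E : 'M[R[i]]_n).
Hypothesis halpha : `|alpha| = 1.
Local Notation C := R[i].
Local Notation beta := (alpha^*).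
Let W := alpha *: E - beta *: A.
Hypothesis uW : W \in unitmx.

(** Splitting the feedback into its two blocks turns the equation with the
    indefinite weight into the hypotheses of [riccati_step]: a maximizing
    disturbance [F1 x] and a minimizing control [F2 x]. *)
Lemma control_care m1 m2 p1 (B1 : 'M[C]_(n, m1)) (B2 : 'M[C]_(n, m2))
    (C1 : 'M[C]_(p1, n)) (D12 : 'M[C]_(p1, m2)) (X : 'M[C]_n) :
  let At := cayley_A alpha beta A E in
  let Bt1 := - (invmx W *m B1) in let Bt2 := - (invmx W *m B2) in
  let B := row_mx B1 B2 in
  let L : 'M[C]_(n, m1 + m2) := row_mx 0 (C1^t* *m D12) in
  let R12 := D12^t* *m D12 in
  let M : 'M[C]_(m1 + m2) := block_mx (- 1%:M) 0 0 R12 in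
  let F := feedback alpha A E B L M X in
  R12 \in unitmx -> ddtare_stabilizing alpha A E B (C1^t* *m C1) L M X -> negsemidef X ->
  exists2 Xh : 'M[C]_n,
    [/\ Xh^t* = Xh, forall v : 'cV[C]_n, 0 <= complex.Re ((v^t* *m Xh *m v) 0 0),
        usubmx F = Bt1^t* *m Xh & R12 *m dsubmx F = - (Bt2^t* *m Xh + D12^t* *m C1)] &
    At^t* *m Xh + Xh *m At + C1^t* *m C1 + (usubmx F)^t* *m usubmx F
      - (dsubmx F)^t* *m R12 *m dsubmx F = 0 /\
    Hurwitz (At + Bt1 *m usubmx F + Bt2 *m dsubmx F).
Proof.
move=> At Bt1 Bt2 B L R12 M F uR [/hermP hX are st] neg.
have hR : R12^t* = R12 by exact: gram_adj.
have [hM uM] := signed_block m1 hR uR.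
have [hXh eF ric] := care_of_ddtare (alpha_beta halpha) uW hX hM uM are.
have eBt : - (invmx W *m B) = row_mx Bt1 Bt2 by rewrite mul_mx_row opp_row_mx.
exists (- (W^t* *m X *m W)).
  rewrite -/W eBt in eF; have [e1 e2 _] := split_feedback eF; split.
  - exact: hXh.
  - move=> v; have := negsemidef_Re (W *m v) neg.
    by rewrite adjmxM !mulmxN !mulNmx !mulmxA.
  - exact: e1.
  - by rewrite e2 adjmxM adjmxK.
rewrite -/W eBt in eF; have [e1 e2 e3] := split_feedback eF.
split; first by rewrite -ric -/F e3 opprD opprK addrA.
have [_] := proj1 (stable_pencil_cayley halpha _ _) st.
have [_ ->] := cayley_A_feedback A E (B *m F) (alpha_beta halpha) (two_neq0 R).
rewrite -/W -[F in B *m F]vsubmxK mul_row_col mulmxDr opprD addrA.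
by rewrite /Bt1 /Bt2 !mulNmx !mulmxA.
Qed.

(** The dual statement, for the plant left by the first reduction; the feedback
    from the disturbance changes neither [W] nor, therefore, the transport to the
    left half-plane. *)
Lemma filter_care m1 p2 m2 (B1 : 'M[C]_(n, m1)) (F1 : 'M[C]_(m1, n))
    (CO1 : 'M[C]_(m2, n)) (CF : 'M[C]_(p2, n)) (D21 : 'M[C]_(p2, m1)) (Z : 'M[C]_n) :
  let Bt1 := - (invmx W *m B1) in
  let At := cayley_A alpha beta A E + Bt1 *m F1 in
  let AO := A + alpha *: (B1 *m F1) in let EO := E + beta *: (B1 *m F1) in
  let CO := col_mx CO1 CF in
  let L : 'M[C]_(n, m2 + p2) := row_mx 0 (B1 *m D21^t*) in
  let R21 := D21 *m D21^t* in
  let M : 'M[C]_(m2 + p2) := block_mx (- 1%:M) 0 0 R21 in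
  let H1 := - Z *m CO1^t* in
  let H2 := invmx W *m ((B1 *m D21^t* + W *m Z *m CF^t*) *m invmx R21) in
  R21 \in unitmx ->
  dual_ddtare_stabilizing alpha AO EO CO (B1 *m B1^t*) L M Z -> negsemidef Z ->
  [/\ (- Z)^t* = - Z, forall v : 'cV[C]_n, 0 <= complex.Re ((v^t* *m - Z *m v) 0 0),
      H2 *m R21 = - (- Z *m CF^t* + Bt1 *m D21^t*),
      At *m - Z + - Z *m At^t* + Bt1 *m Bt1^t* + H1 *m H1^t* - H2 *m R21 *m H2^t* = 0
    & Hurwitz (At + H1 *m CO1 + H2 *m CF)].
Proof.
move=> Bt1 At AO EO CO L R21 M H1 H2 uR [/hermP hZ are st] neg.
have hR : R21^t* = R21 by rewrite /R21 adjmxM adjmxK.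
have [hM uM] := signed_block m2 hR uR.
have [eWO eAO] := cayley_A_feedback A E (B1 *m F1) (alpha_beta halpha) (two_neq0 R).
have eAt : cayley_A alpha beta AO EO = At.
  by rewrite [LHS]eAO -/W /At /Bt1 mulNmx mulmxA.
have uWO : alpha *: EO - beta *: AO \in unitmx by rewrite eWO.
have := care_of_dual_ddtare (alpha_beta halpha) uWO hZ hM uM are.
rewrite eWO eAt -/W; set H := invmx W *m (W *m Z *m CO^t* + L) *m invmx M => -[eH ric].
have eH' : H *m M = - (- Z *m CO^t* - row_mx 0 (invmx W *m (B1 *m D21^t*))).
  by rewrite eH mul_mx_row mulmx0.
have [e1 e2 e3] := split_injection eH'.
have eH1 : lsubmx H = H1 by [].
have eH2 : rsubmx H = H2.
  rewrite -[LHS](mulmxK uR) e2 /H2 !mulmxA; congr (_ *m _).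
  by rewrite opprD opprK mulNmx opprK mulmxDr !mulmxA mulVmx // mul1mx addrC.
split.
- by rewrite adjmxN hZ.
- by move=> v; exact: negsemidef_Re.
- by rewrite -eH2 e2 [Bt1 *m _]mulNmx !mulmxA.
- by rewrite e3 eH1 eH2 opprD opprK in ric; rewrite -[LHS]addrA.
have [_] := proj1 (stable_pencil_cayley halpha _ _) st.
have [_ ->] := cayley_A_feedback AO EO
  (dual_feedback alpha AO EO CO L M Z *m CO) (alpha_beta halpha) (two_neq0 R).
rewrite eWO -/W eAt /dual_feedback eWO -/W mulNmx mulmxN opprK !mulmxA -/H.
by rewrite -[H]hsubmxK eH1 eH2 mul_row_col addrA.
Qed.

End PencilRiccati.

Lemma BHinf0 (R : realType) (alpha : R[i]) (halpha : `|alpha| = 1) p m :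
  BHinf (0 : 'M[ratfunc R]_(p, m)).
Proof.
apply/(BHinfP halpha); exists 0%N, (sys_const 0); split.
  have c0 : contractive (0 : 'M[R[i]]_(p, m)).
    by move=> u u0; rewrite mul0mx sqn0; exact: sqn_gt0.
  split; last exact: c0.
    by move=> s _; rewrite /nonpole unitmxE det_mx00 unitr1.
  by move=> s _; rewrite transfer_const; exact: c0.
rewrite /rtransfer /map_sys /= !map_mx0; exact/esym/transfer_const.
Qed.

Local Open Scope classical_set_scope.
Local Open Scope ring_scope.

Theorem theorem8 (R : realType) (alpha : R[i]) (halpha : `|alpha| = 1)
  (n p1 p2 m1 m2 : nat)
  (T : 'M[ratfunc R]_(p1 + p2, m1 + m2))
  (A E : 'M[R[i]]_n) (B1 : 'M[R[i]]_(n, m1)) (B2 : 'M[R[i]]_(n, m2))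
  (C1 : 'M[R[i]]_(p1, n)) (C2 : 'M[R[i]]_(p2, n))
  (D12 : 'M[R[i]]_(p1, m2)) (D21 : 'M[R[i]]_(p2, m1))
  (hT : minimal_realization alpha T A E
          (row_mx B1 B2) (col_mx C1 C2) (block_mx 0 D12 D21 0))
  (hz0 : ~ gen_eigenvalues A E (Some (center_point alpha)))
  (hstab : stabilizable A E B2) (hdet : detectable C2 A E)
  (hrank12 : forall t : R, 0 <= t < 2 * pi ->
     \rank (block_mx (A - expi t *: E)%R ((alpha - alpha^* * expi t) *: B2)%R
                     C1 D12) = (n + m2)%N)
  (hrank21 : forall t : R, 0 <= t < 2 * pi ->
     \rank (block_mx (A - expi t *: E)%R ((alpha - alpha^* * expi t) *: B1)%R
                     C2 D21) = (n + p2)%N)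
  (X Z : 'M[R[i]]_n) :
  let beta := alpha^* in
  let B := row_mx B1 B2 in
  let W := alpha *: E - beta *: A in
  let R12 := D12^t* *m D12 in
  let R21 := D21 *m D21^t* in
  (* data of Sigma_c *)
  let Lc : 'M[R[i]]_(n, m1 + m2) := row_mx 0 (C1^t* *m D12) in
  let Rc : 'M[R[i]]_(m1 + m2) := block_mx (- 1%:M) 0 0 R12 in
  ddtare_stabilizing alpha A E B (C1^t* *m C1) Lc Rc X ->
  negsemidef X ->
  let Fc := feedback alpha A E B Lc Rc X in
  let F1 := usubmx Fc in
  let F2 := dsubmx Fc in
  let CF := C2 + D21 *m F1 in
  (* data of Sigma_x *)
  let AO := A + alpha *: (B1 *m F1) in
  let EO := E + beta *: (B1 *m F1) in
  let CO := col_mx (- (sqrtmx R12 *m F2)) CF in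
  let LO : 'M[R[i]]_(n, m2 + p2) := row_mx 0 (B1 *m D21^t*) in
  let RO : 'M[R[i]]_(m2 + p2) := block_mx (- 1%:M) 0 0 R21 in
  dual_ddtare_stabilizing alpha AO EO CO (B1 *m B1^t*) LO RO Z ->
  negsemidef Z ->
  let BZ := - ((B1 *m D21^t* + W *m Z *m CF^t*) *m invmx R21) in
  let M := B *m Fc + BZ *m CF in
  let Ctrl : 'M[ratfunc R]_(m2 + p2, p2 + m2) :=
    centered_system alpha (A + alpha *: M) (E + beta *: M)
      (row_mx BZ (- (B2 *m invmx (sqrtmx R12)) + W *m Z *m F2^t* *m sqrtmx R12))
      (col_mx (- F2) (invmx (sqrtmx R21) *m CF))
      (block_mx 0 (invmx (sqrtmx R12)) (invmx (sqrtmx R21)) 0) in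
  (exists K : 'M[ratfunc R]_(m2, p2),
      solves_suboptimal_Hinf alpha T A E B2 C2 K)
  /\ (forall K : 'M[ratfunc R]_(m2, p2),
      solves_suboptimal_Hinf alpha T A E B2 C2 K
      <-> exists2 Q : 'M[ratfunc R]_(m2, p2), BHinf Q & K = LFT Ctrl Q).
Proof.
move=> beta B W R12 R21 Lc Rc sX negX Fc F1 F2 CF AO EO CO LO RO sZ negZ BZ M Ctrl.
have ab := alpha_beta halpha; have b0 := beta_neq0 halpha.
have eAz := cayley_center ab A E; rewrite -/(center_point alpha) in eAz.
have uAz : A - center_point alpha *: E \in unitmx.
  by rewrite unitmxE unitfE; apply/eqP.
have uW : W \in unitmx.
  by move: uAz; rewrite eAz unitmxZ // unitrN unitrV unitfE.
(* The center lies on the circle, so the rank conditions apply there. *)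
have [t0 ht0 et0] := circle_expi (cabs_center halpha).
have az0 : alpha - beta * center_point alpha = 0.
  by rewrite /center_point mulrC divfK // subrr.
have rk12 := hrank12 t0 ht0; have rk21 := hrank21 t0 ht0.
rewrite -et0 -/(center_point alpha) az0 scale0r in rk12.
rewrite -et0 -/(center_point alpha) az0 scale0r in rk21.
have pR12 : posdef R12.
  by apply: posdef_gram => v; exact: feedthrough_injective rk12.
have pR21 : posdef R21.
  have -> : R21 = D21^t*^t* *m D21^t* by rewrite adjmxK.
  apply: posdef_gram => v hv.
  have : v^t* = 0.
    apply: (feedthrough_surjective uAz rk21).
    by have := congr1 (fun N => N^t*) hv; rewrite adjmxM adjmxK adjmx0.
  by move/(congr1 (fun N => N^t*)); rewrite adjmxK adjmx0.
have [hS uS SS] := sqrtmx_spec pR12; have [hU uU UU] := sqrtmx_spec pR21.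
have uR12 : R12 \in unitmx by rewrite -SS unitmx_mul uS.
have uR21 : R21 \in unitmx by rewrite -UU unitmx_mul uU.
have [Xh [hXh Xh0 eF1 eF2] [ricX stX]] := control_care halpha uW uR12 sX negX.
have [hZh Zh0 eH2 ricZ stZ] := filter_care halpha uW uR21 sZ negZ.
pose P := cayley_plant alpha A E B1 B2 C1 C2 D12 D21.
pose H1 := - Z *m (- (sqrtmx R12 *m F2))^t*.
pose H2 := invmx W *m ((B1 *m D21^t* + W *m Z *m CF^t*) *m invmx R21).
pose P2 := dual_square_plant (square_plant P F1 F2 (sqrtmx R12)) H1 H2 (sqrtmx R21).
(* P2 is what remains of the plant after both reductions; closing a controller K
   around P2 produces the parameter Q, and inverting P2 recovers K. *)
have eT : T = rtransfer alpha (open_loop P).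
  by case: hT => -[_ ->] _; exact: centered_open_loop.
have loopE k (K : sys R[i] k p2 m2) :
    stable_contraction (loop P K) <-> stable_contraction (loop P2 K).
  exact: (@stabilized_loop R n m1 m2 p1 p2 P Xh (- Z) F1 F2 H1 H2 _ _ uS uU hS hU SS UU
    hXh Xh0 eF1 eF2 ricX stX hZh Zh0 erefl eH2 ricZ stZ).
have loopI k (Q : sys R[i] k p2 m2) :
    stable_contraction Q -> stable_contraction (loop P (loop (inverse_plant P2) Q)).
  exact: (@stabilized_inverse R n m1 m2 p1 p2 P Xh (- Z) F1 F2 H1 H2 _ _ uS uU hS hU SS UU
    hXh Xh0 eF1 eF2 ricX stX hZh Zh0 erefl eH2 ricZ stZ).
have eC : Ctrl = rtransfer alpha (open_loop (inverse_plant P2)).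
  have [eWM eAM] := cayley_A_feedback A E M ab (two_neq0 R).
  have eH2' : - (invmx W *m BZ) = H2 by rewrite /BZ mulmxN opprK.
  rewrite /Ctrl (centered_systemE halpha); last by rewrite eWM; exact: uW.
  congr (rtransfer alpha _); rewrite /P2 (inverse_stabilized P F1 F2 H1 H2 uS uU).
  rewrite /cayley_sys eAM eWM -/beta -/W /open_loop /=; congr Sys.
    have e1 : - (invmx W *m (B *m Fc)) = - (invmx W *m B1) *m F1 - invmx W *m B2 *m F2.
      by rewrite -[Fc]vsubmxK mul_row_col mulmxDr opprD !mulNmx !mulmxA.
    have e2 : - (invmx W *m (BZ *m CF)) = H2 *m CF by rewrite mulmxA -mulNmx eH2'.
    rewrite [invmx W *m M]mulmxDr opprD e1 e2 [LHS]addrA.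
    by rewrite [- (invmx W *m B2) *m F2]mulNmx.
  rewrite mul_mx_row opp_row_mx eH2'; congr row_mx.
  rewrite [invmx W *m (_ + _)]mulmxDr opprD [invmx W *m - _]mulmxN opprK; congr (_ + _).
    by rewrite mulNmx opprK mulmxA.
  rewrite !mulmxA mulVmx // mul1mx /H1 [(- (sqrtmx R12 *m F2))^t*]adjmxN.
  by rewrite [(sqrtmx R12 *m F2)^t*]adjmxM hS mulmxN mulNmx opprK mulmxA.
have key (K : 'M[ratfunc R]_(m2, p2)) : solves_suboptimal_Hinf alpha T A E B2 C2 K <->
    exists2 Q : 'M[ratfunc R]_(m2, p2), BHinf Q & K = LFT Ctrl Q.
  rewrite eT eC; split.
    move=> /(solves_stable_contraction halpha B1 B2 C1 C2 D12 D21 uW) [k [G [eK cG]]].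
    exists (rtransfer alpha (loop P2 G)).
      apply/(BHinfP halpha); exists (n + k)%N, (loop P2 G); split; last reflexivity.
      exact: (proj1 (loopE k G) cG).
    rewrite (LFT_rtransfer halpha) eK; symmetry.
    exact: (rtransfer_inverse_left halpha G (P := P2) uS uU).
  move=> [Q /(BHinfP halpha) [k [G [cG ->]]] ->].
  rewrite (LFT_rtransfer halpha).
  apply/(solves_stable_contraction halpha B1 B2 C1 C2 D12 D21 uW).
  by exists (n + k)%N, (loop (inverse_plant P2) G); split; last exact: loopI.
split; last exact: key.
by exists (LFT Ctrl 0); apply/key; exists 0; first exact: (BHinf0 halpha).
Qed.
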